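(* Let $\phi$ solve the homogeneous wave equation $\Box_g\phi=0$ on a $(1+n)$-dimensional hyperspherical Schwarzschild manifold $(\mathcal{M},g)$ with $n\ge 4$. Then $$\sup_{t\ge 0}E[\phi](t)+\|\phi\|_{LE}^2\lesssim E[\phi](0).$$
   Context: Notation: $n\ge 4$, $d=n-3$, and $r_s>0$ is the Schwarzschild radius (so $r=r_s$ is the event horizon). $\log$ is the natural logarithm. $A\lesssim B$ means $A\le CB$ with a constant $C>0$ independent of $\phi$. The exterior of the $(1+n)$-dimensional hyperspherical Schwarzschild black hole is the manifold $\mathcal{M}=\mathbb{R}\times(r_s,\infty)\times\mathbb{S}^{d+2}$ (note $\mathbb{S}^{d+2}=\mathbb{S}^{n-1}$), with coordinates $(t,r,\omega)$ and Lorentzian metric $g$ given by the line element $$ds^2=-\Bigl(1-\Bigl(\frac{r_s}{r}\Bigr)^{d+1}\Bigr)dt^2+\Bigl(1-\Bigl(\frac{r_s}{r}\Bigr)^{d+1}\Bigr)^{-1}dr^2+r^2d\omega^2,$$ where $d\omega^2$ is the standard round metric on the unit sphere $\mathbb{S}^{d+2}$. In integrals, $d\omega$ denotes the standard surface measure on $\mathbb{S}^{d+2}$. The symbol $\not\nabla$ denotes the angular gradient, i.e. the gradient on the sphere of radius $r$ with its induced metric; thus $|\not\nabla\phi|^2=r^{-2}|\nabla_{\mathbb{S}^{d+2}}\phi|^2$ and $\not\nabla\cdot\not\nabla\phi=r^{-2}\Delta_{\mathbb{S}^{d+2}}\phi$, where $\nabla_{\mathbb{S}^{d+2}}$ and $\Delta_{\mathbb{S}^{d+2}}$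 are the gradient and Laplace–Beltrami operator of the unit round sphere. The d'Alembertian is $$\Box_g\phi=-\Bigl(1-\Bigl(\frac{r_s}{r}\Bigr)^{d+1}\Bigr)^{-1}\partial_t^2\phi+r^{-(d+2)}\partial_r\Bigl[r^{d+2}\Bigl(1-\Bigl(\frac{r_s}{r}\Bigr)^{d+1}\Bigr)\partial_r\phi\Bigr]+\not\nabla\cdot\not\nabla\phi.$$ The energy is $$E[\phi](t)=\int_{\mathbb{S}^{d+2}}\int_{r\ge r_s}\Bigl[\Bigl(1-\Bigl(\frac{r_s}{r}\Bigr)^{d+1}\Bigr)^{-1}(\partial_t\phi)^2(t,r,\omega)+\Bigl(1-\Bigl(\frac{r_s}{r}\Bigr)^{d+1}\Bigr)(\partial_r\phi)^2(t,r,\omega)+|\not\nabla\phi|^2(t,r,\omega)\Bigr]r^{d+2}\,dr\,d\omega.$$ The photon sphere is located at $r=r_{ps}$, where $r_{ps}=\bigl(\frac{d+3}{2}\bigr)^{\frac{1}{d+1}}r_s$. The localized energy norm is defined by $$\|\phi\|_{LE}^2=\int_0^\infty\int_{\mathbb{S}^{d+2}}\int_{r\ge r_s}\Bigl[c_r(r)\Bigl(1-\Bigl(\frac{r_s}{r}\Bigr)^{d+1}\Bigr)(\partial_r\phi)^2(t,r,\omega)+c_\omega(r)|\not\nabla\phi|^2(t,r,\omega)+c_0(r)\phi^2(t,r,\omega)\Bigr]r^{d+2}\,dr\,d\omega\,dt,$$ where $$c_r(r)=\frac{1}{r^{d+3}\Bigl(1-\log\bigl(\frac{r-r_s}{r}\bigr)\Bigr)^2},\qquad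 c_\omega(r)=\frac1r\Bigl(\frac{r-r_{ps}}{r}\Bigr)^2,$$ $$c_0(r)=\Bigl(\frac{r-r_s}{r}\Bigr)^{-1}\frac{1}{r^3\Bigl(1-\log\bigl(\frac{r-r_s}{r}\bigr)\Bigr)^4}.$$
   Formalization: The solution is additionally assumed to have initial data tending to 0 at spatial infinity along almost every direction, since nonzero constants solve the wave equation with zero energy but infinite localized energy norm. *)

(* Defs.v *)
From HB Require Import structures.
From mathcomp Require Import all_boot all_order all_algebra.
From mathcomp Require Import all_classical all_reals all_analysis.
From mathcomp Require Import measurable_realfun.
Import Order.TTheory GRing.Theory Num.Theory.
Import numFieldNormedType.Exports.

Set Implicit Arguments.
Unset Strict Implicit.
Unset Printing Implicit Defensive.

Local Open Scope classical_set_scope.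
Local Open Scope ring_scope.

(* R^n is 'rV[R]_n with the sigma-algebra generated by the n coordinates,
   i.e. the product, hence Borel, sigma-algebra. *)
Definition rV_display : measure_display. Proof. exact. Qed.

Section measurable_rV.
Context (R : realType) (n : nat).

Definition rV_coord (i : 'I_n) (x : 'rV[R]_n) : measurableTypeR R := x ord0 i.

Let rV_set0 : g_sigma_preimage rV_coord set0.
Proof. exact: sigma_algebra0. Qed.

Let rV_setC A : g_sigma_preimage rV_coord A -> g_sigma_preimage rV_coord (~` A).
Proof. exact: sigma_algebraC. Qed.

Let rV_bigcup (F : _^nat) : (forall i, g_sigma_preimage rV_coord (F i)) ->
  g_sigma_preimage rV_coord (\bigcup_i (F i)).
Proof. exact: sigma_algebra_bigcup. Qed.

HB.instance Definition _ := @isMeasurable.Build rV_display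
  'rV[R]_n (g_sigma_preimage rV_coord) rV_set0 rV_setC rV_bigcup.

Lemma measurable_rV_coord (i : 'I_n) : measurable_fun setT (rV_coord i).
Proof.
move=> _ Y mY; rewrite setTI; apply: sub_sigma_algebra => /=.
rewrite -bigcup_seq/=; exists i => /=; first by rewrite mem_index_enum.
by exists Y => //; rewrite setTI.
Qed.

Lemma measurable_fun_rVP d (T : measurableType d) (f : T -> 'rV[R]_n) :
  (forall i, measurable_fun setT (rV_coord i \o f)) -> measurable_fun setT f.
Proof.
move=> mf.
suff prefS : g_sigma_preimage (fun i => rV_coord i \o f) `<=` measurable.
  move=> _ A mA; apply: prefS.
  rewrite g_sigma_preimage_comp; by exists A.
apply: smallest_sub; first exact: sigma_algebra_measurable.
move=> A /=; rewrite -bigcup_seq /= => -[i _ [B mB <-]].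
exact: mf.
Qed.

End measurable_rV.

Section lebesgue_rV.
Context (R : realType).

Definition rV_cons n (p : measurableTypeR R * 'rV[R]_n) : 'rV[R]_n.+1 :=
  row_mx (p.1%:M : 'rV[R]_1) p.2.

Definition rV_uncons n (x : 'rV[R]_n.+1) : measurableTypeR R * 'rV[R]_n :=
  (x ord0 ord0, \row_j x ord0 (lift ord0 j)).

Lemma rV_consK n : cancel (@rV_cons n) (@rV_uncons n).
Proof.
case=> x v; rewrite /rV_uncons /rV_cons /=; congr (_, _).
  rewrite [LHS](_ : _ = row_mx (x%:M : 'rV[R]_1) v ord0 (lshift n ord0)).
    by rewrite row_mxEl mxE eqxx mulr1n.
  by congr (row_mx _ _ _ _); exact/val_inj.
apply/rowP => j; rewrite mxE.
rewrite [LHS](_ : _ = row_mx (x%:M : 'rV[R]_1) v ord0 (rshift 1 j)).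
  by rewrite row_mxEr.
by congr (row_mx _ _ _ _); exact/val_inj.
Qed.

Lemma measurable_rV_cons n : measurable_fun setT (@rV_cons n).
Proof.
apply: measurable_fun_rVP => i.
have [j ->|j ->] := split_ordP (i : 'I_(1 + n)).
  rewrite (_ : _ \o _ = fst) //.
  apply/funext => p; apply: etrans (row_mxEl _ _ _ _) _.
  by rewrite mxE !ord1 eqxx mulr1n.
rewrite (_ : _ \o _ = rV_coord j \o snd).
  by apply: measurableT_comp => //; exact: measurable_rV_coord.
by apply/funext => p; exact: row_mxEr.
Qed.

Lemma measurable_rV_uncons n : measurable_fun setT (@rV_uncons n).
Proof.
apply/measurable_fun_pairP; split; first exact: (@measurable_rV_coord R n.+1).
apply: measurable_fun_rVP => i.
rewrite (_ : _ \o _ = rV_coord (lift ord0 i)); first exact: measurable_rV_coord.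
by apply/funext => x; rewrite /= /rV_coord mxE.
Qed.

Section lebesgue_rV_step.
Context n (mu : {sigma_finite_measure set 'rV[R]_n -> \bar R}).

Definition lebesgue_rV_step : set 'rV[R]_n.+1 -> \bar R :=
  pushforward (lebesgue_measure \x mu)%E (@rV_cons n).

HB.instance Definition _ := Measure.copy lebesgue_rV_step
  (measure_function_pushforward__canonical__measure_function_Measure
     (lebesgue_measure \x mu)%E (@measurable_rV_cons n)).

Let lebesgue_rV_step_sigma_finite : sigma_finite setT lebesgue_rV_step.
Proof.
pose lam : {sigma_finite_measure set (measurableTypeR R) -> \bar R} :=
  lebesgue_measure.
have /sigma_finiteP[F [TF ndF Foo]] := sigma_finiteT lam.
have /sigma_finiteP[G [TG ndG Goo]] := sigma_finiteT mu.
exists (fun k => @rV_uncons n @^-1` (F k `*` G k)).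
  rewrite -preimage_bigcup (_ : \bigcup_k _ = setT) ?preimage_setT//.
  apply/esym; rewrite -setXTT TF TG predeqE => -[x y]; split.
    move=> [/= [k _ Fkx] [l _ Gly]]; exists (maxn k l) => //; split.
    - by move: x Fkx; exact/subsetPset/ndF/leq_maxl.
    - by move: y Gly; exact/subsetPset/ndG/leq_maxr.
  by move=> [k _ []/= ? ?]; split; exists k.
move=> k; have [mF Fy] := Foo k; have [mG Gy] := Goo k; split.
  rewrite -[X in measurable X]setTI.
  by apply: measurable_rV_uncons => //; exact: measurableX.
rewrite /lebesgue_rV_step /pushforward (_ : _ @^-1` _ = F k `*` G k).
  by rewrite (product_measure1E lam)// lte_mul_pinfty// ge0_fin_numE.
by apply/funext => p; exact: (congr1 (F k `*` G k) (rV_consK p)).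
Qed.

HB.instance Definition _ := Measure_isSigmaFinite.Build _ _ _ lebesgue_rV_step
  lebesgue_rV_step_sigma_finite.

End lebesgue_rV_step.

Fixpoint lebesgue_rV n : {sigma_finite_measure set 'rV[R]_n -> \bar R} :=
  if n is n'.+1 then lebesgue_rV_step (lebesgue_rV n') else \d_(0 : 'rV[R]_0).

End lebesgue_rV.

Section sphere.
Context (R : realType) (n : nat).
Implicit Types (x w : 'rV[R]_n) (f : 'rV[R]_n -> R).

(* The norm `|x| of the library on 'rV[R]_n is the sup norm. *)
Definition enorm x : R := Num.sqrt (\sum_i x ord0 i ^+ 2).

Definition sphere : set 'rV[R]_n := [set w | enorm w = 1].

Definition direction x : 'rV[R]_n := (enorm x)^-1 *: x.

Definition punctured_ball : set 'rV[R]_n := [set x | 0 < enorm x <= 1].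

Lemma measurable_enorm : measurable_fun setT (enorm : _ -> measurableTypeR R).
Proof.
apply: measurableT_comp.
  by apply: continuous_measurable_fun; exact: sqrt_continuous.
apply: measurable_sum => i; apply: measurable_funX.
exact: measurable_rV_coord.
Qed.

Lemma measurable_punctured_ball : measurable punctured_ball.
Proof.
rewrite (_ : punctured_ball = enorm @^-1` `]0, 1]); last first.
  by apply/seteqP; split => x /=; rewrite in_itv.
by rewrite -[X in measurable X]setTI; exact: measurable_enorm.
Qed.

Lemma measurable_direction : measurable_fun setT direction.
Proof.
apply: measurable_fun_rVP => i.
rewrite (_ : _ \o _ = fun x => enorm x `^ (-1) * rV_coord i x).
  apply: measurable_funM; last exact: measurable_rV_coord.
  by apply: (measurableT_comp (@measurable_powR R (-1))); exact: measurable_enorm.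
by apply/funext => x; rewrite powR_inv1 ?sqrtr_ge0//= /rV_coord mxE.
Qed.

(* The surface measure of a set A of directions is n times the volume of the
   cone {s w | 0 < s <= 1, w in A}, as in polar coordinates
   dx = s^(n-1) ds dw. *)
Definition surface_measure (A : set 'rV[R]_n) : \bar R :=
  (n%:R%:E * lebesgue_rV R n (direction @^-1` A `&` punctured_ball))%E.

HB.instance Definition _ := Measure.copy surface_measure
  (mscale (n%:R%:nng : {nonneg R})
    (measure_function_pushforward__canonical__measure_function_Measure
      (mrestr (lebesgue_rV R n) measurable_punctured_ball)
      measurable_direction)).

(* The gradient and the Laplace-Beltrami operator of the unit round sphere are
   computed by extending a function to R^n \ {0} constantly along rays: at a
   point of the sphere, the Euclidean gradient of the extension is tangential
   and equals the spherical gradient, and its Euclidean Laplacian equals the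
   spherical one. *)
Definition partial (i : 'I_n) f x : R := 'D_(delta_mx ord0 i) f x.

Definition sphere_grad f w : 'rV[R]_n :=
  \row_i partial i (f \o direction) w.

Definition sphere_laplacian f w : R :=
  \sum_i partial i (partial i (f \o direction)) w.

End sphere.

(* Class C^k on the open set U: all directional derivatives of order <= k exist
   and are continuous, which is the usual notion for V finite dimensional. *)
Fixpoint class_C (R : realType) (V : normedModType R) (k : nat) (U : set V)
    (f : V -> R) : Prop :=
  if k is k'.+1 then
    forall v, (forall x, U x -> derivable f x v) /\
      class_C k' U (fun x => 'D_v f x)
  else forall x, U x -> {for x, continuous f}.

(* A function on the exterior R x (rs, +oo) x S^(n-1) is a total function
   phi t r w; only its values at r > rs and w in the sphere matter. *)
Section schwarzschild.
Context (R : realType) (n : nat) (rs : R).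
Local Notation d := (n - 3)%N.
Local Notation leb := (@lebesgue_measure R).
Local Notation sigma := (@surface_measure R n).
Implicit Types (phi : R -> R -> 'rV[R]_n -> R) (t r : R) (w : 'rV[R]_n).

Definition dt phi t r w : R := derive1 (fun s => phi s r w) t.
Definition dr phi t r w : R := derive1 (fun s => phi t s w) r.

Definition lapse r : R := 1 - (rs / r) ^+ d.+1.

Definition ang_grad_sq phi t r w : R :=
  r ^- 2 * enorm (sphere_grad (phi t r) w) ^+ 2.

Definition box phi t r w : R :=
  - (lapse r)^-1 * dt (dt phi) t r w
  + r ^- d.+2 * derive1 (fun s => s ^+ d.+2 * lapse s * dr phi t s w) r
  + r ^- 2 * sphere_laplacian (phi t r) w.

Definition exterior_C2 phi : Prop :=
  @class_C R (R * R * 'rV[R]_n)%type 2 [set p | rs < p.1.2 /\ p.2 != 0]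
    (fun p => phi p.1.1 p.1.2 (direction p.2)).

Definition wave_solution phi : Prop :=
  exterior_C2 phi /\
  forall t r w, rs < r -> sphere w -> box phi t r w = 0.

(* Nonzero constants are solutions of zero energy, which this condition on the
   data excludes.  When the energy of the data is finite, the limit exists and
   does not depend on w for almost every w. *)
Definition vanishes_at_infinity (f : R -> 'rV[R]_n -> R) : Prop :=
  {ae sigma, forall w, sphere w -> f r w @[r --> +oo] --> 0}.

Definition energy phi t : \bar R :=
  (\int[sigma]_(w in @sphere R n) \int[leb]_(r in `]rs, +oo[)
    (((lapse r)^-1 * dt phi t r w ^+ 2 + lapse r * dr phi t r w ^+ 2
      + ang_grad_sq phi t r w) * r ^+ d.+2)%:E)%E.

Definition photon_sphere : R := (d.+3%:R / 2) `^ (d.+1%:R)^-1 * rs.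

Definition c_r r : R := (r ^+ d.+3 * (1 - ln ((r - rs) / r)) ^+ 2)^-1.

Definition c_omega r : R := r^-1 * ((r - photon_sphere) / r) ^+ 2.

Definition c_0 r : R :=
  ((r - rs) / r)^-1 * (r ^+ 3 * (1 - ln ((r - rs) / r)) ^+ 4)^-1.

Definition LE_norm_sq phi : \bar R :=
  (\int[leb]_(t in `[0%R, +oo[) \int[sigma]_(w in @sphere R n)
    \int[leb]_(r in `]rs, +oo[)
      ((c_r r * lapse r * dr phi t r w ^+ 2 + c_omega r * ang_grad_sq phi t r w
        + c_0 r * phi t r w ^+ 2) * r ^+ d.+2)%:E)%E.

End schwarzschild.

(* Main.v *)
From HB Require Import structures.
Require Import Defs.
From mathcomp Require Import all_boot all_order all_algebra.
From mathcomp Require Import all_classical all_reals all_analysis.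
From mathcomp Require Import measurable_realfun.
From mathcomp Require Import ring lra.
Import Order.TTheory GRing.Theory Num.Theory.
Import numFieldNormedType.Exports.
Set Implicit Arguments.
Unset Strict Implicit.
Unset Printing Implicit Defensive.
Local Open Scope classical_set_scope.
Local Open Scope ring_scope.

(** The proof is a multiplier argument on boxes, with cutoffs that are removed
   at the end.  Put k = n - 1, N = k - 1, s = (rs/r)^N, F = 1 - s, y = 1/r,
   Lam = 1 - ln F, z = 1/Lam and D = F d/dr, the derivative in the tortoise
   coordinate.  A function on the sphere is extended constantly along rays, so
   that all derivatives are directional derivatives on an open set, and
   integration by parts on the sphere ([sphere_integration_by_parts]) follows
   from the vanishing of integrals of partial derivatives on R^n.

   Each estimate integrates an identity
     d/dt M - d/dr J - (angular divergence) + (bulk) = 0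
   over [0, T] x S x [a, b] ([flux_balance]), where M and J carry the cutoff
   chi = pp (1 - m/X) and m = r + (rs/N) Lam.  This m tends to infinity at
   both ends of (rs, oo) and D m is bounded, so the cutoff error is O(1/X)
   times the flux; letting X tend to infinity removes it ([uncut2], [uncut3]).

   Energy ([energy_bound]).  Multiplying by phi_t with a cutoff in (m + t)/X,
   the error has a sign because |D m| <= 1, so the energy at time t is at most
   the initial one.

   Hardy ([hardy]).  The weight h = r^(k-1) z satisfies
   h' >= N r^(k-2) z^2/F, so the integral of r^(k-2) z^2 phi^2/F is bounded by
   the energy as soon as phi vanishes at infinity.  At t = 0 this is done on
   almost every ray, and at later times for phi(t) - phi(0), which is square
   integrable with a bound that grows with t and only enters the cutoff error.

   Morawetz ([morawetz_cutoff], [bulk_ge]).  With c = (k/2) F y and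
   U = D phi + c phi, the multiplier 2 f U + (D f) phi, with f equal to
   A (1 - (k+1)/2 s) + (z - z(r_ps)), gives the bulk term
     2 (Df) U^2 - (1/2) (D D D f) phi^2 - f (D V0) phi^2 - f D(F y^2) |grad|^2,
   where V0 = D c + c^2 and grad is the gradient on the unit sphere.  Both
   parts of f change sign at the photon sphere together with D(F y^2), so the
   angular term is nonnegative.  After a Hardy correction and completion of
   squares, the coefficient of phi^2 from the first part is F y^3 times a cubic
   in s that is at least 3/16 on [0, 1]; it degenerates at the horizon, where
   the logarithmic part z gives the missing y^3 z^4 phi^2.  For A large the bulk
   dominates the local energy density ([qle_bulk]), while J and M are bounded
   by the energy density and the Hardy density.  *)

(** * Directional derivatives and continuity *)

Section derive_rules.
Context {R : realType} {V : normedModType R}.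
Implicit Types (f g : V -> R) (x v w : V).

Lemma isd_cst (c : R) x v : is_derive x v (fun _ => c) 0.
Proof. exact: is_derive_cst. Qed.

Lemma isd_ex f x v df : is_derive x v f df -> derivable f x v.
Proof. by case. Qed.

Lemma isd_val f x v df : is_derive x v f df -> 'D_v f x = df.
Proof. by case. Qed.

Lemma isdD f g x v df dg : is_derive x v f df -> is_derive x v g dg ->
  is_derive x v (fun y => f y + g y) (df + dg).
Proof. exact: is_deriveD. Qed.

Lemma isdN f x v df : is_derive x v f df -> is_derive x v (fun y => - f y) (- df).
Proof. exact: is_deriveN. Qed.

Lemma isdM f g x v df dg : is_derive x v f df -> is_derive x v g dg ->
  is_derive x v (fun y => f y * g y) (f x * dg + g x * df).
Proof. exact: is_deriveM. Qed.

Lemma isdZ (c : R) f x v df : is_derive x v f df ->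
  is_derive x v (fun y => c * f y) (c * df).
Proof.
move=> h; have := isdM (isd_cst c x v) h; rewrite [f x * 0]mulr0 addr0; exact.
Qed.

Lemma isd_sum (I : Type) (r : seq I) (F : I -> V -> R) (dF : I -> R) x v :
  (forall i, is_derive x v (F i) (dF i)) ->
  is_derive x v (fun y => \sum_(i <- r) F i y) (\sum_(i <- r) dF i).
Proof.
move=> h; elim: r => [|i r ih].
  by under eq_fun do rewrite big_nil; rewrite big_nil; exact: isd_cst.
by under eq_fun do rewrite big_cons; rewrite big_cons; apply: isdD.
Qed.

Lemma isd_eq f g x v df dg : is_derive x v f df -> f =1 g -> df = dg ->
  is_derive x v g dg.
Proof. by move=> h /funext <- <-. Qed.

Lemma isd_near f g x v df : is_derive x v f df ->
  (\forall y \near x, f y = g y) -> is_derive x v g df.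
Proof. by move=> h fg; exact: near_eq_is_derive fg h. Qed.

(** A directional derivative is the derivative of the restriction to a line;
   this reduces chain rules and mean value statements to one variable. *)
Lemma isd_line f x v df :
  is_derive x v f df <-> is_derive (0 : R) 1 (fun t => f (x + t *: v)) df.
Proof.
have E : (fun h : R => h^-1 *: ((f \o shift x) (h *: v) - f x)) =
    (fun h : R => h^-1 *: (((fun t => f (x + t *: v)) \o shift 0) (h *: 1) -
       f (x + 0 *: v))).
  apply/funext => h /=; rewrite scale0r !addr0 [h *: 1]mulr1.
  congr (_ *: (f _ - _)); exact: addrC.
by split => -[h1 h2]; split; move: h1 h2; rewrite /derivable /derive E.
Qed.

End derive_rules.

Section derive_rules2.
Context {R : realType} {V : normedModType R}.
Implicit Types (f g : V -> R) (x v w : V).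

Lemma isd_line_at f x v (t : R) df : is_derive (x + t *: v) v f df ->
  is_derive t 1 (fun u => f (x + u *: v)) df.
Proof.
move=> /isd_line h; apply/isd_line; apply: (isd_eq h) => // u /=.
by rewrite [u *: 1]mulr1 scalerDl addrA.
Qed.

Lemma isd_comp (xi : R -> R) f x v dxi df : is_derive (f x) 1 xi dxi ->
  is_derive x v f df -> is_derive x v (fun y => xi (f y)) (dxi * df).
Proof.
move=> hxi /isd_line hf; apply/isd_line.
pose g (t : R) := f (x + t *: v).
have g0 : g 0 = f x by rewrite /g scale0r addr0.
rewrite -g0 in hxi; exact: is_derive1_comp hxi hf.
Qed.

Lemma isd_scale f x v (c : R) df : is_derive x v f df ->
  is_derive x (c *: v) f (c * df).
Proof.
move=> /isd_line h; apply/isd_line.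
have hc : is_derive (0 : R) 1 (fun t : R => c * t) c.
  have H := isdM (isd_cst c (0:R) 1) (is_derive_id (0 : R) 1).
  by apply: (isd_eq H) => //=; rewrite mulr1 mulr0 addr0.
rewrite -[X in is_derive X](mulr0 c) in h.
apply: (isd_eq (is_derive1_comp h hc)) => [t /=|]; last by rewrite mulrC.
by rewrite scalerA mulrC.
Qed.

Lemma mvt_line f x v : (forall t : R, 0 <= t <= 1 -> derivable f (x + t *: v) v) ->
  exists2 t : R, 0 < t < 1 & f (x + v) - f x = 'D_v f (x + t *: v).
Proof.
move=> df.
have dg (t : R) : 0 <= t <= 1 ->
    is_derive t 1 (fun u : R => f (x + u *: v)) ('D_v f (x + t *: v)).
  by move=> t01; apply: isd_line_at; apply: derivableP; exact: df.
have [t|t|t] := @MVT R (fun u => f (x + u *: v)) (fun t => 'D_v f (x + t *: v))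
    0 1 ltr01.
- by rewrite in_itv /= => /andP[t0 t1]; apply: dg; rewrite !ltW.
- apply: derivable_within_continuous => u; rewrite in_itv /= => u01.
  by have [] := dg _ u01.
- rewrite in_itv /= => t01; rewrite scale1r scale0r addr0 subr0 mulr1 => E.
  by exists t.
Qed.

(** Directional derivatives are additive in the direction once one of them is
   continuous; the notion of class C^1 at hand only asks for directional
   derivatives, so linearity has to be recovered this way. *)
Lemma isd_addv f x v w : (\forall y \near x, derivable f y w) ->
  {for x, continuous (fun y => 'D_w f y)} -> derivable f x v ->
  is_derive x (v + w) f ('D_v f x + 'D_w f x).
Proof.
move=> dw cw dv.
have [dv0|v0] := eqVneq w 0.
  by rewrite dv0 addr0 derive0 addr0; exact: derivableP.
apply/isd_line.
pose F (t : R) := f (x + t *: v + t *: w) - f (x + t *: v).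
suff hF : is_derive (0 : R) 1 F ('D_w f x).
  have /isd_line hv := derivableP dv.
  apply: (isd_eq (isdD hv hF)) => // t.
  by rewrite /F addrCA subrr addr0 scalerDr addrA.
have F0 : F 0 = 0 by rewrite /F !scale0r !addr0 subrr.
have lim : h^-1 *: ((F \o shift 0) (h *: 1) - F 0) @[h --> 0^'] --> 'D_w f x.
  apply/cvgrPdist_lt => e e0.
  have /(@cvgrPdist_lt _ _ _ (nbhs x)) /(_ e e0) := cw.
  move=> /(filterI dw) /nbhs_ballP[d /= d0 hd].
  pose K := `|v| + `|w| + 1.
  have K0 : 0 < K by rewrite ltr_wpDl // addr_ge0.
  near=> h.
  have h0 : h != 0 by near: h; exact: nbhs_dnbhs_neq.
  have hK : `|h| * K < d.
    rewrite -ltr_pdivlMr //; near: h; apply: dnbhs0_lt; exact: divr_gt0.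
  rewrite /= F0 subr0 addr0 [h *: 1]mulr1.
  have inb (t : R) : 0 <= t <= 1 -> ball x d (x + h *: v + t *: (h *: w)).
    move=> /andP[t0 t1]; rewrite -ball_normE /ball_ /= -addrA opprD addNKr normrN.
    apply: le_lt_trans hK; rewrite /K; apply: le_trans (ler_normD _ _) _.
    rewrite !normrZ (ger0_norm t0) mulrDr mulrDr mulr1 -addrA lerD //.
    rewrite -[X in X <= _]addr0 lerD //.
    by rewrite -[X in _ <= X]mul1r ler_wpM2r // mulr_ge0.
  have [t /andP[t0 t1]] := @mvt_line f (x + h *: v) (h *: w)
     (fun t t01 => isd_ex (isd_scale h (derivableP (hd _ (inb t t01)).1))).
  have t01 : 0 <= t <= 1 by rewrite !ltW.
  have [d1 d2] := hd _ (inb t t01).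
  rewrite /F => ->.
  have -> : 'D_(h *: w) f (x + h *: v + t *: (h *: w)) =
      h * 'D_w f (x + h *: v + t *: (h *: w)).
    exact: isd_val (isd_scale h (derivableP d1)).
  by rewrite [_ *: _]mulKf.
by split; [apply/cvg_ex; exists ('D_w f x)|exact/cvg_lim].
Unshelve. all: by end_near. Qed.

End derive_rules2.

Section continuity_rules.
Context {R : realType} {T : topologicalType}.
Implicit Types (f g : T -> R) (x : T).

Lemma ct_cst (c : R) x : {for x, continuous (fun _ => c)}.
Proof. exact: cst_continuous. Qed.

Lemma ctD f g x : {for x, continuous f} -> {for x, continuous g} ->
  {for x, continuous (fun y => f y + g y)}.
Proof. by move=> cf cg; exact: cvgD cf cg. Qed.

Lemma ctN f x : {for x, continuous f} -> {for x, continuous (fun y => - f y)}.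
Proof. by move=> cf; exact: cvgN cf. Qed.

Lemma ctM f g x : {for x, continuous f} -> {for x, continuous g} ->
  {for x, continuous (fun y => f y * g y)}.
Proof. by move=> cf cg; exact: cvgM cf cg. Qed.

Lemma ctX f x n : {for x, continuous f} -> {for x, continuous (fun y => f y ^+ n)}.
Proof.
move=> cf; elim: n => [|n ih].
  by rewrite (_ : (fun y => _) = (fun _ => 1)); [exact: ct_cst|exact/funext].
rewrite (_ : (fun y => _) = (fun y => f y * f y ^+ n)); first exact: ctM.
by apply/funext => y; rewrite exprS.
Qed.

Lemma ctV f x : f x != 0 -> {for x, continuous f} ->
  {for x, continuous (fun y => (f y)^-1)}.
Proof. by move=> f0 cf; exact: cvgV cf. Qed.

Lemma ct_sum (I : Type) (r : seq I) (F : I -> T -> R) x :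
  (forall i, {for x, continuous (F i)}) ->
  {for x, continuous (fun y => \sum_(i <- r) F i y)}.
Proof.
move=> h; elim: r => [|i r ih].
  rewrite (_ : (fun y => _) = (fun _ => 0)); first exact: ct_cst.
  by apply/funext => y; rewrite big_nil.
rewrite (_ : (fun y => _) = (fun y => F i y + \sum_(j <- r) F j y)).
  exact: ctD.
by apply/funext => y; rewrite big_cons.
Qed.

Lemma ct_comp (xi : R -> R) f x : {for f x, continuous xi} ->
  {for x, continuous f} -> {for x, continuous (fun y => xi (f y))}.
Proof. by move=> cxi cf; exact: (continuous_comp cf cxi). Qed.

End continuity_rules.
Arguments ct_cst {R T} c x.
Arguments ctD {R T f g x}.
Arguments ctN {R T f x}.
Arguments ctM {R T f g x}.
Arguments ctX {R T f x} n.
Arguments ctV {R T f x}.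
Arguments ct_comp {R T xi f x}.

Lemma ct_pair (R : realType) (T : topologicalType) (U W : normedModType R)
    (f : T -> U) (g : T -> W) x : {for x, continuous f} -> {for x, continuous g} ->
  {for x, continuous (fun y => (f y, g y))}.
Proof. by move=> cf cg; exact: (cvg_pair cf cg). Qed.


(** * Symmetry of second derivatives *)

Section schwarz.
Context {R : realType} {V : normedModType R}.
Implicit Types (f : V -> R) (x v w : V).

Let sdiff f x v w (h : R) :=
  f (x + h *: v + h *: w) - f (x + h *: v) - (f (x + h *: w) - f x).

(** Two applications of the mean value theorem express the second difference
   by a mixed derivative at an intermediate point. *)
Lemma second_difference f x v w :
  (\forall y \near x, derivable f y v) ->
  (\forall y \near x, derivable (fun z => 'D_v f z) y w) ->
  {for x, continuous (fun y => 'D_w (fun z => 'D_v f z) y)} ->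
  (sdiff f x v w h / h ^+ 2) @[h --> 0^'] --> 'D_w (fun z => 'D_v f z) x.
Proof.
move=> dv dwv cwv; apply/cvgrPdist_lt => e e0.
have /(@cvgrPdist_lt _ _ _ (nbhs x)) /(_ e e0) := cwv.
move=> /(filterI dwv) /(filterI dv) /nbhs_ballP[d /= d0 hd].
pose K := `|v| + `|w| + 1.
have K0 : 0 < K by rewrite ltr_wpDl // addr_ge0.
near=> h.
have h0 : h != 0 by near: h; exact: nbhs_dnbhs_neq.
have hK : `|h| * K < d.
  rewrite -ltr_pdivlMr //; near: h; apply: dnbhs0_lt; exact: divr_gt0.
have inb (s t : R) : 0 <= s <= 1 -> 0 <= t <= 1 ->
    ball x d (x + s *: (h *: v) + t *: (h *: w)).
  move=> /andP[s0 s1] /andP[t0 t1].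
  rewrite -ball_normE /ball_ /= -addrA opprD addNKr normrN.
  apply: le_lt_trans hK; rewrite /K; apply: le_trans (ler_normD _ _) _.
  rewrite !normrZ (ger0_norm t0) (ger0_norm s0) !mulrDr mulr1.
  rewrite -[X in X <= _]addr0; apply: lerD => //.
  by apply: lerD; rewrite -[X in _ <= X]mul1r ler_wpM2r // mulr_ge0.
have i00 : (0:R) <= (0:R) <= 1 by lra.
have i11 : (0:R) <= 1 <= (1:R) by lra.
pose G y := f (y + h *: w) - f y.
have dG (t : R) : 0 <= t <= 1 -> is_derive (x + t *: (h *: v)) (h *: v) G
   (h * ('D_v f (x + t *: (h *: v) + h *: w) - 'D_v f (x + t *: (h *: v)))).
  move=> t01; apply: isd_scale; rewrite /G.
  have [d1 _] := hd _ (inb _ _ t01 i11).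
  have [d2 _] := hd _ (inb _ _ t01 i00).
  rewrite scale1r in d1; rewrite scale0r addr0 in d2.
  apply: isdD; last by apply: isdN; exact: derivableP.
  apply/isd_line; have /isd_line := derivableP d1.
  by move=> H; apply: (isd_eq H) => // u; rewrite addrAC.
have [s s01] := @mvt_line _ _ G x (h *: v) (fun t t01 => isd_ex (dG t t01)).
have {s01}s01 : 0 <= s <= 1 by case/andP: s01 => *; rewrite !ltW.
rewrite (isd_val (dG s s01)).
have [t t01] := @mvt_line _ _ (fun z => 'D_v f z) (x + s *: (h *: v)) (h *: w)
  (fun t t01 => isd_ex (isd_scale h (derivableP (hd _ (inb s t s01 t01)).2.1))).
have {t01}t01 : 0 <= t <= 1 by case/andP: t01 => *; rewrite !ltW.
have [_ [d2 d3]] := hd _ (inb _ _ s01 t01).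
rewrite (isd_val (isd_scale h (derivableP d2))) => -> GE.
rewrite /sdiff -/(G (x + h *: v)) -/(G x) GE mulrA -expr2 mulrAC divff ?mul1r //.
by rewrite sqrf_eq0.
Unshelve. all: by end_near. Qed.

(** Symmetry of second derivatives: both mixed derivatives are the limit of the
   same symmetric second difference. *)
Lemma schwarz f x v w :
  (\forall y \near x, derivable f y v) ->
  (\forall y \near x, derivable f y w) ->
  (\forall y \near x, derivable (fun z => 'D_v f z) y w) ->
  (\forall y \near x, derivable (fun z => 'D_w f z) y v) ->
  {for x, continuous (fun y => 'D_w (fun z => 'D_v f z) y)} ->
  {for x, continuous (fun y => 'D_v (fun z => 'D_w f z) y)} ->
  'D_w (fun z => 'D_v f z) x = 'D_v (fun z => 'D_w f z) x.
Proof.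
move=> dv dw dwv dvw cwv cvw.
have h1 := second_difference dv dwv cwv; have h2 := second_difference dw dvw cvw.
have E : (fun h => sdiff f x v w h / h ^+ 2) = (fun h => sdiff f x w v h / h ^+ 2).
  by apply/funext => h; rewrite /sdiff (addrAC x); congr (_ / _); ring.
rewrite E in h1.
have e1 := cvg_lim (@norm_hausdorff _ _) h1.
have e2 := cvg_lim (@norm_hausdorff _ _) h2.
by rewrite -e1 -e2.
Qed.

End schwarz.

Section class_C_theory.
Context {R : realType}.

Lemma isd_sumv (V : normedModType R) (I : Type) (r : seq I) (v : I -> V)
    (f : V -> R) x :
  (\forall y \near x, forall i, derivable f y (v i)) ->
  (forall i, {for x, continuous (fun y => 'D_(v i) f y)}) ->
  is_derive x (\sum_(i <- r) v i) f (\sum_(i <- r) 'D_(v i) f x).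
Proof.
move=> df cf; elim: r => [|i r ih].
  by rewrite !big_nil; exact: is_derive0.
rewrite !big_cons [X in is_derive _ X]addrC [X in is_derive _ _ _ X]addrC.
rewrite -(isd_val ih); apply: isd_addv => //.
by apply: filterS df => y.
Qed.

(** The mean value theorem bounds the increment of the function by its
   derivatives along the spanning family times the coordinates of the step. *)
Lemma C1_continuous (V : normedModType R) (I : finType) (b : I -> V)
    (co : I -> V -> R) (f : V -> R) x :
  (forall h, h = \sum_i co i h *: b i) ->
  (forall i h, `|co i h| <= `|h|) ->
  (\forall y \near x, forall i, derivable f y (b i)) ->
  (\forall y \near x, forall i, {for y, continuous (fun z => 'D_(b i) f z)}) ->
  {for x, continuous f}.
Proof.
move=> hco bco df cf.
have bd : \forall y \near x, forall i, `|'D_(b i) f y| < `|'D_(b i) f x| + 1.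
  apply: filter_forall => i.
  have /nbhs_singleton/(_ i) := cf.
  move=> /(@cvgrPdist_lt _ _ _ (nbhs x)) /(_ 1 ltr01).
  apply: filterS => y yx.
  rewrite -ltrBlDl; apply: le_lt_trans yx.
  by rewrite distrC; apply: lerB_dist.
have [d /= d0 hd] := (nbhs_ballP _ _).1 (filterI bd
  (filterI (near_join df) cf)).
apply/cvgrPdist_lt => e e0.
pose K := \sum_i (`|'D_(b i) f x| + 1) + 1.
have K0 : 0 < K by rewrite ltr_wpDl // sumr_ge0 // => i _; rewrite addr_ge0.
have : \forall y \near x, ball x (Num.min d (e / K)) y.
  by apply: nbhsx_ballx; rewrite lt_min d0 divr_gt0.
apply: filterS => y; rewrite -ball_normE /ball_ /= lt_min => /andP[yd ye].
pose h := y - x.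
have inb (t : R) : 0 <= t <= 1 -> ball x d (x + t *: h).
  move=> /andP[t0 t1]; rewrite -ball_normE /ball_ /= opprD addNKr normrN.
  rewrite normrZ ger0_norm // /h distrC; apply: le_lt_trans yd.
  by rewrite -[X in _ <= X]mul1r ler_wpM2r.
have dh (t : R) : 0 <= t <= 1 ->
    is_derive (x + t *: h) h f (\sum_i co i h * 'D_(b i) f (x + t *: h)).
  move=> t01; have [_ [dft cft]] := hd _ (inb t t01).
  have sc i z : derivable f z (b i) ->
      is_derive z (co i h *: b i) f (co i h * 'D_(b i) f z).
    by move=> dz; apply: isd_scale; exact: derivableP.
  rewrite (eq_bigr (fun i => 'D_(co i h *: b i) f (x + t *: h))); last first.
    by move=> i _; rewrite (isd_val (sc _ _ (nbhs_singleton dft i))).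
  suff H : is_derive (x + t *: h) (\sum_i co i h *: b i) f
      (\sum_i 'D_(co i h *: b i) f (x + t *: h)) by rewrite -hco in H.
  apply: isd_sumv.
    by apply: filterS dft => z dz i; exact: isd_ex (sc i z (dz i)).
  move=> i; have [c0|c0] := eqVneq (co i h) 0.
    rewrite c0 scale0r (_ : 'D_0 f = cst 0); first exact: cst_continuous.
    by apply/funext => u; exact: derive0.
  have E : \forall z \near (x + t *: h),
     co i h * 'D_(b i) f z = 'D_(co i h *: b i) f z.
    by apply: filterS dft => z dz; rewrite (isd_val (sc i z (dz i))).
  have H : co i h * 'D_(b i) f z @[z --> x + t *: h] -->
      co i h * 'D_(b i) f (x + t *: h).
    by apply: cvgM; [exact: cvg_cst|exact: cft].
  have E0 : co i h * 'D_(b i) f (x + t *: h) = 'D_(co i h *: b i) f (x + t *: h).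
    exact: (nbhs_singleton E).
  rewrite E0 in H; apply: cvg_trans H; exact: near_eq_cvg.
have [t t01] := @mvt_line _ _ f x h (fun t t01 => isd_ex (dh t t01)).
have {t01}t01 : 0 <= t <= 1 by case/andP: t01 => *; rewrite !ltW.
have yE : x + h = y by rewrite /h addrC subrK.
rewrite (isd_val (dh t t01)) yE => fE.
rewrite distrC fE; have [bt _] := hd _ (inb t t01).
apply: le_lt_trans (ler_norm_sum _ _ _) _.
apply: (@le_lt_trans _ _ (`|h| * \sum_i (`|'D_(b i) f x| + 1))).
  rewrite mulr_sumr; apply: ler_sum => i _; rewrite normrM ler_pM //.
  by apply: ltW; exact: bt.
rewrite /h distrC; apply: (@le_lt_trans _ _ (`|x - y| * K)).
  by rewrite ler_wpM2l // /K ltW // ltrDl.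
by rewrite -ltr_pdivlMr.
Qed.

End class_C_theory.


(** * The exterior region *)

Section exterior_geometry.
Context {R : realType} {n : nat}.
Local Notation V := (R * R * 'rV[R]_n)%type.

Definition e_t : V := (1, 0, 0).
Definition e_r : V := (0, 1, 0).
Definition e_x (v : 'rV[R]_n) : V := (0, 0, v).

(** The domain of the extension along rays: unlike the product with the sphere,
   it is open in a normed space. *)
Definition exterior (rs : R) : set V := [set p | rs < p.1.2 /\ p.2 != 0].

Lemma open_exterior rs : open (exterior rs).
Proof.
rewrite (_ : exterior rs = ((fun p : V => p.1.2) @^-1` [set x | rs < x]) `&`
    (snd @^-1` ~` [set 0])).
  apply: openI; apply: open_comp.
  - by move=> p _; apply: continuous_comp; [exact: cvg_fst|exact: cvg_snd].
  - exact: open_gt.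
  - by move=> p _; exact: cvg_snd.
  - by apply: closed_openC; apply: accessible_closed_set1;
      apply: hausdorff_accessible; exact: norm_hausdorff.
by apply/seteqP; split => p [h1 h2]; split => //; apply/eqP.
Qed.

Lemma near_exterior rs (P : V -> Prop) p : exterior rs p ->
  (forall q, exterior rs q -> P q) -> \forall q \near p, P q.
Proof.
move=> ep h; have := open_nbhs_nbhs (conj (@open_exterior rs) ep).
by apply: filterS.
Qed.

Lemma slice_t (G : V -> R) t r x d : is_derive (t, r, x) e_t G d ->
  is_derive t 1 (fun s => G (s, r, x)) d.
Proof.
move=> /isd_line h; apply/isd_line; apply: (isd_eq h) => // s.
by congr (G (_, _, _)); rewrite /= ?scaler0 ?addr0 //.
Qed.

Lemma slice_r (G : V -> R) t r x d : is_derive (t, r, x) e_r G d ->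
  is_derive r 1 (fun s => G (t, s, x)) d.
Proof.
move=> /isd_line h; apply/isd_line; apply: (isd_eq h) => // s.
by congr (G (_, _, _)); rewrite /= ?scaler0 ?addr0 //.
Qed.

Lemma slice_x (G : V -> R) t r x v d : is_derive (t, r, x) (e_x v) G d ->
  is_derive x v (fun y => G (t, r, y)) d.
Proof.
move=> /isd_line h; apply/isd_line; apply: (isd_eq h) => // s.
by congr (G (_, _, _)); rewrite /= ?scaler0 ?addr0 //.
Qed.

Lemma slice_derive_x (G : V -> R) t r x v :
  'D_v (fun y => G (t, r, y)) x = 'D_(e_x v) G (t, r, x).
Proof.
rewrite /derive; set A := (fun h : R => _); set B := (fun h : R => _).
suff -> : A = B by []; apply/funext => h; rewrite /A /B /=.
by congr (_ *: (G (_, _, _) - _)); rewrite /= ?scaler0 ?add0r.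
Qed.

Lemma slice_derive1_t (G : V -> R) t r x :
  derive1 (fun s => G (s, r, x)) t = 'D_e_t G (t, r, x).
Proof.
rewrite derive1E; rewrite /derive; set A := (fun h : R => _); set B := (fun h : R => _).
suff -> : A = B by []; apply/funext => h; rewrite /A /B /=.
by congr (_ *: (G (_, _, _) - _)); rewrite /= ?scaler0 ?add0r.
Qed.

Lemma slice_derive1_r (G : V -> R) t r x :
  derive1 (fun s => G (t, s, x)) r = 'D_e_r G (t, r, x).
Proof.
rewrite derive1E; rewrite /derive; set A := (fun h : R => _); set B := (fun h : R => _).
suff -> : A = B by []; apply/funext => h; rewrite /A /B /=.
by congr (_ *: (G (_, _, _) - _)); rewrite /= ?scaler0 ?add0r.
Qed.

Let basis (j : bool + 'I_n) : V :=
  match j with inl true => e_t | inl false => e_r | inr i => e_x (delta_mx ord0 i) end.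

Let coord (j : bool + 'I_n) (p : V) : R :=
  match j with inl true => p.1.1 | inl false => p.1.2 | inr i => p.2 ord0 i end.

Lemma norm_coord_le (x : 'rV[R]_n) i : `|x ord0 i| <= `|x|.
Proof.
rewrite [leRHS]/Num.Def.normr /= mx_normrE.
exact: (@le_bigmax _ _ _ _ (fun ij => `|x ij.1 ij.2|) (ord0, i)).
Qed.

Lemma class_C1_continuous rs (g : V -> R) p :
  class_C 1 (exterior rs) g -> exterior rs p -> {for p, continuous g}.
Proof.
move=> Cg ep; apply: (@C1_continuous _ _ _ basis coord).
- move=> [[t r] x]; rewrite big_sumType big_bool /=.
  rewrite [X in _ = _ + X](_ : _ = (0, 0, x)).
    rewrite /e_t /e_r; congr (_, _, _); rewrite /= ?scaler0 ?addr0 ?add0r //.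
    + by rewrite [t *: 1]mulr1.
    + by rewrite [r *: 1]mulr1.
  rewrite [in RHS](row_sum_delta x).
  elim/big_ind2 : _ => // [a b c d -> ->|i _].
    by congr (_, _, _); rewrite /= addr0.
  by congr (_, _, _); rewrite /= scaler0.
- move=> [[]|i] [[t r] x] /=; rewrite !prod_normE /= !le_max ?lexx ?orbT //.
  by rewrite norm_coord_le orbT.
- by apply: (near_exterior ep) => q eq i; have [h _] := Cg (basis i); exact: h.
- by apply: (near_exterior ep) => q eq i; have [_ h] := Cg (basis i); exact: h.
Qed.

End exterior_geometry.


(** * Functions of class C^2 and extension along rays *)

Section class_C2.
Context {R : realType} {n : nat} (rs : R).
Local Notation V := (R * R * 'rV[R]_n)%type.
Variable G : V -> R.
Hypothesis CG : class_C 2 (exterior rs) G.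

Lemma C2_derivable p v : exterior rs p -> derivable G p v.
Proof. by move=> ep; have [h _] := CG v; exact: h. Qed.

Lemma C2_derivable2 p v w : exterior rs p -> derivable ('D_v G) p w.
Proof. by move=> ep; have [_ /(_ w)[h _]] := CG v; exact: h. Qed.

Lemma C2_continuous2 p v w : exterior rs p -> {for p, continuous ('D_w ('D_v G))}.
Proof. by move=> ep; have [_ /(_ w)[_ h]] := CG v; exact: h. Qed.

Lemma C2_continuous1 p v : exterior rs p -> {for p, continuous ('D_v G)}.
Proof. by move=> ep; have [_ h] := CG v; exact: class_C1_continuous h ep. Qed.

Lemma C2_continuous p : exterior rs p -> {for p, continuous G}.
Proof.
move=> ep; apply: (class_C1_continuous _ ep) => v; split.
  by move=> q eq; exact: C2_derivable.
by move=> q eq; exact: C2_continuous1.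
Qed.

Lemma C2_sym p v w : exterior rs p -> 'D_w ('D_v G) p = 'D_v ('D_w G) p.
Proof.
move=> ep; apply: schwarz; last 2 first.
- exact: C2_continuous2.
- exact: C2_continuous2.
all: apply: (near_exterior ep) => q eq.
- exact: C2_derivable.
- exact: C2_derivable.
- exact: C2_derivable2.
- exact: C2_derivable2.
Qed.

End class_C2.

Section enorm_theory.
Context {R : realType} {n : nat}.
Implicit Types x w : 'rV[R]_n.

Lemma enorm_ge0 x : 0 <= enorm x.
Proof. exact: sqrtr_ge0. Qed.

Lemma enorm_sq x : enorm x ^+ 2 = \sum_i x ord0 i ^+ 2.
Proof. by rewrite sqr_sqrtr // sumr_ge0 // => i _; exact: sqr_ge0. Qed.

Lemma enorm_eq0 x : (enorm x == 0) = (x == 0).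
Proof.
apply/eqP/eqP => [x0|->]; last first.
  by rewrite /enorm big1 ?sqrtr0 // => i _; rewrite mxE expr0n.
have := enorm_sq x; rewrite x0 expr0n /= => /esym /eqP.
rewrite psumr_eq0 => [/allP h|i _]; last exact: sqr_ge0.
by apply/rowP => i; apply/eqP; rewrite mxE -sqrf_eq0; apply: h; rewrite mem_index_enum.
Qed.

Lemma enorm_gt0 x : (0 < enorm x) = (x != 0).
Proof. by rewrite lt0r enorm_eq0 enorm_ge0 andbT. Qed.

Lemma enormZ (c : R) x : 0 <= c -> enorm (c *: x) = c * enorm x.
Proof.
move=> c0; rewrite /enorm.
under eq_bigr do rewrite mxE exprMn.
by rewrite -mulr_sumr sqrtrM ?sqr_ge0 // sqrtr_sqr ger0_norm.
Qed.

Lemma directionZ (c : R) x : 0 < c -> direction (c *: x) = direction x.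
Proof.
move=> c0; rewrite /direction enormZ ?ltW // scalerA; congr (_ *: _).
by rewrite invfM mulrAC mulVf ?mul1r // gt_eqF.
Qed.

Lemma direction_id w : sphere w -> direction w = w.
Proof. by rewrite /sphere /= /direction => ->; rewrite invr1 scale1r. Qed.

Lemma sphere_direction x : x != 0 -> sphere (direction x).
Proof.
move=> x0; rewrite /sphere /= /direction enormZ ?invr_ge0 ?enorm_ge0 //.
by rewrite mulVf // enorm_eq0.
Qed.

Lemma sphere_neq0 w : sphere w -> w != 0.
Proof. by move=> w1; rewrite -enorm_eq0 w1 oner_eq0. Qed.

Lemma coord_le_enorm x i : `|x ord0 i| <= enorm x.
Proof.
rewrite -sqrtr_sqr ler_wsqrtr // (bigD1 i) //= lerDl sumr_ge0 // => j _.
exact: sqr_ge0.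
Qed.

Lemma sumsq_continuous : continuous (fun x : 'rV[R]_n => \sum_i x ord0 i ^+ 2).
Proof.
by move=> x; apply: ct_sum => i; apply: ctX; exact: coord_continuous.
Qed.

Lemma enorm_continuous : continuous (@enorm R n).
Proof.
move=> x; apply: (@continuous_comp _ _ _ (fun x : 'rV[R]_n => \sum_i x ord0 i ^+ 2)).
  exact: sumsq_continuous.
exact: sqrt_continuous.
Qed.

End enorm_theory.

Section lift_of_function.
Context {R : realType} {n : nat} (rs : R).
Local Notation V := (R * R * 'rV[R]_n)%type.
Implicit Types (phi : R -> R -> 'rV[R]_n -> R).

(** The function extended to the ambient space constantly along rays; all the
   analysis is done on this extension, whose domain is open. *)
Definition ray_ext phi (p : V) : R := phi p.1.1 p.1.2 (direction p.2).

Lemma ray_extZ phi t r x (c : R) : 0 < c ->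
  ray_ext phi (t, r, c *: x) = ray_ext phi (t, r, x).
Proof. by move=> c0; rewrite /ray_ext /= directionZ. Qed.

Lemma ray_ext_sphere phi t r w : sphere w -> ray_ext phi (t, r, w) = phi t r w.
Proof. by move=> sw; rewrite /ray_ext /= direction_id. Qed.

Lemma dtE phi t r w : sphere w -> dt phi t r w = 'D_e_t (ray_ext phi) (t, r, w).
Proof.
move=> sw; rewrite -slice_derive1_t /dt; congr (derive1 _ t).
by apply/funext => s; rewrite ray_ext_sphere.
Qed.

Lemma drE phi t r w : sphere w -> dr phi t r w = 'D_e_r (ray_ext phi) (t, r, w).
Proof.
move=> sw; rewrite -slice_derive1_r /dr; congr (derive1 _ r).
by apply/funext => s; rewrite ray_ext_sphere.
Qed.

Lemma dttE phi t r w : sphere w ->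
  dt (dt phi) t r w = 'D_e_t ('D_e_t (ray_ext phi)) (t, r, w).
Proof.
move=> sw; rewrite -slice_derive1_t {1}/dt; congr (derive1 _ t).
by apply/funext => s; rewrite dtE.
Qed.

Lemma sphere_gradE phi t r w i :
  sphere_grad (phi t r) w ord0 i =
  'D_(e_x (delta_mx ord0 i)) (ray_ext phi) (t, r, w).
Proof. by rewrite /sphere_grad mxE /partial -slice_derive_x. Qed.

Lemma sphere_laplacianE phi t r w :
  sphere_laplacian (phi t r) w = \sum_i
  'D_(e_x (delta_mx ord0 i)) ('D_(e_x (delta_mx ord0 i)) (ray_ext phi)) (t, r, w).
Proof.
rewrite /sphere_laplacian; apply: eq_bigr => i _; rewrite /partial.
rewrite (_ : (fun x => _) = (fun y =>
    'D_(e_x (delta_mx ord0 i)) (ray_ext phi) (t, r, y))); first exact: slice_derive_x.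
by apply/funext => x; rewrite -slice_derive_x.
Qed.

Lemma ang_grad_sqE phi t r w : ang_grad_sq phi t r w = r ^- 2 *
  \sum_i ('D_(e_x (delta_mx ord0 i)) (ray_ext phi) (t, r, w)) ^+ 2.
Proof.
by rewrite /ang_grad_sq enorm_sq; under eq_bigr do rewrite sphere_gradE.
Qed.

(** The difference quotients themselves are constant along rays. *)
Lemma derive_tr_ray (G : V -> R) (a b : R) t r x (c : R) :
  (forall t r x, G (t, r, c *: x) = G (t, r, x)) ->
  'D_(a, b, 0) G (t, r, c *: x) = 'D_(a, b, 0) G (t, r, x).
Proof.
move=> hG; rewrite /derive; set A := (fun h : R => _); set B := (fun h : R => _).
suff -> : A = B by []; apply/funext => h; rewrite /A /B /=.
have E y : h *: (a, b, 0) + (t, r, y) = (h * a + t, h * b + r, y) :> V.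
  by congr (_, _, _); rewrite /= scaler0 add0r.
by rewrite !E !hG.
Qed.

End lift_of_function.


(** * Measurability of continuous functions *)

Section discretisation.
Context {R : realType} {n : nat}.
Local Notation V := (R * R * 'rV[R]_n)%type.
Local Notation Z := (measurableTypeR R * ('rV[R]_n * measurableTypeR R))%type.

(** Integrals are taken with the radius innermost and time outermost; this
   reorders the coordinates. *)
Definition to_V (z : Z) : V := (z.1, z.2.2, z.2.1).

(* The grid of mesh 1 / (m + 1): index of a cell and the node that stands for
   it. *)
Let cell (m : nat) (x : R) : int := Num.floor (m.+1%:R * x).
Let node (m : nat) (k : int) : R := k%:~R / m.+1%:R.

Let node_cell m x : `|x - node m (cell m x)| <= m.+1%:R^-1.
Proof.
rewrite /node /cell; have m0 : (0 : R) < m.+1%:R by rewrite ltr0n.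
set k := Num.floor _.
have h1 : k%:~R <= m.+1%:R * x by have /andP[] := Num.Theory.floor_itv (m.+1%:R * x).
have h2 : m.+1%:R * x < (k + 1)%:~R by have /andP[] := Num.Theory.floor_itv (m.+1%:R * x).
rewrite intrD in h2.
rewrite ler_norml; apply/andP; split.
  rewrite lerBrDl -lerBrDr opprK.
  have : k%:~R / m.+1%:R <= x by rewrite ler_pdivrMr // mulrC.
  move=> h; apply: le_trans h _; rewrite lerDl invr_ge0 ltW //.
rewrite lerBlDl -[X in _ + X]mul1r -mulrDl ler_pdivlMr // mulrC.
exact: ltW.
Qed.

Let measurable_cell m k : measurable [set x : measurableTypeR R | cell m x = k].
Proof.
rewrite (_ : [set _ | _] = `[node m k, node m (k + 1)[%classic).
  exact: measurable_itv.
have m0 : (0 : R) < m.+1%:R by rewrite ltr0n.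
apply/seteqP; split => x /=; rewrite in_itv /= /node /cell.
  move=> <-; rewrite ler_pdivrMr // ltr_pdivlMr // ![x * _]mulrC.
  exact: Num.Theory.floor_itv.
rewrite ler_pdivrMr // ltr_pdivlMr // ![x * _]mulrC => H.
by apply/Num.Theory.floor_def; rewrite addrC in H; rewrite addrC.
Qed.

Let idx (m : nat) (z : Z) : int * int * {ffun 'I_n -> int} :=
  (cell m z.1, cell m z.2.2, [ffun i => cell m (z.2.1 ord0 i)]).

Let point (m : nat) (c : int * int * {ffun 'I_n -> int}) : V :=
  (node m c.1.1, node m c.1.2, \row_i node m (c.2 i)).

Let measurable_idx m c : measurable [set z | idx m z = c].
Proof.
case: c => -[a b] f.
rewrite (_ : [set z | _] = (fst @^-1` [set x | cell m x = a]) `&`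
   ((snd \o snd) @^-1` [set x | cell m x = b]) `&`
   \bigcap_(i in [set: 'I_n])
     ((@rV_coord R n i \o (fst \o snd)) @^-1` [set x | cell m x = f i])).
  apply: measurableI; first apply: measurableI.
  - rewrite -[X in measurable X]setTI.
    by apply: (@measurable_fst _ _ (measurableTypeR R) ('rV[R]_n * measurableTypeR R)%type).
  - rewrite -[X in measurable X]setTI.
    apply: (@measurableT_comp _ _ _ _ _ _ (snd : ('rV[R]_n * measurableTypeR R)%type -> _)) => //.
  - apply: fin_bigcap_measurable => // i _; rewrite -[X in measurable X]setTI.
    apply: (measurableT_comp (@measurable_rV_coord R n i)) => //.
    exact: (measurableT_comp (measurable_fst)).
apply/seteqP; split => -[t [x r]]; rewrite /idx /= /rV_coord.
  by move=> [-> -> /ffunP h]; split => // i _ /=; have := h i; rewrite ffunE.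
move=> [[-> ->] h]; congr (_, _, _); apply/ffunP => i; rewrite ffunE.
exact: (h i I).
Qed.

Let point_cvg (z : Z) : point m (idx m z) @[m --> \oo] --> to_V z.
Proof.
apply/cvgrPdist_le => e e0; near=> m.
have hm : m.+1%:R^-1 <= e.
  near: m.
  by near do rewrite ltW //; exact: near_infty_natSinv_lt (PosNum e0).
rewrite /point /idx /to_V /= !prod_normE /= !ge_max.
rewrite !(le_trans (node_cell _ _) hm) /=.
rewrite [leLHS]/Num.Def.normr /= mx_normrE bigmax_le // ?ltW // => -[i j] _ /=.
by rewrite !mxE ffunE (ord1 i) (le_trans (node_cell _ _) hm).
Unshelve. all: by end_near. Qed.

(** A continuous function is the pointwise limit of its values on finer and
   finer grids, and the latter take countably many values on cells. *)
Lemma measurable_continuous (D : set Z) (G : V -> R) : measurable D ->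
  (forall z, D z -> {for to_V z, continuous G}) ->
  measurable_fun D (fun z => G (to_V z) : measurableTypeR R).
Proof.
move=> mD cG.
apply: (@measurable_fun_cvg _ _ _ D (fun m z => G (point m (idx m z)))); last first.
  by move=> z Dz; apply: continuous_cvg; [exact: cG|exact: point_cvg].
move=> m; apply: measurable_funS (@subsetT _ D) _ => // _ Y mY; rewrite setTI.
rewrite (_ : _ @^-1` _ =
   \bigcup_c [set z | idx m z = c /\ Y (G (point m c))]).
  apply: countable_bigcupT_measurable => // c.
  have [Yc|nYc] := pselect (Y (G (point m c))).
    rewrite (_ : [set _ | _] = [set z | idx m z = c]); first exact: measurable_idx.
    by apply/seteqP; split => z; [case|split].
  by rewrite (_ : [set _ | _] = set0) // -subset0 => z [].
apply/seteqP; split => z /=; first by move=> Yz; exists (idx m z).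
by move=> [c /= _ [<-]].
Qed.

End discretisation.


(** * Iterated integrals over rectangles *)

Section rectangles.
Context d1 d2 (T1 : measurableType d1) (T2 : measurableType d2) (R : realType).
Variables (m1 : {sigma_finite_measure set T1 -> \bar R})
  (m2 : {sigma_finite_measure set T2 -> \bar R}).
Variables (A : set T1) (B : set T2).
Hypotheses (mA : measurable A) (mB : measurable B).
Local Open Scope ereal_scope.
Implicit Types f : T1 * T2 -> \bar R.

Let patchX1 f x y : (f \_ (A `*` B)) (x, y) =
  ((fun x => ((fun y => f (x, y)) \_ B) y) \_ A) x.
Proof.
rewrite /patch; case: ifPn => [|/negP].
  by rewrite inE => -[/= Ax By]; rewrite !mem_set.
rewrite inE /= => h; case: ifPn => //; rewrite inE => Ax; case: ifPn => //.
by rewrite inE => By; case: h.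
Qed.

Let patchX2 f x y : (f \_ (A `*` B)) (x, y) =
  ((fun y => ((fun x => f (x, y)) \_ A) x) \_ B) y.
Proof.
rewrite /patch; case: ifPn => [|/negP].
  by rewrite inE => -[/= Ax By]; rewrite !mem_set.
rewrite inE /= => h; case: ifPn => //; rewrite inE => By; case: ifPn => //.
by rewrite inE => Ax; case: h.
Qed.

Let pull1 f x : \int[m2]_y (f \_ (A `*` B)) (x, y) =
  ((fun x => \int[m2]_(y in B) f (x, y)) \_ A) x.
Proof.
rewrite [in RHS]/patch; case: ifPn => xA.
  rewrite [RHS]integral_mkcond; apply: eq_integral => y _.
  by rewrite patchX1 /patch xA.
by rewrite integral0_eq // => y _; rewrite patchX1 /patch (negbTE xA).
Qed.

Let pull2 f y : \int[m1]_x (f \_ (A `*` B)) (x, y) =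
  ((fun y => \int[m1]_(x in A) f (x, y)) \_ B) y.
Proof.
rewrite [in RHS]/patch; case: ifPn => yB.
  rewrite [RHS]integral_mkcond; apply: eq_integral => x _.
  by rewrite patchX2 /patch yB.
by rewrite integral0_eq // => x _; rewrite patchX2 /patch (negbTE yB).
Qed.

Let mAB : measurable (A `*` B). Proof. exact: measurableX. Qed.

Lemma rect_integral12 f : (m1 \x m2).-integrable (A `*` B) f ->
  \int[m1]_(x in A) \int[m2]_(y in B) f (x, y) =
  \int[m1 \x m2]_(z in A `*` B) f z.
Proof.
move=> /(integrable_mkcond _ mAB) fi.
rewrite [RHS]integral_mkcond -integral12_prod_meas1 // integral_mkcond.
by apply: eq_integral => x _; rewrite -pull1.
Qed.

Lemma rect_integral21 f : (m1 \x m2).-integrable (A `*` B) f ->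
  \int[m2]_(y in B) \int[m1]_(x in A) f (x, y) =
  \int[m1 \x m2]_(z in A `*` B) f z.
Proof.
move=> /(integrable_mkcond _ mAB) fi.
rewrite [RHS]integral_mkcond -integral21_prod_meas1 // integral_mkcond.
by apply: eq_integral => y _; rewrite -pull2.
Qed.

Lemma rect_tonelli12 f : measurable_fun (A `*` B) f ->
  (forall z, (A `*` B) z -> 0 <= f z) ->
  \int[m1]_(x in A) \int[m2]_(y in B) f (x, y) =
  \int[m1 \x m2]_(z in A `*` B) f z.
Proof.
move=> /(measurable_restrictT _ mAB) mf f0.
rewrite [RHS]integral_mkcond fubini_tonelli1 //; last first.
  by move=> z; rewrite /patch; case: ifPn => // /set_mem; exact: f0.
rewrite integral_mkcond.
by apply: eq_integral => x _; rewrite -pull1.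
Qed.

Lemma rect_measurable1 f : measurable_fun (A `*` B) f ->
  (forall z, (A `*` B) z -> 0 <= f z) ->
  measurable_fun A (fun x => \int[m2]_(y in B) f (x, y)).
Proof.
move=> /(measurable_restrictT _ mAB) mf f0.
apply/(measurable_restrictT _ mA).
rewrite (_ : _ \_ A = fun x => \int[m2]_y (f \_ (A `*` B)) (x, y)); last first.
  by apply/funext => x; rewrite -pull1.
apply: (@measurable_fun_fubini_tonelli_F _ _ _ _ _ m2 (f \_ (A `*` B))) => //.
by move=> z; rewrite /patch; case: ifPn => // /set_mem; exact: f0.
Qed.

End rectangles.

Section ftc.
Context {R : realType}.
Local Notation leb := (@lebesgue_measure R).

Lemma ftc_segment (f df : R -> R) (a b : R) : a <= b ->
  (forall x, a <= x <= b -> is_derive x 1 f (df x)) ->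
  (forall x, a <= x <= b -> {for x, continuous df}) ->
  (\int[leb]_(x in `[a, b]) (df x)%:E = (f b - f a)%:E)%E.
Proof.
rewrite le_eqVlt => /orP[/eqP <-|ab] hf cdf.
  by rewrite set_itv1 integral_set1 subrr.
have cf x : a <= x <= b -> {for x, continuous f}.
  by move=> xab; apply/differentiable_continuous/derivable1_diffP; case: (hf x xab).
rewrite EFinB (@continuous_FTC2 _ df f) //.
- apply: continuous_in_subspaceT => x; rewrite inE /= in_itv /=; exact: cdf.
- split.
  + by move=> x; rewrite in_itv /= => /andP[? ?]; case: (hf x) => //; rewrite !ltW.
  + by apply: cvg_at_right_filter; apply: cf; rewrite lexx ltW.
  + by apply: cvg_at_left_filter; apply: cf; rewrite lexx ltW.
- move=> x; rewrite in_itv /= => /andP[? ?]; rewrite derive1E.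
  by apply: isd_val; apply: hf; rewrite !ltW.
Qed.

End ftc.


(** * Integrals of partial derivatives on Euclidean space *)

Section euclidean_divergence.
Context {R : realType}.
Local Notation leb := (@lebesgue_measure R).

Definition cube (n : nat) (M : R) : set 'rV[R]_n := [set x | forall i, `|x ord0 i| <= M].

Lemma measurable_cube n M : measurable (@cube n M).
Proof.
rewrite (_ : cube _ = \bigcap_(i in [set: 'I_n])
    (@rV_coord R n i @^-1` `[- M, M]%classic)).
  apply: fin_bigcap_measurable => // i _; rewrite -[X in measurable X]setTI.
  by apply: measurable_rV_coord => //; exact: measurable_itv.
apply/seteqP; split => x /= h i; have := h i; rewrite /rV_coord /= in_itv /= ler_norml //.
by move=> /(_ I).
Qed.

Lemma rV_cons0 n (p : measurableTypeR R * 'rV[R]_n) : rV_cons p ord0 ord0 = p.1.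
Proof. by have /(congr1 fst) := rV_consK p. Qed.

Lemma rV_consS n (p : measurableTypeR R * 'rV[R]_n) i :
  rV_cons p ord0 (lift ord0 i) = p.2 ord0 i.
Proof. by have /(congr1 snd)/rowP/(_ i) := rV_consK p; rewrite mxE. Qed.

Lemma rV_cons_cube n M : @rV_cons R n @^-1` (cube M) = `[- M, M]%classic `*` cube M.
Proof.
apply/seteqP; split => p /=.
  move=> h; split => [|i] /=; last by rewrite -rV_consS; exact: h.
  by rewrite in_itv /= -ler_norml -rV_cons0; exact: h.
move=> [/=]; rewrite in_itv /= => hx hv i.
by have [j ->|->] := unliftP ord0 i; rewrite ?rV_cons0 ?rV_consS // ler_norml.
Qed.

Lemma lebesgue_cube_lty n M : (lebesgue_rV R n (cube M) < +oo)%E.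
Proof.
elim: n => [|n ih].
  by rewrite /= diracE; case: (_ \in _); rewrite ltry.
rewrite /= /lebesgue_rV_step /pushforward rV_cons_cube.
rewrite product_measure1E; [|exact: measurable_itv|exact: measurable_cube].
apply: lte_mul_pinfty => //.
rewrite ge0_fin_numE //=; have [M0|M0] := leP (- M) M.
  by rewrite lebesgue_measure_itv /= ; case: ifP => _; rewrite -?EFinB ltry.
by rewrite set_itv_ge ?measure0 // bnd_simp -ltNge.
Qed.

Lemma measurable_continuous_rV n (D : set 'rV[R]_n) (g : 'rV[R]_n -> R) :
  measurable D -> (forall x, D x -> {for x, continuous g}) ->
  measurable_fun D (g : _ -> measurableTypeR R).
Proof.
move=> mD cg.
pose G (p : R * R * 'rV[R]_n) := g p.2.
have mf : measurable_fun (setT `*` (D `*` setT))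
    (fun z : measurableTypeR R * ('rV[R]_n * measurableTypeR R) => G (to_V z) : measurableTypeR R).
  apply: measurable_continuous.
    by apply: measurableX => //; exact: measurableX.
  move=> [t [x r]] [_ [/= Dx _]]; rewrite /G /to_V /=.
  apply: (@continuous_comp _ _ _ (fun p : R * R * 'rV[R]_n => p.2) g).
    exact: cvg_snd.
  exact: cg.
pose emb (x : 'rV[R]_n) : measurableTypeR R * ('rV[R]_n * measurableTypeR R) :=
  (0, (x, 0)).
have memb : measurable_fun D emb.
  apply: measurable_funS (@subsetT _ D) _ => //.
  apply/measurable_fun_pairP; split; first exact: measurable_cst.
  by apply/measurable_fun_pairP; split; [exact: measurable_id|exact: measurable_cst].
apply: (measurable_comp _ _ mf memb) => [|_ [x Dx <-] //].
by apply: measurableX => //; exact: measurableX.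
Qed.

(** The recursive definition of Lebesgue measure, for a bounded function with
   support in a cube. *)
Lemma integral_rV_consE n (f : 'rV[R]_n.+1 -> R) (M : R) :
  measurable_fun setT (f : _ -> measurableTypeR R) ->
  (forall x, ~ cube M x -> f x = 0) -> [bounded f x | x in cube M] ->
  let g (p : measurableTypeR R * 'rV[R]_n) : \bar R := (f (rV_cons p))%:E in
  let D := (`[- M, M]%classic : set (measurableTypeR R)) `*` (cube M : set 'rV[R]_n) in
  ((leb : {sigma_finite_measure set (measurableTypeR R) -> \bar R}) \x
    lebesgue_rV R n)%E.-integrable D g /\
  (\int[lebesgue_rV R n.+1]_x (f x)%:E = \int[leb \x lebesgue_rV R n]_(p in D) g p)%E.
Proof.
move=> mf f0 bf g D.
have mD : measurable D.
  by apply: measurableX; [exact: measurable_itv|exact: measurable_cube].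
have mg : measurable_fun setT (fun p => f (@rV_cons R n p) : measurableTypeR R).
  exact: (measurableT_comp mf (@measurable_rV_cons R n)).
have ig : (leb \x lebesgue_rV R n)%E.-integrable D g.
  apply: (@measurable_bounded_integrable _ _ _ _ (fun p => f (rV_cons p))) => //.
  - have := lebesgue_cube_lty n.+1 M.
    by rewrite /= /lebesgue_rV_step /pushforward rV_cons_cube.
  - exact: measurable_funS mg.
  - have [B [Br hB]] := bf; exists B; split => // C BC p Dp; apply: (hB C BC) => /=.
    by move: Dp; rewrite /D -rV_cons_cube.
split => //.
have gD : g \_ D = g.
  apply/funext => p; rewrite /patch; case: ifPn => // /negP pD.
  rewrite /g f0 // => h; apply: pD; rewrite inE /D -rV_cons_cube //.
have igT : (leb \x lebesgue_rV R n)%E.-integrable setT g.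
  by rewrite -gD; exact/(integrable_mkcond _ mD).
rewrite [RHS]integral_mkcond gD.
rewrite /= /lebesgue_rV_step.
rewrite (@integral_pushforward _ _ _ _ _ _ (@measurable_rV_cons R n) _ setT) //.
exact/measurable_EFinP.
Qed.

Lemma compact_cube n M : compact (cube M : set 'rV[R]_n).
Proof.
have := @rV_compact R n (fun=> `[- M, M]%classic) (fun=> @segment_compact _ _ _).
by congr compact; apply/seteqP; split => x /= h i; have := h i;
  rewrite in_itv /= ler_norml.
Qed.

Lemma bounded_on_compact (T : topologicalType) (K : set T) (f : T -> R) : compact K ->
  (forall x, K x -> {for x, continuous f}) -> [bounded f x | x in K].
Proof.
move=> cK cf; have [B [Br hB]] : bounded_set (f @` K).
  apply: compact_bounded; apply: continuous_compact => //.
  by apply: continuous_in_subspaceT => x; rewrite inE; exact: cf.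
by exists B; split => // C BC x Kx; apply: hB => //; exists x.
Qed.

Let addE m (u v : 'rV[R]_m) k i : (u + v) k i = u k i + v k i.
Proof. by rewrite mxE. Qed.

Let oppE m (u : 'rV[R]_m) k i : (- u) k i = - u k i.
Proof. by rewrite mxE. Qed.

Let scaleE m c (u : 'rV[R]_m) k i : (c *: u) k i = c * u k i.
Proof. by rewrite mxE. Qed.

Lemma rV_cons_continuous n : continuous (fun p : R * 'rV[R]_n => rV_cons p : 'rV[R]_n.+1).
Proof.
move=> p; apply/cvgrPdist_le => e e0.
have : \forall q \near p, ball p e q by exact: nbhsx_ballx.
apply: filterS => q; rewrite -ball_normE /ball_ /= => /ltW.
rewrite prod_normE ge_max => /andP[/= h1 h2].
rewrite [leLHS]/Num.Def.normr /= mx_normrE bigmax_le // ?ltW // => -[k i] _ /=.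
rewrite addE oppE (ord1 k); have [j ->|->] := unliftP ord0 i; rewrite ?rV_consS ?rV_cons0 //.
by apply: le_trans h2; have := norm_coord_le (p.2 - q.2) j; rewrite addE oppE.
Qed.

Lemma rV_cons_line0 n (x t : R) (v : 'rV[R]_n) :
  rV_cons (x + t, v) = rV_cons (x, v) + t *: delta_mx ord0 ord0 :> 'rV[R]_n.+1.
Proof.
apply/rowP => i; rewrite addE scaleE.
have [j ->|->] := unliftP ord0 i; rewrite ?rV_consS ?rV_cons0 mxE eqxx /=.
  by rewrite mulr0 addr0.
by rewrite mulr1.
Qed.

Lemma rV_cons_lineS n (x t : R) (v : 'rV[R]_n) j :
  rV_cons (x, v + t *: delta_mx ord0 j) =
  rV_cons (x, v) + t *: delta_mx ord0 (lift ord0 j) :> 'rV[R]_n.+1.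
Proof.
apply/rowP => i; rewrite addE scaleE.
have [k ->|->] := unliftP ord0 i; rewrite ?rV_consS ?rV_cons0 /=.
  by rewrite addE scaleE !mxE (inj_eq (@lift_inj _ _)).
by rewrite mxE /= mulr0 addr0.
Qed.

(** The coordinates are split off one by one, as the measure is built; in the
   direction of the derivative, the fundamental theorem of calculus leaves
   boundary values outside of the support. *)
Lemma integral_partial n (i : 'I_n) (F dF : 'rV[R]_n -> R) (M : R) : 0 <= M ->
  (forall x, is_derive x (delta_mx ord0 i) F (dF x)) ->
  continuous dF -> (forall x, ~ cube M x -> F x = 0) ->
  (\int[lebesgue_rV R n]_x (dF x)%:E = 0)%E.
Proof.
move=> M0; elim: n => [|n ih] in i F dF *; first by case: i.
move=> hF cdF F0.
have dF0 x : ~ cube M x -> dF x = 0.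
  move=> xM; apply: (etrans (esym (isd_val (hF x)))).
  apply: isd_val; apply: (isd_near (isd_cst 0 _ _)).
  have oc : open (~` (cube M : set 'rV[R]_n.+1)).
    apply: closed_openC; apply: compact_closed; last exact: compact_cube.
    exact: norm_hausdorff.
  by apply: filterS (open_nbhs_nbhs (conj oc xM)) => y yM; rewrite F0.
have sub (m : nat) (x : 'rV[R]_m) : ~ cube (M + 1) x -> ~ cube M x.
  by move=> h1 h2; apply: h1 => k; apply: le_trans (h2 k) _; rewrite lerDl.
have [ig ->] := @integral_rV_consE n dF (M + 1)
  (measurable_continuous_rV measurableT (fun x _ => cdF x))
  (fun x xM => dF0 x (sub _ _ xM))
  (bounded_on_compact (@compact_cube _ _) (fun x _ => cdF x)).
have mI : measurable (`[- (M + 1), M + 1]%classic : set (measurableTypeR R)).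
  exact: measurable_itv.
have [j ij|i0] := unliftP ord0 i; last first.
- rewrite -rect_integral21 //; last exact: measurable_cube.
  apply: integral0_eq => v _ /=.
  have h1 (x : R) : - (M + 1) <= x <= M + 1 ->
      is_derive x 1 (fun x => F (rV_cons (x, v))) (dF (rV_cons (x, v))).
    move=> _; apply/isd_line.
    have /isd_line h := hF (rV_cons (x, v)); apply: (isd_eq h) => // t.
    by rewrite i0 [t *: 1]mulr1 rV_cons_line0.
  have h2 (x : R) : - (M + 1) <= x <= M + 1 ->
      {for x, continuous (fun x : R => dF (rV_cons (x, v)))}.
    move=> _; apply: (@continuous_comp _ _ _ (fun x => rV_cons (x, v)) dF).
      apply: (@continuous_comp _ _ _ (fun x : R => (x, v)) (fun p => rV_cons p)).
        by apply: ct_pair; [exact: cvg_id|exact: cst_continuous].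
      exact: rV_cons_continuous.
    exact: cdF.
  have h0 : - (M + 1) <= M + 1 by lra.
  rewrite (ftc_segment h0 h1 h2) !F0 ?subrr // => /(_ ord0); rewrite rV_cons0 /=.
    by rewrite normrN ger0_norm; lra.
  by rewrite ger0_norm; lra.
- rewrite -rect_integral12 //; last exact: measurable_cube.
  apply: integral0_eq => x _ /=.
  have h1 v : is_derive v (delta_mx ord0 j) (fun v => F (rV_cons (x, v)))
      (dF (rV_cons (x, v))).
    apply/isd_line.
    have /isd_line h := hF (rV_cons (x, v)); apply: (isd_eq h) => // t.
    by rewrite ij rV_cons_lineS.
  have h2 : continuous (fun v : 'rV[R]_n => dF (rV_cons (x, v))).
    move=> v; apply: (@continuous_comp _ _ _ (fun v => rV_cons (x, v)) dF).
      apply: (@continuous_comp _ _ _ (fun v : 'rV[R]_n => (x, v)) (fun p => rV_cons p)).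
        by apply: ct_pair; [exact: cst_continuous|exact: cvg_id].
      exact: rV_cons_continuous.
    exact: cdF.
  have h3 v : ~ cube M v -> F (rV_cons (x, v)) = 0.
    move=> vM; apply: F0 => h; apply: vM => k.
    by have := h (lift ord0 k); rewrite rV_consS.
  rewrite -(ih j _ _ h1 h2 h3).
  rewrite integral_mkcond; apply: eq_integral => v _.
  rewrite /patch; case: ifPn => // /negP vM; rewrite dF0 // => h.
  apply: vM; rewrite inE => k; have := h (lift ord0 k); rewrite rV_consS /= => hk.
  by apply: le_trans hk _; rewrite lerDl.
Qed.

End euclidean_divergence.


(** * Integration over the sphere *)

Section surface_integral.
Context {R : realType} {n : nat}.
Local Notation leb_n := (lebesgue_rV R n).
Local Notation sigma := (@surface_measure R n).
Local Notation S := (@sphere R n).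
Local Notation pb := (@punctured_ball R n).

Lemma measurable_sphere : measurable S.
Proof.
rewrite (_ : S = @enorm R n @^-1` [set 1]) //.
rewrite -[X in measurable X]setTI.
exact: (@measurable_enorm R n measurableT [set 1] (measurable_set1 1)).
Qed.

Lemma punctured_ball_sub_cube : pb `<=` cube 1.
Proof. by move=> x /andP[_ x1] i; apply: le_trans (coord_le_enorm x i) x1. Qed.

Lemma punctured_ball_lty : (leb_n pb < +oo)%E.
Proof.
apply: le_lt_trans (lebesgue_cube_lty n 1); apply: le_measure.
- by rewrite inE; exact: measurable_punctured_ball.
- by rewrite inE; exact: measurable_cube.
- exact: punctured_ball_sub_cube.
Qed.

Lemma surface_measure_fin : fin_num_fun sigma.
Proof.
move=> A mA; rewrite ge0_fin_numE //= /surface_measure lte_mul_pinfty //.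
apply: le_lt_trans punctured_ball_lty; apply: le_measure; last by move=> x [].
- rewrite inE; apply: measurableI; last exact: measurable_punctured_ball.
  by rewrite -[X in measurable X]setTI; exact: measurable_direction.
- by rewrite inE; exact: measurable_punctured_ball.
Qed.

HB.instance Definition _ :=
  @Measure_isFinite.Build _ _ _ sigma surface_measure_fin.

(** Integrals over the sphere become integrals over the punctured ball of
   functions constant along rays, the form in which the divergence theorem of
   the ambient space applies. *)
Lemma ge0_integral_sphere (G : 'rV[R]_n -> \bar R) :
  measurable_fun S G -> (forall w, S w -> 0 <= G w)%E ->
  (\int[sigma]_(w in S) G w =
   n%:R%:E * \int[leb_n]_(x in pb) G (direction x))%E.
Proof.
move=> mG G0.
have mS := measurable_sphere; have mpb := @measurable_punctured_ball R n.
pose m1 : {measure set 'rV[R]_n -> \bar R} := mrestr leb_n mpb.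
pose m2 : {measure set 'rV[R]_n -> \bar R} :=
   (measure_function_pushforward__canonical__measure_function_Measure
      m1 (@measurable_direction R n)).
pose c : {nonneg R} := NngNum (ler0n R n).
have -> : (\int[sigma]_(w in S) G w = \int[mscale c m2]_(w in S) G w)%E.
  exact: eq_measure_integral.
rewrite ge0_integral_mscale //; congr (_ * _)%E.
have -> : (\int[m2]_(w in S) G w = \int[pushforward m1 (@direction R n)]_(w in S) G w)%E.
  by [].
rewrite ge0_integral_pushforward //; first last.
- by move=> y; rewrite inE; exact: G0.
- exact: measurable_direction.
have mD : measurable (@direction R n @^-1` S).
  by rewrite -[X in measurable X]setTI; exact: measurable_direction.
have sub : pb `<=` @direction R n @^-1` S.
  by move=> x /andP[x0 _]; apply: sphere_direction; rewrite -enorm_gt0.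
rewrite (@ge0_negligible_integral _ _ _ m1 _ (@direction R n @^-1` S `\` pb)) //.
- have E : @direction R n @^-1` S `\` (@direction R n @^-1` S `\` pb) = pb.
    by rewrite setDD; exact: setIidr.
  rewrite E; by apply: eq_measure_integral => A mA Apb; rewrite /= /mrestr setIidl.
- exact: measurableD.
- apply: (measurable_comp mS _ mG) => [_ [x Dx <-] //|].
  by apply: measurable_funS (@subsetT _ _) _ => //; exact: measurable_direction.
- by move=> x Dx; exact: G0.
- change (leb_n ((@direction R n @^-1` S `\` pb) `&` pb) = 0%E).
  by rewrite setDE -setIA setICl setI0 measure0.
Qed.

End surface_integral.


(** * Cutoff functions of one variable *)

Section positive_part_square.
Context {R : realType}.
Implicit Types z : R.

(** The square of the positive part: the simplest function of class C^1 that
   vanishes exactly on a half-line. *)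
Definition pp z : R := Num.max 0 z ^+ 2.
Definition dpp z : R := 2 * Num.max 0 z.

Lemma max0_continuous : continuous (fun z : R => Num.max 0 z).
Proof.
move=> z; apply: (@continuous_max R R (fun=> 0) id); last exact: cvg_id.
exact: cst_continuous.
Qed.

Lemma pp_ge0 z : 0 <= pp z. Proof. exact: sqr_ge0. Qed.

Lemma pp_le0 z : z <= 0 -> pp z = 0.
Proof. by move=> z0; rewrite /pp max_l // expr0n. Qed.

Lemma pp_ge z : 0 <= z -> pp z = z ^+ 2.
Proof. by move=> z0; rewrite /pp max_r. Qed.

Lemma dpp_ge0 z : 0 <= dpp z.
Proof. by rewrite mulr_ge0 // le_max lexx. Qed.

Lemma dpp_le0 z : z <= 0 -> dpp z = 0.
Proof. by move=> z0; rewrite /dpp max_l // mulr0. Qed.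

Lemma dpp_continuous : continuous dpp.
Proof. by move=> z; exact: (ctM (ct_cst 2 z) (@max0_continuous z)). Qed.

Lemma is_derive_pp z : is_derive z 1 pp (dpp z).
Proof.
have [z0|z0|->] := ltrgtP z 0.
- rewrite dpp_le0 ?ltW //; apply: (isd_near (isd_cst 0 z 1)).
  have : \forall y \near z, y < 0 by exact: lt_nbhsl.
  by apply: filterS => y y0; rewrite pp_le0 // ltW.
- rewrite /dpp max_r ?ltW //.
  have h : is_derive z 1 (fun y : R => y * y) (2 * z).
    have H := isdM (is_derive_id z 1) (is_derive_id z 1).
    by apply: (isd_eq H) => //=; rewrite mulr1 -mulr2n mulr_natl.
  apply: (isd_near h).
  have : \forall y \near z, 0 < y by exact: lt_nbhsr.
  by apply: filterS => y y0; rewrite pp_ge ?ltW.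
- apply/is_derive1_caratheodory; exists (fun y => Num.max 0 y); split.
  + move=> y; rewrite (pp_le0 (lexx 0)) !subr0 /pp expr2.
    by have [y0|y0] := leP y 0; rewrite ?mul0r.
  + exact: max0_continuous.
  + by rewrite dpp_le0 // max_l.
Qed.

Lemma pp_continuous : continuous pp.
Proof. by move=> z; exact: (ctX 2 (@max0_continuous z)). Qed.

Lemma pp_homo : {homo pp : y z / y <= z}.
Proof.
move=> y z yz; rewrite /pp !expr2.
have h : Num.max 0 y <= Num.max 0 z by rewrite ge_max !le_max lexx yz orbT.
by apply: ler_pM => //; rewrite le_max lexx.
Qed.

Lemma pp_le1 z : z <= 1 -> pp z <= 1.
Proof. by move=> /pp_homo; rewrite (pp_ge ler01) expr1n. Qed.

(** A step of class C^1 from 0 on the negative half-line to 1 beyond 1. *)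
Definition step z : R := 1 - pp (1 - pp z).
Definition dstep z : R := dpp (1 - pp z) * dpp z.

Lemma step_le0 z : z <= 0 -> step z = 0.
Proof. by move=> z0; rewrite /step (pp_le0 z0) subr0 (pp_ge ler01) expr1n subrr. Qed.

Lemma dstep_le0 z : z <= 0 -> dstep z = 0.
Proof. by move=> z0; rewrite /dstep (dpp_le0 z0) mulr0. Qed.

Lemma step_ge1 z : 1 <= z -> step z = 1.
Proof.
move=> z1; have h : 1 - pp z <= 0.
  by rewrite pp_ge ?(le_trans ler01) // subr_le0 exprn_ege1.
by rewrite /step (pp_le0 h) subr0.
Qed.

Lemma step_01 z : 0 <= step z <= 1.
Proof.
rewrite /step subr_ge0 lerBlDr lerDl pp_ge0 andbT; apply: pp_le1.
by rewrite lerBlDr lerDl pp_ge0.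
Qed.

Lemma is_derive_step z : is_derive z 1 step (dstep z).
Proof.
have h1 := isdD (isd_cst 1 z 1) (isdN (is_derive_pp z)).
have h2 := @isd_comp _ _ pp (fun y => 1 - pp y) z 1 _ _ (is_derive_pp _) h1.
have h3 := isdD (isd_cst 1 z 1) (isdN h2).
by apply: (isd_eq h3) => //; rewrite /dstep; ring.
Qed.

Lemma dstep_continuous : continuous dstep.
Proof.
move=> z; apply: (@ctM _ _ (fun z => dpp (1 - pp z)) dpp z); last exact: dpp_continuous.
apply: (@ct_comp _ _ dpp (fun z => 1 - pp z)); first exact: dpp_continuous.
exact: (ctD (ct_cst 1 z) (ctN (@pp_continuous z))).
Qed.

Lemma step_continuous : continuous step.
Proof.
move=> z; apply: (ctD (ct_cst 1 z)); apply: ctN.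
apply: (@ct_comp _ _ pp (fun z => 1 - pp z)); first exact: pp_continuous.
exact: (ctD (ct_cst 1 z) (ctN (@pp_continuous z))).
Qed.

End positive_part_square.


(** * Integration by parts on the sphere *)

Section integrable_cube.
Context {R : realType} {n : nat}.
Local Notation leb_n := (lebesgue_rV R n).

Lemma integrable_continuous_cube (f : 'rV[R]_n -> R) (M : R) :
  continuous f -> (forall x, ~ cube M x -> f x = 0) ->
  leb_n.-integrable setT (EFin \o f).
Proof.
move=> cf f0; have mC := @measurable_cube R n M.
have fE : (EFin \o f) \_ (cube M) = EFin \o f.
  apply/funext => x; rewrite /patch; case: ifPn => // /negP h.
  by rewrite /= f0 // => hx; apply: h; rewrite inE.
rewrite -fE; apply/(integrable_mkcond _ mC).
apply: measurable_bounded_integrable => //.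
- exact: lebesgue_cube_lty.
- by apply: measurable_continuous_rV => // x _; exact: cf.
- by apply: bounded_on_compact => [|x _]; [exact: compact_cube|exact: cf].
Qed.

End integrable_cube.

Section sphere_ibp.
Context {R : realType} {n : nat}.
Local Notation leb_n := (lebesgue_rV R n).
Local Notation sigma := (@surface_measure R n).
Local Notation S := (@sphere R n).
Local Notation pb := (@punctured_ball R n).
Local Notation e i := (delta_mx ord0 i : 'rV[R]_n).

Definition sumsq (x : 'rV[R]_n) : R := \sum_i x ord0 i ^+ 2.

Lemma is_derive_sumsq x i : is_derive x (e i) sumsq (2 * x ord0 i).
Proof.
have hc j : is_derive x (e i) (fun y : 'rV[R]_n => y ord0 j) (j == i)%:R.
  apply/isd_line.
  have h := isdD (isd_cst (x ord0 j) (0 : R) 1)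
    (isdM (is_derive_id (0 : R) 1) (isd_cst (j == i)%:R (0 : R) 1)).
  apply: (isd_eq h) => [t /=|]; last by rewrite mulr0 mulr1 !add0r.
  by rewrite !mxE /= eq_sym.
have h := isd_sum (index_enum 'I_n) (fun j => isdM (hc j) (hc j)).
apply: (isd_eq h) => [y|]; first by apply: eq_bigr => j _; rewrite expr2.
rewrite (bigD1 i) //= eqxx mulr1 big1 => [|j /negbTE ji].
  by rewrite addr0 -mulr2n mulr_natl.
by rewrite ji mulr0 addr0.
Qed.

Lemma sumsq_enorm x : sumsq x = enorm x ^+ 2.
Proof. by rewrite enorm_sq. Qed.

Lemma sumsq_gt0 x : (0 < sumsq x) = (x != 0).
Proof. by rewrite sumsq_enorm exprn_even_gt0 //= enorm_eq0. Qed.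

Lemma derive_scaled (f : 'rV[R]_n -> R) (a c : R) (x v : 'rV[R]_n) : c != 0 ->
  (\forall y \near x, f (c *: y) = a * f y) ->
  derivable f x v -> derivable f (c *: x) v ->
  'D_v f (c *: x) = a * c^-1 * 'D_v f x.
Proof.
move=> c0 hf d1 d2.
have h1 := isdM (isd_cst a x v) (derivableP d1).
have /isd_line h2 := isd_scale c (derivableP d2).
have h3 : is_derive x v (fun y => f (c *: y)) (c * 'D_v f (c *: x)).
  apply/isd_line; apply: (isd_eq h2) => // t.
  by rewrite scalerDr !scalerA mulrC.
have h4 := isd_near h3 hf.
have := isd_val h4; rewrite (isd_val h1) mulr0 addr0 => E.
by rewrite mulrAC E mulrC mulKf.
Qed.

Variables (h f : 'rV[R]_n -> R).
Hypotheses (hZ : forall (c : R) (x : 'rV[R]_n), 0 < c -> h (c *: x) = h x)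
  (fZ : forall (c : R) (x : 'rV[R]_n), 0 < c -> f (c *: x) = f x)
  (dh : forall (x : 'rV[R]_n) (i : 'I_n), x != 0 -> derivable h x (e i))
  (df : forall (x : 'rV[R]_n) (i : 'I_n), x != 0 -> derivable f x (e i))
  (ddf : forall (x : 'rV[R]_n) (i : 'I_n), x != 0 -> derivable ('D_(e i) f) x (e i))
  (ch : forall x : 'rV[R]_n, x != 0 -> {for x, continuous h})
  (cdh : forall (x : 'rV[R]_n) (i : 'I_n), x != 0 -> {for x, continuous ('D_(e i) h)})
  (cdf : forall (x : 'rV[R]_n) (i : 'I_n), x != 0 -> {for x, continuous ('D_(e i) f)})
  (cddf : forall (x : 'rV[R]_n) (i : 'I_n), x != 0 -> {for x, continuous ('D_(e i) ('D_(e i) f))}).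

Let Div x := h x * (\sum_i 'D_(e i) ('D_(e i) f) x) +
  \sum_i 'D_(e i) h x * 'D_(e i) f x.

Let neq0_near (x : 'rV[R]_n) : x != 0 -> \forall y \near x, y != 0.
Proof.
move=> x0; have : open (~` [set (0 : 'rV[R]_n)]).
  by apply: closed_openC; apply: accessible_closed_set1;
     apply: hausdorff_accessible; exact: norm_hausdorff.
move=> o; apply: filterS (open_nbhs_nbhs (conj o _)) => [y /eqP y0 //|].
exact/eqP.
Qed.

(* Constancy along rays: the gradient of f is tangential. *)
Let euler (x : 'rV[R]_n) : x != 0 -> \sum_i x ord0 i * 'D_(e i) f x = 0.
Proof.
move=> x0.
have hs i y : y != 0 -> is_derive y (x ord0 i *: e i) f (x ord0 i * 'D_(e i) f y).
  by move=> y0; apply: isd_scale; apply: derivableP; exact: df.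
have H : is_derive x (\sum_i x ord0 i *: e i) f
    (\sum_i 'D_(x ord0 i *: e i) f x).
  apply: isd_sumv.
    by apply: filterS (neq0_near x0) => y y0 i; exact: isd_ex (hs i y y0).
  move=> i; have E : \forall z \near x,
      x ord0 i * 'D_(e i) f z = 'D_(x ord0 i *: e i) f z.
    by apply: filterS (neq0_near x0) => y y0; rewrite (isd_val (hs i y y0)).
  have E0 : x ord0 i * 'D_(e i) f x = 'D_(x ord0 i *: e i) f x.
    exact: (nbhs_singleton E).
  have H : x ord0 i * 'D_(e i) f z @[z --> x] --> x ord0 i * 'D_(e i) f x.
    exact: (ctM (ct_cst (x ord0 i) x) (@cdf x i x0)).
  rewrite E0 in H; exact: (cvg_trans (near_eq_cvg E) H).
rewrite -row_sum_delta in H.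
have H0 : is_derive x x f 0.
  apply/isd_line; apply: (isd_near (isd_cst (f x) (0 : R) 1)).
  have : \forall t \near (0 : R), -1 < t by apply: lt_nbhsr; rewrite oppr_lt0.
  apply: filterS => t t1.
  by rewrite -[X in f (X + _)]scale1r -scalerDl fZ //; lra.
transitivity (\sum_i 'D_(x ord0 i *: e i) f x).
  by apply: eq_bigr => i _; rewrite (isd_val (hs i x x0)).
exact: (etrans (esym (isd_val H)) (isd_val H0)).
Qed.

(* The divergence is homogeneous of degree -2, so that its values on the ball
   are determined by those on the sphere. *)
Let DivZ (c : R) (x : 'rV[R]_n) : 0 < c -> x != 0 -> Div (c *: x) = c ^- 2 * Div x.
Proof.
move=> c0 x0; have cx0 : c *: x != 0 by rewrite scaler_eq0 negb_or (gt_eqF c0).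
have cN : c != 0 by rewrite gt_eqF.
have f1 y i : y != 0 -> 'D_(e i) f (c *: y) = c^-1 * 'D_(e i) f y.
  move=> y0; have cy0 : c *: y != 0 by rewrite scaler_eq0 negb_or (gt_eqF c0).
  have H : \forall u \near y, f (c *: u) = 1 * f u.
    by apply: filterS (neq0_near y0) => u _; rewrite mul1r fZ.
  by rewrite (derive_scaled cN H (@df _ i y0) (@df _ i cy0)) mul1r.
have h1 i : 'D_(e i) h (c *: x) = c^-1 * 'D_(e i) h x.
  have H : \forall u \near x, h (c *: u) = 1 * h u.
    by apply: filterS (neq0_near x0) => u _; rewrite mul1r hZ.
  by rewrite (derive_scaled cN H (@dh _ i x0) (@dh _ i cx0)) mul1r.
have f2 i : 'D_(e i) ('D_(e i) f) (c *: x) = c ^- 2 * 'D_(e i) ('D_(e i) f) x.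
  have H : \forall u \near x, 'D_(e i) f (c *: u) = c^-1 * 'D_(e i) f u.
    by apply: filterS (neq0_near x0) => u u0; exact: f1.
  by rewrite (derive_scaled cN H (@ddf _ i x0) (@ddf _ i cx0)) expr2 invfM.
rewrite /Div hZ // (eq_bigr _ (fun i _ => f2 i)) -mulr_sumr.
rewrite [X in _ + X](eq_bigr (fun i => c ^- 2 * ('D_(e i) h x * 'D_(e i) f x))).
  by rewrite -mulr_sumr mulrCA -mulrDr.
by move=> i _; rewrite h1 f1 // expr2 invfM; ring.
Qed.

Let Div_direction (x : 'rV[R]_n) : x != 0 -> sumsq x * Div x = Div (direction x).
Proof.
move=> x0; rewrite /direction DivZ ?invr_gt0 ?enorm_gt0 // sumsq_enorm.
by rewrite exprVn invrK.
Qed.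

Let cDiv (x : 'rV[R]_n) : x != 0 -> {for x, continuous Div}.
Proof.
move=> x0; apply: ctD.
  by apply: ctM; [exact: ch|apply: ct_sum => i; exact: cddf].
by apply: ct_sum => i; apply: ctM; [exact: cdh|exact: cdf].
Qed.

(* The radial cutoffs tend to the indicator function of (0, 1], as functions
   of the squared norm. *)
Let chi (m : nat) (q : R) := step (m.+1%:R * q - 1) * step (1 + m.+1%:R * (1 - q)).

Let dchi (m : nat) (q : R) := m.+1%:R *
  (step (1 + m.+1%:R * (1 - q)) * dstep (m.+1%:R * q - 1) -
   step (m.+1%:R * q - 1) * dstep (1 + m.+1%:R * (1 - q))).

Let is_derive_chi (m : nat) (q : R) : is_derive q 1 (chi m) (dchi m q).
Proof.
have a1 : is_derive q 1 (fun q : R => m.+1%:R * q - 1) m.+1%:R.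
  have H := isdD (isdM (isd_cst m.+1%:R q 1) (is_derive_id q 1)) (isd_cst (-1) q 1).
  by apply: (isd_eq H) => //=; ring.
have a2 : is_derive q 1 (fun q : R => 1 + m.+1%:R * (1 - q)) (- m.+1%:R).
  have H := isdD (isd_cst 1 q 1) (isdM (isd_cst m.+1%:R q 1)
    (isdD (isd_cst 1 q 1) (isdN (is_derive_id q 1)))).
  by apply: (isd_eq H) => //=; ring.
have b1 := @isd_comp _ _ step _ q 1 _ _ (is_derive_step _) a1.
have b2 := @isd_comp _ _ step _ q 1 _ _ (is_derive_step _) a2.
have := isdM b1 b2.
by move=> H; apply: (isd_eq H) => //=; rewrite /dchi; ring.
Qed.

Let caff (a b : R) : continuous (fun q : R => a * q + b).
Proof. by move=> q; exact: (ctD (ctM (ct_cst a q) (@cvg_id _ _)) (ct_cst b q)). Qed.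

Let caff' (a : R) : continuous (fun q : R => 1 + a * (1 - q)).
Proof.
move=> q; have -> : (fun q : R => 1 + a * (1 - q)) = (fun q => - a * q + (1 + a)).
  by apply/funext => u; ring.
exact: caff.
Qed.

Let chi_parts (m : nat) (xi : R -> R) (q : R) : continuous xi ->
  {for q, continuous (fun q : R => xi (m.+1%:R * q - 1))} /\
  {for q, continuous (fun q : R => xi (1 + m.+1%:R * (1 - q)))}.
Proof.
move=> cxi; split.
  exact: (@ct_comp _ _ xi (fun q : R => m.+1%:R * q - 1) q (@cxi _) (@caff _ _ q)).
exact: (@ct_comp _ _ xi (fun q : R => 1 + m.+1%:R * (1 - q)) q (@cxi _) (@caff' _ q)).
Qed.

Let chi_continuous (m : nat) : continuous (chi m).
Proof.
move=> q; have [h1 h2] := @chi_parts m _ q step_continuous.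
exact: (ctM h1 h2).
Qed.

Let dchi_continuous (m : nat) : continuous (dchi m).
Proof.
move=> q; have [h1 h2] := @chi_parts m _ q step_continuous.
have [h3 h4] := @chi_parts m _ q dstep_continuous.
exact: (ctM (ct_cst m.+1%:R q) (ctD (ctM h2 h3) (ctN (ctM h1 h4)))).
Qed.

Let chi_small (m : nat) (q : R) : m.+1%:R * q <= 1 -> chi m q = 0.
Proof. by move=> hq; rewrite /chi step_le0 ?mul0r // subr_le0. Qed.

Let dchi_small (m : nat) (q : R) : m.+1%:R * q <= 1 -> dchi m q = 0.
Proof.
move=> hq; have h' : m.+1%:R * q - 1 <= 0 by rewrite subr_le0.
by rewrite /dchi (step_le0 h') (dstep_le0 h') mulr0 mul0r subr0 mulr0.
Qed.

Let chi_large (m : nat) (q : R) : 2 <= q -> chi m q = 0.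
Proof.
move=> q2; rewrite /chi [X in _ * X]step_le0 ?mulr0 //.
have : (1 : R) <= m.+1%:R by rewrite ler1n.
by move=> m1; nra.
Qed.

Let chi_01 (m : nat) (q : R) : 0 <= chi m q <= 1.
Proof.
have /andP[a0 a1] := step_01 (m.+1%:R * q - 1).
have /andP[b0 b1] := step_01 (1 + m.+1%:R * (1 - q)).
by rewrite mulr_ge0 //= mulr_ile1.
Qed.

(* The vector field to be integrated over the whole space. The factor |x|^2
   makes its divergence chi times a function that is constant along rays. *)
Let F (m : nat) (i : 'I_n) (x : 'rV[R]_n) := (chi m (sumsq x) * sumsq x) * (h x * 'D_(e i) f x).

Let dF (m : nat) (i : 'I_n) (x : 'rV[R]_n) :=
  (chi m (sumsq x) * sumsq x) *
    (h x * 'D_(e i) ('D_(e i) f) x + 'D_(e i) f x * 'D_(e i) h x) +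
  (h x * 'D_(e i) f x) * ((chi m (sumsq x) + sumsq x * dchi m (sumsq x)) *
    (2 * x ord0 i)).

Let small_near0 m : \forall y \near (0 : 'rV[R]_n), m.+1%:R * sumsq y <= 1.
Proof.
have c : {for (0 : 'rV[R]_n), continuous (fun y => m.+1%:R * sumsq y)}.
  by apply: ctM; [exact: ct_cst|exact: sumsq_continuous].
have /(@cvgrPdist_lt _ _ _ (nbhs (0 : 'rV[R]_n))) /(_ 1 ltr01) := c.
apply: filterS => y; have -> : sumsq (0 : 'rV[R]_n) = 0.
  by rewrite /sumsq big1 // => i _; rewrite mxE expr0n.
by rewrite mulr0 sub0r normrN => /ltW; apply: le_trans; exact: ler_norm.
Qed.

Let is_derive_F (m : nat) (i : 'I_n) (x : 'rV[R]_n) : is_derive x (e i) (F m i) (dF m i x).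
Proof.
have [->|x0] := eqVneq x 0.
  have sm := small_near0 m.
  have s0 := nbhs_singleton sm.
  rewrite /dF chi_small // dchi_small // !mul0r !mulr0 addr0 !mul0r mulr0 addr0.
  apply: (isd_near (isd_cst 0 _ _)); apply: filterS sm => y ys.
  by rewrite /F chi_small // !mul0r.
have q := is_derive_sumsq x i.
have a := @isd_comp _ _ (chi m) sumsq x (e i) _ _ (is_derive_chi m _) q.
have b := isdM (derivableP (@dh _ i x0)) (derivableP (@ddf _ i x0)).
have H := isdM (isdM a q) b.
by apply: (isd_eq H) => //; rewrite /dF; ring.
Qed.

Let dF_continuous m i : continuous (dF m i).
Proof.
move=> x; have [->|x0] := eqVneq x 0.
  have sm := small_near0 m.
  have E : \forall y \near (0 : 'rV[R]_n), 0 = dF m i y.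
    apply: filterS sm => y ys.
    by rewrite /dF chi_small // dchi_small // !mul0r !mulr0 addr0 !mul0r mulr0 addr0.
  have E0 : 0 = dF m i 0 by exact: (nbhs_singleton E).
  have H : (fun=> 0) y @[y --> (0 : 'rV[R]_n)] --> dF m i 0.
    by rewrite -E0; exact: (ct_cst (0 : R) (0 : 'rV[R]_n)).
  exact: (cvg_trans (near_eq_cvg E) H).
have cs : {for x, continuous sumsq} by exact: sumsq_continuous.
have cc : {for x, continuous (fun x => chi m (sumsq x))}.
  by apply: (@ct_comp _ _ (chi m) sumsq) => //; exact: chi_continuous.
have cd : {for x, continuous (fun x => dchi m (sumsq x))}.
  by apply: (@ct_comp _ _ (dchi m) sumsq) => //; exact: dchi_continuous.
have cx : {for x, continuous (fun x : 'rV[R]_n => x ord0 i)} by exact: coord_continuous.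
have h1 := @ch x x0; have h2 := @cdh x i x0; have h3 := @cdf x i x0; have h4 := @cddf x i x0.
exact: (ctD (ctM (ctM cc cs) (ctD (ctM h1 h4) (ctM h3 h2)))
  (ctM (ctM h1 h3) (ctM (ctD cc (ctM cs cd)) (ctM (ct_cst 2 x) cx)))).
Qed.

Let far2 (x : 'rV[R]_n) : ~ cube 2 x -> 2 <= sumsq x.
Proof.
move=> hx; rewrite leNgt; apply/negP => hq; apply: hx => i.
rewrite leNgt; apply/negP => xi.
have : x ord0 i ^+ 2 <= sumsq x.
  by rewrite /sumsq (bigD1 i) //= lerDl sumr_ge0 // => j _; exact: sqr_ge0.
rewrite -real_normK ?num_real // => h2; nra.
Qed.

Let F_far (m : nat) (i : 'I_n) x : ~ cube 2 x -> F m i x = 0.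
Proof. by move=> /far2 x2; rewrite /F chi_large // !mul0r. Qed.

Let sum_dF m x : \sum_i dF m i x = chi m (sumsq x) * Div (direction x).
Proof.
have [->|x0] := eqVneq x 0.
  have s0 := nbhs_singleton (small_near0 m).
  rewrite chi_small // mul0r big1 // => i _.
  by rewrite /dF chi_small // dchi_small // !mul0r !mulr0 addr0 !mul0r mulr0 addr0.
rewrite -Div_direction // mulrA big_split /= -mulr_sumr.
rewrite [X in _ + X](_ : _ = 2 * h x * (chi m (sumsq x) + sumsq x * dchi m (sumsq x))
   * (\sum_i x ord0 i * 'D_(e i) f x)); last first.
  by rewrite mulr_sumr; apply: eq_bigr => i _; ring.
rewrite euler // mulr0 addr0; congr (_ * _); rewrite big_split /= -mulr_sumr.
by rewrite /Div; congr (_ + _); apply: eq_bigr => i _; rewrite mulrC.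
Qed.

Let dF_far (m : nat) (i : 'I_n) x : ~ cube 2 x -> dF m i x = 0.
Proof.
move=> xM; apply: (etrans (esym (isd_val (is_derive_F m i x)))).
apply: isd_val; apply: (isd_near (isd_cst 0 _ _)).
have oc : open (~` (cube 2 : set 'rV[R]_n)).
  apply: closed_openC; apply: compact_closed; last exact: compact_cube.
  exact: norm_hausdorff.
by apply: filterS (open_nbhs_nbhs (conj oc xM)) => y yM; rewrite F_far.
Qed.

Let integral_chi m : (\int[leb_n]_x (chi m (sumsq x) * Div (direction x))%:E = 0)%E.
Proof.
under eq_integral do rewrite -sum_dF -sumEFin.
rewrite integral_sum //=; last first.
  move=> i; apply: (@integrable_continuous_cube _ _ (dF m i) 2).
    exact: dF_continuous.
  exact: dF_far.
rewrite big1 // => i _.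
exact: (@integral_partial _ n i (F m i) (dF m i) 2 (ler0n _ _)
  (is_derive_F m i) (@dF_continuous m i) (@F_far m i)).
Qed.

Let chi_cvg (x : 'rV[R]_n) :
  chi m (sumsq x) @[m --> \oo] --> (\1_pb x : R).
Proof.
have hpb : (x \in pb) = (0 < sumsq x <= 1).
  rewrite sumsq_gt0 sumsq_enorm -enorm_gt0.
  rewrite -[X in _ && (_ <= X)](expr1n _ 2) ler_sqr ?nnegrE ?enorm_ge0 //.
  by apply/idP/idP; rewrite inE.
rewrite indicE hpb; set q := sumsq x.
have q0 : 0 <= q by rewrite /q sumsq_enorm sqr_ge0.
move: q0; rewrite le_eqVlt => /predU1P[<-|q0].
  rewrite ltxx /=; under eq_fun do rewrite chi_small ?mulr0 //; exact: cvg_cst.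
rewrite q0 /=; have [q1|q1] := leP q 1.
  apply: cvg_near_cst; near=> m.
  have hm : 2 / q <= m.+1%:R.
    have : 2 / q <= m%:R by near: m; exact: nbhs_infty_ger.
    by rewrite -natr1; lra.
  rewrite /chi !step_ge1 ?mul1r //.
    by rewrite lerDl mulr_ge0 // subr_ge0.
  by move: hm; rewrite ler_pdivrMr //; lra.
apply: cvg_near_cst; near=> m.
have hm : 1 / (q - 1) <= m.+1%:R.
  have : 1 / (q - 1) <= m%:R by near: m; exact: nbhs_infty_ger.
  by rewrite -natr1; lra.
rewrite /chi [X in _ * X]step_le0 ?mulr0 //.
by move: hm; rewrite ler_pdivrMr ?subr_gt0 //; nra.
Unshelve. all: by end_near. Qed.

Lemma compact_sphere : compact S.
Proof.
apply: (@subclosed_compact _ _ (cube 1 : set 'rV[R]_n)).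
- rewrite (_ : S = @enorm R n @^-1` [set 1]) //.
  apply: preimage_closed; last first.
    by apply: accessible_closed_set1; apply: hausdorff_accessible; exact: norm_hausdorff.
  by move=> x _; exact: enorm_continuous.
- exact: compact_cube.
- by move=> x x1 i; rewrite -(x1 : enorm x = 1); exact: coord_le_enorm.
Qed.

Let measurable_Divdir : measurable_fun pb (fun x => Div (direction x) : measurableTypeR R).
Proof.
have : measurable_fun S (Div : _ -> measurableTypeR R).
  apply: measurable_continuous_rV; first exact: measurable_sphere.
  by move=> x /sphere_neq0 /cDiv.
move=> mD; apply: (measurable_comp measurable_sphere _ mD).
  by move=> _ [x /andP[x0 _] <-]; apply: sphere_direction; rewrite -enorm_gt0.
by apply: measurable_funS (@subsetT _ _) _ => //; exact: measurable_direction.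
Qed.

Let bounded_Divdir : exists2 B : R, 0 <= B & forall x, x != 0 -> `|Div (direction x)| <= B.
Proof.
have [B [Br hB]] := bounded_on_compact compact_sphere (fun x sx => cDiv (sphere_neq0 sx)).
exists (`|B| + 1); first by rewrite addr_ge0.
move=> x x0; apply: (hB (`|B| + 1)); first by rewrite ltr_pwDr // ler_norm.
exact: sphere_direction.
Qed.

Let integral_pb : (\int[leb_n]_(x in pb) (Div (direction x))%:E = 0)%E.
Proof.
have mpb := @measurable_punctured_ball R n.
have [B B0 hB] := bounded_Divdir.
rewrite integral_mkcond.
have E : ((fun x => (Div (direction x))%:E) \_ pb) =
    (fun x => (\1_pb x * Div (direction x))%:E).
  apply/funext => x; rewrite /patch indicE; case: ifPn => // _.
    by rewrite mul1r.
  by rewrite mul0r.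
have mf m : measurable_fun setT
    (fun x => (chi m (sumsq x) * Div (direction x))%:E).
  apply/measurable_EFinP; apply: measurable_continuous_rV => // x _.
  have -> : (fun x => chi m (sumsq x) * Div (direction x)) =
     (fun x => \sum_i dF m i x) by apply/funext => y; rewrite sum_dF.
  by apply: ct_sum => i; exact: dF_continuous.
have icst : leb_n.-integrable (cube 2) (EFin \o cst B).
  apply: measurable_bounded_integrable.
  - exact: measurable_cube.
  - exact: lebesgue_cube_lty.
  - exact: measurable_cst.
  - by exists `|B|; split; [exact: num_real|move=> M BM x _; rewrite /= ltW].
have ig : leb_n.-integrable setT ((EFin \o cst B) \_ (cube 2)).
  exact/(integrable_mkcond _ (@measurable_cube R n 2)).
have fg : {ae leb_n, forall x m, setT x ->
    (`|(chi m (sumsq x) * Div (direction x))%:E| <= ((EFin \o cst B) \_ (cube 2)) x)%E}.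
  apply: aeW => x m _; rewrite /patch; case: ifPn => [_|/negP x2].
    have [->|x0] := eqVneq x 0.
      rewrite chi_small ?mul0r ?abse0 ?lee_fin //.
      exact: nbhs_singleton (small_near0 m).
    have /andP[c0 c1] := chi_01 m (sumsq x).
    rewrite /= lee_fin normrM ger0_norm //.
    by rewrite -[leRHS]mul1r ler_pM // hB.
  rewrite chi_large ?mul0r ?abse0 //; apply: far2 => h2; apply: x2.
  by rewrite inE.
have mlim : measurable_fun setT (fun x => (\1_pb x * Div (direction x))%:E).
  rewrite -E; apply/(measurable_restrictT _ mpb).
  by apply/measurable_EFinP; exact: measurable_Divdir.
have ff : {ae leb_n, forall x, setT x ->
    (chi m (sumsq x) * Div (direction x))%:E @[m --> \oo] -->
    (\1_pb x * Div (direction x))%:E}.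
  apply: aeW => x _; apply: cvg_EFin; first exact: nearW.
  apply: cvgM; [exact: chi_cvg|exact: cvg_cst].
have [_ _] := dominated_convergence measurableT mf mlim ff ig fg.
have -> : [sequence (\int[leb_n]_x (chi m (sumsq x) * Div (direction x))%:E)%E]_m
    = (fun=> 0%E) by apply/funext => m /=; exact: integral_chi.
rewrite E => H.
have <- := cvg_lim (@ereal_hausdorff R) H.
by apply: lim_cst; exact: ereal_hausdorff.
Qed.

(** Integration by parts on the sphere: for functions that are constant along
   rays, the radial cutoff in the divergence theorem of the ambient space
   contributes nothing, as the gradient of [f] is tangential. *)
Theorem sphere_integration_by_parts :
  (\int[sigma]_(w in S) (h w * (\sum_i 'D_(e i) ('D_(e i) f) w) +
    \sum_i 'D_(e i) h w * 'D_(e i) f w)%:E = 0)%E.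
Proof.
have mD : measurable_fun S (EFin \o Div).
  apply/measurable_EFinP; apply: measurable_continuous_rV.
    exact: measurable_sphere.
  by move=> x /sphere_neq0 /cDiv.
rewrite -[LHS]/(\int[sigma]_(w in S) (EFin \o Div) w)%E integralE.
rewrite !ge0_integral_sphere //; try by move=> w _; rewrite ?funepos_ge0 ?funeneg_ge0.
- pose A := (\int[leb_n]_(x in pb) (fun x => (Div (direction x))%:E)^\+ x)%E.
  pose B := (\int[leb_n]_(x in pb) (fun x => (Div (direction x))%:E)^\- x)%E.
  have A0 : (0 <= A)%E by apply: integral_ge0 => x _; rewrite funepos_ge0.
  have B0 : (0 <= B)%E by apply: integral_ge0 => x _; rewrite funeneg_ge0.
  have AB : (A - B = 0)%E by rewrite -integral_pb integralE.
  have -> : (\int[leb_n]_(x in pb) (EFin \o Div)^\+ (direction x))%E = A.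
    by apply: eq_integral => x _; rewrite !funeposE.
  have -> : (\int[leb_n]_(x in pb) (EFin \o Div)^\- (direction x))%E = B.
    by apply: eq_integral => x _; rewrite !funenegE.
  move: A0 B0 AB; case: A => [a| |] //; case: B => [b| |] // _ _ /eqP.
  rewrite -EFinB eqe subr_eq0 => /eqP ->.
  by rewrite -!EFinM -EFinB subrr.
- exact: measurable_funeneg.
- exact: measurable_funepos.
Qed.

End sphere_ibp.


(** * Integrals over boxes *)

Section box_integrals.
Context {R : realType} {n : nat} (rs : R).
Local Notation V := (R * R * 'rV[R]_n)%type.
Local Notation S := (@sphere R n).
Local Notation Z2 := ('rV[R]_n * measurableTypeR R)%type.
Local Notation Z3 := (measurableTypeR R * ('rV[R]_n * measurableTypeR R))%type.
Implicit Types (G H : V -> R) (a b t r T : R) (w : 'rV[R]_n).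

Definition leb : {sigma_finite_measure set (measurableTypeR R) -> \bar R} :=
  lebesgue_measure.
Definition surf : {sigma_finite_measure set 'rV[R]_n -> \bar R} :=
  @surface_measure R n.
Definition slab : set Z2 -> \bar R := (surf \x leb)%E.

HB.instance Definition _ := Measure.copy slab (surf \x leb)%E.

Let slab_sigma_finite : sigma_finite setT slab.
Proof.
have /sigma_finiteP[G [TG ndG Goo]] := sigma_finiteT leb.
exists (fun k => setT `*` G k).
  by rewrite -setXTT TG predeqE => -[x y]; split => [[_ [k _ h]]|[k _ [_ h]]];
    [exists k|split => //; exists k].
move=> k; have [mG Gy] := Goo k; split; first exact: measurableX.
rewrite /slab product_measure1E // lte_mul_pinfty //.
exact: (@surface_measure_fin R n setT measurableT).
Qed.

HB.instance Definition _ := Measure_isSigmaFinite.Build _ _ _ slab slab_sigma_finite.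

Definition spacetime : set Z3 -> \bar R := (leb \x slab)%E.

HB.instance Definition _ := Measure.copy spacetime (leb \x slab)%E.

Definition itv a b : set (measurableTypeR R) := `[a, b]%classic.
Definition box2 a b := S `*` itv a b.
Definition box3 T a b := itv 0 T `*` box2 a b.

Lemma measurable_itvR a b : measurable (itv a b).
Proof. exact: measurable_itv. Qed.

Lemma measurable_box2 a b : measurable (box2 a b).
Proof. by apply: measurableX; [exact: measurable_sphere|exact: measurable_itv]. Qed.

Lemma measurable_box3 T a b : measurable (box3 T a b).
Proof. by apply: measurableX; [exact: measurable_itv|exact: measurable_box2]. Qed.

Lemma itv_lty a b : (leb (itv a b) < +oo)%E.
Proof.
rewrite /itv /=; have [ab|ab] := leP a b.
  by rewrite lebesgue_measure_itv /=; case: ifP => _; rewrite -?EFinB ltry.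
by rewrite set_itv_ge ?measure0 // bnd_simp -ltNge.
Qed.

Lemma box2_lty a b : (slab (box2 a b) < +oo)%E.
Proof.
rewrite /slab /= product_measure1E; [|exact: measurable_sphere|exact: measurable_itv].
apply: lte_mul_pinfty => //; last exact: itv_lty.
exact: (@surface_measure_fin R n S measurable_sphere).
Qed.

Lemma box3_lty T a b : (spacetime (box3 T a b) < +oo)%E.
Proof.
rewrite /spacetime /= product_measure1E; [|exact: measurable_itv|exact: measurable_box2].
apply: lte_mul_pinfty => //; last exact: box2_lty.
by rewrite ge0_fin_numE //; exact: itv_lty.
Qed.

(** The admissible integrands. Continuity on the open exterior gives
   measurability, and boundedness on boxes away from the horizon. *)
Definition nice G := forall p, exterior rs p -> {for p, continuous G}.

Let compact_box T a b :
  compact [set p : V | [/\ 0 <= p.1.1 <= T, a <= p.1.2 <= b & S p.2]].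
Proof.
have := compact_setX (compact_setX (@segment_compact R 0 T) (@segment_compact R a b))
  (@compact_sphere R n).
congr compact; apply/seteqP; split => -[[t r] w] /=; rewrite !in_itv /=.
  by move=> [[]].
by move=> [].
Qed.

Lemma nice_bounded G T a b : nice G -> rs < a ->
  exists2 B : R, 0 <= B & forall t r w, 0 <= t <= T -> a <= r <= b -> S w ->
    `|G (t, r, w)| <= B.
Proof.
move=> nG ra.
have [B [Br hB]] := bounded_on_compact (@compact_box T a b) (f := G) (fun p hp =>
   nG p (let: And3 _ h2 h3 := hp in
     conj (lt_le_trans ra (proj1 (andP h2))) (sphere_neq0 h3))).
exists (`|B| + 1); first by rewrite addr_ge0.
move=> t r w h1 h2 h3.
by apply: (hB (`|B| + 1)); [rewrite ltr_pwDr // ler_norm|split].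
Qed.

Lemma nice_measurable3 G T a b : nice G -> rs < a ->
  measurable_fun (box3 T a b) (fun z => G (to_V z) : measurableTypeR R).
Proof.
move=> nG ra; apply: measurable_continuous; first exact: measurable_box3.
move=> [t [w r]] [_ [/= sw rab]]; apply: nG; split => /=; last exact: sphere_neq0.
by move: rab; rewrite /itv /= in_itv /= => /andP[h _]; exact: lt_le_trans h.
Qed.

Lemma nice_integrable3 G T a b : nice G -> rs < a ->
  spacetime.-integrable (box3 T a b) (EFin \o (fun z => G (to_V z))).
Proof.
move=> nG ra; apply: measurable_bounded_integrable.
- exact: measurable_box3.
- exact: box3_lty.
- exact: nice_measurable3.
- have [B B0 hB] := nice_bounded T b nG ra.
  exists B; split; [exact: num_real|move=> M BM [t [w r]] [/= ht [/= hw hr]]].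
  by apply: le_trans (ltW BM); apply: hB => //; move: ht hr; rewrite /itv /= !in_itv.
Qed.

Lemma slab_measurable_at (D : set Z2) G t :
  measurable D -> nice G ->
  (forall z, D z -> S z.1 /\ rs < z.2) ->
  measurable_fun D (fun z => G (t, z.2, z.1) : measurableTypeR R).
Proof.
move=> mD nG hD.
have mf : measurable_fun (setT `*` D) (fun z => G (to_V z) : measurableTypeR R).
  apply: measurable_continuous; first exact: measurableX.
  move=> [s [w r]] [_ /hD[/= sw rr]]; apply: nG; split => //=.
  exact: sphere_neq0.
have memb : measurable_fun D (fun z : Z2 => (t, z) : Z3).
  apply: measurable_funS (@subsetT _ D) _ => //.
  by apply/measurable_fun_pairP; split; [exact: measurable_cst|exact: measurable_id].
apply: (measurable_comp _ _ mf memb) => [|_ [x Dx <-] //].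
exact: measurableX.
Qed.

Lemma nice_integrable2 G t a b : nice G -> rs < a ->
  slab.-integrable (box2 a b) (EFin \o (fun z => G (t, z.2, z.1))).
Proof.
move=> nG ra; apply: measurable_bounded_integrable.
- exact: measurable_box2.
- exact: box2_lty.
- apply: slab_measurable_at => //; first exact: measurable_box2.
  move=> [w r] [/= sw]; rewrite /itv /= in_itv /= => /andP[h _].
  by split => //; exact: lt_le_trans h.
- pose G' (p : V) := G (p.1.1 + t, p.1.2, p.2).
  have nG' : nice G'.
    move=> p ep; apply: (@continuous_comp _ _ _ (fun p : V => (p.1.1 + t, p.1.2, p.2)) G).
      apply: ct_pair; last exact: cvg_snd.
      apply: ct_pair; last by apply: continuous_comp; [exact: cvg_fst|exact: cvg_snd].
      apply: ctD; last exact: ct_cst.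
      by apply: (@continuous_comp _ _ _ fst fst); [exact: cvg_fst|exact: cvg_fst].
    by apply: nG; case: ep.
  have [B B0 hB] := nice_bounded 0 b nG' ra.
  exists B; split; [exact: num_real|move=> M BM [w r] [/= hw hr]].
  have rab : a <= r <= b by move: hr; rewrite /itv /= in_itv.
  have t0 : (0 : R) <= (0 : R) <= (0 : R) by lra.
  by apply: le_trans (ltW BM); have := hB 0 r w t0 rab hw; rewrite /G' /= add0r.
Qed.

(** Integrals over boxes at fixed time and in spacetime. On boxes every
   function continuous on the exterior is integrable, so that real-valued
   integrals and their linearity can be used freely. *)
Definition Q2 a b G t : R := (\int[slab]_(z in box2 a b) G (t, z.2, z.1))%R.
Definition Q3 T a b G : R := (\int[spacetime]_(z in box3 T a b) G (to_V z))%R.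

Lemma Q3_le T a b G H : nice G -> nice H -> rs < a ->
  (forall t r w, 0 <= t <= T -> a <= r <= b -> S w -> G (t, r, w) <= H (t, r, w)) ->
  Q3 T a b G <= Q3 T a b H.
Proof.
move=> nG nH ra GH; apply: le_Rintegral.
- exact: measurable_box3.
- exact: nice_integrable3.
- exact: nice_integrable3.
- by move=> [t [w r]] [/= ht [/= hw hr]]; apply: GH => //;
    move: ht hr; rewrite /itv /= !in_itv.
Qed.

Lemma Q3D T a b G H : nice G -> nice H -> rs < a ->
  Q3 T a b (fun p => G p + H p) = Q3 T a b G + Q3 T a b H.
Proof.
move=> nG nH ra; apply: RintegralD.
- exact: measurable_box3.
- exact: nice_integrable3.
- exact: nice_integrable3.
Qed.

Lemma Q3Z T a b G (c : R) : nice G -> rs < a ->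
  Q3 T a b (fun p => c * G p) = c * Q3 T a b G.
Proof.
move=> nG ra; apply: RintegralZl; first exact: measurable_box3.
exact: nice_integrable3.
Qed.

Lemma Q2_le a b G H t s : nice G -> nice H -> rs < a ->
  (forall r w, a <= r <= b -> S w -> G (t, r, w) <= H (s, r, w)) ->
  Q2 a b G t <= Q2 a b H s.
Proof.
move=> nG nH ra GH; apply: le_Rintegral.
- exact: measurable_box2.
- exact: nice_integrable2.
- exact: nice_integrable2.
- by move=> [w r] [/= hw hr]; apply: GH => //; move: hr; rewrite /itv /= in_itv.
Qed.

Lemma Q2_ge0 a b G t : (forall r w, a <= r <= b -> S w -> 0 <= G (t, r, w)) ->
  0 <= Q2 a b G t.
Proof.
move=> G0; apply: Rintegral_ge0 => -[w r] [/= hw hr]; exact: G0.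
Qed.

Lemma Q2D a b G H t : nice G -> nice H -> rs < a ->
  Q2 a b (fun p => G p + H p) t = Q2 a b G t + Q2 a b H t.
Proof.
move=> nG nH ra; apply: RintegralD.
- exact: measurable_box2.
- exact: nice_integrable2.
- exact: nice_integrable2.
Qed.

Lemma Q2Z a b G t (c : R) : nice G -> rs < a ->
  Q2 a b (fun p => c * G p) t = c * Q2 a b G t.
Proof.
move=> nG ra; apply: RintegralZl; first exact: measurable_box2.
exact: nice_integrable2.
Qed.

Let EFin_Q3 T a b G : nice G -> rs < a ->
  (Q3 T a b G)%:E = (\int[spacetime]_(z in box3 T a b) (G (to_V z))%:E)%E.
Proof.
move=> nG ra; rewrite fineK //; apply: integrable_fin_num.
  exact: measurable_box3.
exact: nice_integrable3.
Qed.

Let EFin_Q2 t a b G : nice G -> rs < a ->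
  (Q2 a b G t)%:E = (\int[slab]_(z in box2 a b) (G (t, z.2, z.1))%:E)%E.
Proof.
move=> nG ra; rewrite fineK //; apply: integrable_fin_num.
  exact: measurable_box2.
exact: nice_integrable2.
Qed.

Lemma nice_slice_t G r w t : nice G -> rs < r -> S w ->
  {for t, continuous (fun s => G (s, r, w))}.
Proof.
move=> nG rr sw.
apply: (@continuous_comp _ _ _ (fun s : R => (s, r, w)) G).
  by apply: ct_pair; [apply: ct_pair; [exact: cvg_id|exact: cst_continuous]|exact: cst_continuous].
by apply: nG; split => //=; exact: sphere_neq0.
Qed.

Lemma nice_slice_r G r w t : nice G -> rs < r -> S w ->
  {for r, continuous (fun s => G (t, s, w))}.
Proof.
move=> nG rr sw.
apply: (@continuous_comp _ _ _ (fun s : R => (t, s, w)) G).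
  by apply: ct_pair; [apply: ct_pair; [exact: cst_continuous|exact: cvg_id]|exact: cst_continuous].
by apply: nG; split => //=; exact: sphere_neq0.
Qed.

Lemma Q3_dt T a b G dG : nice G -> nice dG -> rs < a -> 0 <= T ->
  (forall t r w, a <= r <= b -> S w ->
     is_derive t 1 (fun s => G (s, r, w)) (dG (t, r, w))) ->
  Q3 T a b dG = Q2 a b G T - Q2 a b G 0.
Proof.
move=> nG ndG ra T0 h; apply: EFin_inj; rewrite EFinB EFin_Q3 // !EFin_Q2 //.
rewrite -integralB_EFin //; first last.
- exact: nice_integrable2.
- exact: nice_integrable2.
- exact: measurable_box2.
rewrite -(rect_integral21 (m1 := leb) (m2 := slab : {sigma_finite_measure set Z2 -> \bar R}) (measurable_itvR 0 T) (measurable_box2 a b)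
  (nice_integrable3 T b ndG ra)).
apply: eq_integral => -[w r]; rewrite inE => -[/= sw]; rewrite /itv /= in_itv /= => rab.
rewrite -EFinB.
apply: (ftc_segment (f := fun t => G (t, r, w)) (df := fun t => dG (t, r, w)) T0).
  by move=> t _; exact: h.
move=> t _; apply: nice_slice_t => //.
by case/andP: rab => h1 _; exact: lt_le_trans h1.
Qed.

Lemma Q3_le_time T a b G (C : R) : nice G -> rs < a -> 0 <= T ->
  (forall t r w, 0 <= t <= T -> a <= r <= b -> S w -> 0 <= G (t, r, w)) ->
  (forall t, 0 <= t <= T -> Q2 a b G t <= C) -> Q3 T a b G <= C * T.
Proof.
move=> nG ra T0 G0 hC.
have mI := measurable_itvR 0 T; have mB := measurable_box2 a b.
have m3 : measurable_fun (box3 T a b) (fun z => (G (to_V z))%:E).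
  by apply/measurable_EFinP; exact: nice_measurable3.
have G0' z : box3 T a b z -> (0 <= (G (to_V z))%:E)%E.
  move: z => [t [w r]] [/= ht [/= hw hr]]; rewrite lee_fin.
  by apply: G0 => //; move: ht hr; rewrite /itv /= !in_itv.
have h3 := rect_tonelli12 leb (slab : {sigma_finite_measure set Z2 -> \bar R}) mI mB m3 G0'.
have h4 := rect_measurable1 (slab : {sigma_finite_measure set Z2 -> \bar R}) mI mB m3 G0'.
rewrite -lee_fin EFin_Q3 // -h3 /=.
rewrite (_ : (C * T)%:E = \int[leb]_(t in itv 0 T) (C%:E))%E; last first.
  rewrite integral_cst // EFinM; congr (_ * _)%E.
  rewrite /itv /= lebesgue_measure_itv /= lte_fin.
  case: ltP => [_|T0']; first by rewrite oppr0 adde0.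
  by congr EFin; apply/eqP; rewrite eq_le T0 T0'.
apply: ge0_le_integral => //.
- move=> t ht; apply: integral_ge0 => z hz.
  by apply: (G0' (t, z)); split.
- move=> t; rewrite /itv /= in_itv /= => ht.
  by rewrite -EFin_Q2 // lee_fin; exact: hC.
Qed.

Lemma Q2_dr t a b J dJ : nice dJ -> rs < a -> a <= b ->
  (forall r w, a <= r <= b -> S w ->
     is_derive r 1 (fun s => J (t, s, w)) (dJ (t, r, w))) ->
  (forall w, S w -> J (t, a, w) = 0) -> (forall w, S w -> J (t, b, w) = 0) ->
  Q2 a b dJ t = 0.
Proof.
move=> ndJ ra ab h Ja Jb; apply: EFin_inj; rewrite EFin_Q2 //.
rewrite -(rect_integral12 (m1 := surf) (m2 := leb) measurable_sphere
  (measurable_itvR a b) (nice_integrable2 t b ndJ ra)).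
apply: integral0_eq => w sw /=.
have h1 (r : R) : a <= r <= b -> is_derive r 1 (fun r => J (t, r, w)) (dJ (t, r, w)).
  by move=> rab; exact: h.
have h2 (r : R) : a <= r <= b -> {for r, continuous (fun r => dJ (t, r, w))}.
  by move=> /andP[r1 _]; apply: nice_slice_r => //; exact: lt_le_trans r1.
by rewrite (ftc_segment ab h1 h2) Ja // Jb // subrr.
Qed.

Lemma Q3_dr T a b J dJ : nice dJ -> rs < a -> a <= b ->
  (forall t r w, a <= r <= b -> S w ->
     is_derive r 1 (fun s => J (t, s, w)) (dJ (t, r, w))) ->
  (forall t w, 0 <= t <= T -> S w -> J (t, a, w) = 0) ->
  (forall t w, 0 <= t <= T -> S w -> J (t, b, w) = 0) ->
  Q3 T a b dJ = 0.
Proof.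
move=> ndJ ra ab h Ja Jb; apply: EFin_inj; rewrite EFin_Q3 //.
rewrite -(rect_integral12 (m1 := leb) (m2 := slab : {sigma_finite_measure set Z2 -> \bar R}) (measurable_itvR 0 T)
  (measurable_box2 a b) (nice_integrable3 T b ndJ ra)).
apply: integral0_eq => t ht /=.
rewrite -EFin_Q2 // (Q2_dr (J := J)) // => w sw.
- by apply: Ja => //; move: ht; rewrite /itv /= in_itv.
- by apply: Jb => //; move: ht; rewrite /itv /= in_itv.
Qed.

Lemma Q3_sphere T a b B : nice B -> rs < a ->
  (forall t r, a <= r <= b ->
    (\int[surf]_(w in S) (B (t, r, w))%:E = 0)%E) ->
  Q3 T a b B = 0.
Proof.
move=> nB ra h; apply: EFin_inj; rewrite EFin_Q3 //.
rewrite -(rect_integral12 (m1 := leb) (m2 := slab : {sigma_finite_measure set Z2 -> \bar R}) (measurable_itvR 0 T)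
  (measurable_box2 a b) (nice_integrable3 T b nB ra)).
apply: integral0_eq => t ht /=.
rewrite -(rect_integral21 (m1 := surf) (m2 := leb) measurable_sphere
  (measurable_itvR a b) (nice_integrable2 t b nB ra)).
apply: integral0_eq => r; rewrite /itv /= in_itv /= => rab; exact: h.
Qed.

End box_integrals.


(** * Exhaustion of the exterior by boxes *)

Section exhaustion.
Context {R : realType} {n : nat} (rs : R).
Local Notation V := (R * R * 'rV[R]_n)%type.
Local Notation S := (@sphere R n).
Local Notation Z2 := ('rV[R]_n * measurableTypeR R)%type.
Local Notation Z3 := (measurableTypeR R * ('rV[R]_n * measurableTypeR R))%type.
Local Notation nice := (@nice R n rs).
Implicit Types (G H : V -> R) (a b t r T : R) (w : 'rV[R]_n).

Definition ext2 : set Z2 := S `*` (`]rs, +oo[%classic : set (measurableTypeR R)).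
Definition ext3 : set Z3 := (`[0%R, +oo[%classic : set (measurableTypeR R)) `*` ext2.

Let mI : measurable (`]rs, +oo[%classic : set (measurableTypeR R)).
Proof. exact: measurable_itv. Qed.

Lemma measurable_ext2 : measurable ext2.
Proof. by apply: measurableX; [exact: measurable_sphere|exact: mI]. Qed.

Lemma measurable_ext3 : measurable ext3.
Proof. by apply: measurableX; [exact: measurable_itv|exact: measurable_ext2]. Qed.

Lemma box2_sub_ext2 a b : rs < a -> box2 a b `<=` ext2.
Proof.
move=> ra [w r] [/= sw]; rewrite /itv /= in_itv /= => /andP[h _]; split => //=.
by rewrite in_itv /= andbT; exact: lt_le_trans h.
Qed.

Lemma slab_measurable_ext2 G t : nice G ->
  measurable_fun ext2 (fun z => (G (t, z.2, z.1))%:E).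
Proof.
move=> nG; apply/measurable_EFinP.
apply: (@slab_measurable_at R n rs) => //; first exact: measurable_ext2.
by move=> [w r] [/= sw]; rewrite in_itv /= andbT.
Qed.

Lemma EFin_Q2 t a b G : nice G -> rs < a ->
  (Q2 a b G t)%:E = (\int[slab]_(z in box2 a b) (G (t, z.2, z.1))%:E)%E.
Proof.
move=> nG ra; rewrite fineK //; apply: integrable_fin_num.
  exact: measurable_box2.
exact: (@nice_integrable2 R n rs).
Qed.

Lemma EFin_Q3 T a b G : nice G -> rs < a ->
  (Q3 T a b G)%:E = (\int[spacetime]_(z in box3 T a b) (G (to_V z))%:E)%E.
Proof.
move=> nG ra; rewrite fineK //; apply: integrable_fin_num.
  exact: measurable_box3.
exact: (@nice_integrable3 R n rs).
Qed.

Lemma ext2_tonelli G t : nice G -> (forall r w, rs < r -> S w -> 0 <= G (t, r, w)) ->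
  (\int[@surface_measure R n]_(w in S) \int[lebesgue_measure]_(r in `]rs, +oo[)
     (G (t, r, w))%:E = \int[slab]_(z in ext2) (G (t, z.2, z.1))%:E)%E.
Proof.
move=> nG G0.
apply: (rect_tonelli12 surf leb measurable_sphere mI (slab_measurable_ext2 t nG)).
move=> [w r] [/= sw]; rewrite in_itv /= andbT => rr; rewrite lee_fin; exact: G0.
Qed.

Lemma Q2_le_ext G t a b : nice G -> rs < a ->
  (forall r w, rs < r -> S w -> 0 <= G (t, r, w)) ->
  ((Q2 a b G t)%:E <= \int[slab]_(z in ext2) (G (t, z.2, z.1))%:E)%E.
Proof.
move=> nG ra G0; rewrite EFin_Q2 //; apply: ge0_subset_integral.
- exact: measurable_box2.
- exact: measurable_ext2.
- exact: slab_measurable_ext2.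
- move=> [w r] [/= sw]; rewrite in_itv /= andbT => rr; rewrite lee_fin; exact: G0.
- exact: box2_sub_ext2.
Qed.

Let lo (k : nat) : R := rs + k.+1%:R^-1.
Let hi (k : nat) : R := rs + k.+1%:R.

Let rs_lo k : rs < lo k.
Proof. by rewrite ltrDl invr_gt0. Qed.

Let nd_box2 : nondecreasing_seq (fun k => box2 (n := n) (lo k) (hi k)).
Proof.
move=> k m km; apply/subsetPset => -[w r] [/= sw]; rewrite /itv /= !in_itv /= => /andP[h1 h2].
split => //=; rewrite /itv /= in_itv /=; apply/andP; split.
  by apply: le_trans h1; rewrite lerD2l lef_pV2 ?posrE // ler_nat.
by apply: le_trans h2 _; rewrite lerD2l ler_nat.
Qed.

Let in_box r : rs < r -> exists k0 : nat, forall k, (k0 <= k)%N -> lo k <= r <= hi k.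
Proof.
move=> rr.
have d0 : 0 < r - rs by rewrite subr_gt0.
exists (maxn (Num.truncn (r - rs)^-1) (Num.truncn (r - rs))) => k; rewrite geq_max => /andP[k1 k2].
have h1 : (r - rs)^-1 <= k.+1%:R.
  by apply: ltW; apply: lt_le_trans (truncnS_gt _) _; rewrite ler_nat ltnS.
have h2 : r - rs <= k.+1%:R.
  by apply: ltW; apply: lt_le_trans (truncnS_gt _) _; rewrite ler_nat ltnS.
have h3 : k.+1%:R^-1 <= r - rs by rewrite -[leRHS]invrK lef_pV2 ?posrE ?invr_gt0.
by apply/andP; split; rewrite /lo /hi -?lerBrDl // -lerBlDl.
Qed.

Let cup_box2 : \bigcup_k box2 (n := n) (lo k) (hi k) = ext2.
Proof.
apply/seteqP; split => [z [k _]|[w r] [/= sw]]; first exact: box2_sub_ext2.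
rewrite in_itv /= andbT => /in_box[k /(_ k (leqnn k)) h].
by exists k => //; split => //=; rewrite /itv /= in_itv.
Qed.

(** Monotone convergence along boxes that exhaust the slice: bounds uniform in
   the box are bounds for the iterated integrals over the exterior. *)
Lemma ext2_le G t (C : R) : nice G -> (forall r w, rs < r -> S w -> 0 <= G (t, r, w)) ->
  (forall a b, rs < a -> a <= b -> Q2 a b G t <= C) ->
  (\int[slab]_(z in ext2) (G (t, z.2, z.1))%:E <= C%:E)%E.
Proof.
move=> nG G0 hC; rewrite -cup_box2.
have H := @ge0_nondecreasing_set_cvg_integral _ _ _ (fun k => box2 (lo k) (hi k))
  (fun z => (G (t, z.2, z.1))%:E) (slab : {measure set Z2 -> \bar R}) nd_box2
  (fun k => @measurable_box2 R n _ _)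
  (fun k => measurable_funS measurable_ext2 (box2_sub_ext2 (rs_lo k)) (slab_measurable_ext2 t nG)).
have H0 k z : box2 (lo k) (hi k) z -> (0 <= (G (t, z.2, z.1))%:E)%E.
  move=> /(box2_sub_ext2 (rs_lo k)); case: z => w r [/= sw].
  by rewrite in_itv /= andbT => rr; rewrite lee_fin; exact: G0.
have {H}H := H H0.
rewrite -(cvg_lim (@ereal_hausdorff R) H); apply: lime_le.
  by apply/cvg_ex; eexists; exact: H.
apply: nearW => k; rewrite -EFin_Q2 // lee_fin; apply: hC => //.
rewrite /lo /hi lerD2l (@le_trans _ _ 1) ?ler1n // invf_le1 ?ler1n //.
Qed.

Lemma ext3_tonelli G : nice G -> (forall t r w, rs < r -> S w -> 0 <= G (t, r, w)) ->
  (\int[lebesgue_measure]_(t in `[0%R, +oo[) \int[@surface_measure R n]_(w in S)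
    \int[lebesgue_measure]_(r in `]rs, +oo[)
     (G (t, r, w))%:E = \int[spacetime]_(z in ext3) (G (to_V z))%:E)%E.
Proof.
move=> nG G0.
transitivity (\int[lebesgue_measure]_(t in `[0%R, +oo[)
    \int[slab]_(z in ext2) (G (t, z.2, z.1))%:E)%E.
  by apply: eq_integral => t _; apply: ext2_tonelli => // r w; exact: G0.
have m0 : measurable (`[0%R, +oo[%classic : set (measurableTypeR R)) by exact: measurable_itv.
apply: (rect_tonelli12 leb (slab : {sigma_finite_measure set Z2 -> \bar R}) m0 measurable_ext2).
  apply/measurable_EFinP; apply: measurable_continuous; first exact: measurable_ext3.
  move=> [t [w r]] [_ [/= sw]]; rewrite in_itv /= andbT => rr.
  by apply: nG; split => //=; exact: sphere_neq0.
move=> [t [w r]] [_ [/= sw]]; rewrite in_itv /= andbT => rr; rewrite lee_fin; exact: G0.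
Qed.

Lemma ext3_le G (C : R) : nice G -> (forall t r w, rs < r -> S w -> 0 <= G (t, r, w)) ->
  (forall T a b, 0 <= T -> rs < a -> a <= b -> Q3 T a b G <= C) ->
  (\int[spacetime]_(z in ext3) (G (to_V z))%:E <= C%:E)%E.
Proof.
move=> nG G0 hC.
pose B k := box3 (n := n) k%:R (lo k) (hi k).
have BE k z : B k z -> ext3 z.
  move: z => [t z] [/= ht hz]; split; last exact: (box2_sub_ext2 (rs_lo k) hz).
  by move: ht; rewrite /itv /= !in_itv /= andbT => /andP[].
have -> : ext3 = \bigcup_k B k.
  apply/seteqP; split => [[t [w r]]|z [k _]]; last exact: BE.
  move=> [/=]; rewrite in_itv /= andbT => t0 [/= sw]; rewrite in_itv /= andbT.
  move=> /in_box[k hk]; pose m := maxn k (Num.truncn t).+1.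
  exists m => //; split; [|split] => //=; rewrite /itv /= in_itv /=.
    rewrite t0 /=; apply: ltW; apply: lt_le_trans (truncnS_gt _) _.
    by rewrite ler_nat leq_max leqnn orbT.
  by apply: hk; rewrite leq_max leqnn.
have nd : nondecreasing_seq B.
  move=> k m km; apply/subsetPset => -[t z] [/= ht hz]; split.
    move: ht; rewrite /itv /= !in_itv /= => /andP[-> h]; apply: le_trans h _.
    by rewrite ler_nat.
  by move/subsetPset: (nd_box2 km); apply.
have mG : measurable_fun ext3 (fun z => (G (to_V z))%:E).
  apply/measurable_EFinP; apply: measurable_continuous; first exact: measurable_ext3.
  move=> [t [w r]] [_ [/= sw]]; rewrite in_itv /= andbT => rr.
  by apply: nG; split => //=; exact: sphere_neq0.
have H := @ge0_nondecreasing_set_cvg_integral _ _ _ B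
  (fun z => (G (to_V z))%:E) (spacetime : {measure set Z3 -> \bar R}) nd
  (fun k => @measurable_box3 R n _ _ _)
  (fun k => measurable_funS measurable_ext3 (BE k) mG).
have H0 k z : B k z -> (0 <= (G (to_V z))%:E)%E.
  move=> /BE; case: z => t [w r] [_ [/= sw]].
  by rewrite in_itv /= andbT => rr; rewrite lee_fin; exact: G0.
have {H}H := H H0.
rewrite -(cvg_lim (@ereal_hausdorff R) H); apply: lime_le.
  by apply/cvg_ex; eexists; exact: H.
apply: nearW => k; rewrite -EFin_Q3 // lee_fin; apply: hC => //.
rewrite /lo /hi lerD2l (@le_trans _ _ 1) ?ler1n // invf_le1 ?ler1n //.
Qed.

(** By the theorem of Tonelli. Almost every ray is enough, and the decay of the
   data at infinity is only given on these. *)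
Lemma Q2_le_rays G H t a b : nice G -> nice H -> rs < a ->
  (forall r w, rs < r -> S w -> 0 <= G (t, r, w)) ->
  (forall r w, rs < r -> S w -> 0 <= H (t, r, w)) ->
  {ae @surface_measure R n, forall w, S w ->
    (\int[leb]_(r in itv a b) (G (t, r, w))%:E <=
     \int[leb]_(r in `]rs, +oo[) (H (t, r, w))%:E)%E} ->
  ((Q2 a b G t)%:E <= \int[slab]_(z in ext2) (H (t, z.2, z.1))%:E)%E.
Proof.
move=> nG nH ra G0 H0 hae; rewrite EFin_Q2 //.
have mS := @measurable_sphere R n; have mab := measurable_itvR a b.
have mG := measurable_funS measurable_ext2 (box2_sub_ext2 ra (b := b)) (slab_measurable_ext2 t nG).
have mH := slab_measurable_ext2 t nH.
have G0' (z : Z2) : (S `*` itv a b) z -> (0 <= (G (t, z.2, z.1))%:E)%E.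
  move=> /(box2_sub_ext2 ra); case: z => w r [/= sw].
  by rewrite in_itv /= andbT => rr; rewrite lee_fin; exact: G0.
have H0' (z : Z2) : ext2 z -> (0 <= (H (t, z.2, z.1))%:E)%E.
  by case: z => w r [/= sw]; rewrite in_itv /= andbT => rr; rewrite lee_fin; exact: H0.
rewrite -(rect_tonelli12 surf leb mS mab mG G0') -(rect_tonelli12 surf leb mS mI mH H0').
apply: ae_ge0_le_integral => //.
- by move=> w sw; apply: integral_ge0 => r hr; apply: (G0' (w, r)); split.
- exact: (rect_measurable1 leb mS mab mG G0').
- by move=> w sw; apply: integral_ge0 => r hr; apply: (H0' (w, r)); split.
- exact: (rect_measurable1 leb mS mI mH H0').
Qed.

End exhaustion.


(** * Radial functions *)

Section radial_functions.
Context {R : realType} (d : nat) (rs : R).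
Hypothesis rs_gt0 : 0 < rs.
Implicit Types r : R.

Local Notation K := (d.+2%:R : R).
Local Notation N := (d.+1%:R : R).

(** The radial weights are polynomials in the three functions [sc], [ir] and
   [zt], and this ring is stable under the tortoise derivative D = F d/dr:
     D s = - N s F y,   D y = - F y^2,   D z = N s y z^2,
   where s, y, z stand for [sc r], [ir r], [zt r] and F = 1 - s.
   The function 1/z = 1 - ln F plays the part of the tortoise coordinate near
   the horizon. *)
Definition sc r : R := (rs / r) ^+ d.+1.
Definition ir r : R := r^-1.
Definition lap r : R := 1 - sc r.
Definition Lam r : R := 1 - ln (lap r).
Definition zt r : R := (Lam r)^-1.
Definition vol r : R := r ^+ d.+2.

Lemma r_gt0 r : rs < r -> 0 < r.
Proof. exact: lt_trans. Qed.

Lemma ratio_bounds r : rs < r -> 0 < rs / r < 1.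
Proof.
move=> rr; have r0 := r_gt0 rr; rewrite divr_gt0 //=.
by rewrite ltr_pdivrMr // mul1r.
Qed.

Lemma sc_bounds r : rs < r -> 0 < sc r < 1.
Proof.
move=> /ratio_bounds/andP[h1 h2]; rewrite /sc exprn_gt0 //=.
by rewrite exprn_ilt1 // ltW.
Qed.

Lemma lap_bounds r : rs < r -> 0 < lap r < 1.
Proof. by move=> /sc_bounds/andP[h1 h2]; rewrite /lap; lra. Qed.

Lemma ir_gt0 r : rs < r -> 0 < ir r.
Proof. by move=> /r_gt0; rewrite /ir invr_gt0. Qed.

Lemma rs_ir r : rs < r -> rs * ir r <= 1.
Proof. by move=> /ratio_bounds/andP[_ /ltW]. Qed.

Lemma Lam_ge1 r : rs < r -> 1 <= Lam r.
Proof.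
move=> /lap_bounds/andP[h1 /ltW h2]; rewrite /Lam lerDl oppr_ge0.
exact: ln_le0.
Qed.

Lemma zt_bounds r : rs < r -> 0 < zt r <= 1.
Proof.
move=> /Lam_ge1 h; have h0 : 0 < Lam r by apply: lt_le_trans h.
by rewrite /zt invr_gt0 h0 /= invf_le1.
Qed.

Lemma vol_gt0 r : rs < r -> 0 < vol r.
Proof. by move=> /r_gt0 h; rewrite exprn_gt0. Qed.

(* From ln u <= u - 1 at u = 1 / x. *)
Let xlnx (x : R) : 0 < x <= 1 -> x * (1 - ln x) <= 1.
Proof.
move=> /andP[x0 x1].
have h : ln x^-1 <= x^-1 - 1.
  have xv : 0 < x^-1 by rewrite invr_gt0.
  have h1 : -1 < x^-1 - 1 by lra.
  have := le_ln1Dx h1; by have -> : 1 + (x^-1 - 1) = x^-1 by ring.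
rewrite lnV ?posrE // in h.
rewrite -(@ler_pM2l _ x^-1) ?invr_gt0 // mulrA mulVf ?gt_eqF // mul1r mulr1.
lra.
Qed.

(** F decays at the horizon faster than any power of 1 / ln F; this and the
   next bound are the two instances that let z absorb F. *)
Lemma lap_le_zt r : rs < r -> lap r <= zt r.
Proof.
move=> rr; have /andP[h1 h2] := lap_bounds rr.
have L0 : 0 < Lam r by apply: lt_le_trans (Lam_ge1 rr).
by rewrite /zt -[leRHS]mul1r ler_pdivlMr // /Lam; apply: xlnx; rewrite h1 ltW.
Qed.

(** From x (1 - ln x) <= 1 at the square root of F. *)
Lemma lap_le_zt2 r : rs < r -> lap r <= 4 * zt r ^+ 2.
Proof.
move=> rr; have /andP[h1 h2] := lap_bounds rr.
have L0 : 0 < Lam r by apply: lt_le_trans (Lam_ge1 rr).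
pose q := Num.sqrt (lap r).
have q0 : 0 < q by rewrite sqrtr_gt0.
have qq : q ^+ 2 = lap r by rewrite sqr_sqrtr // ltW.
have q1 : q <= 1 by rewrite -sqrtr1 ler_wsqrtr // ltW.
have H : q * (1 - ln q) <= 1 by apply: xlnx; rewrite q0.
have LE : Lam r = 1 - 2 * ln q.
  by rewrite /Lam -qq lnXn // mulr_natl.
have lq : ln q <= 0 by apply: ln_le0.
have H2 : q * Lam r <= 2 by rewrite LE; nra.
have H3 : 0 < q * Lam r by rewrite mulr_gt0.
rewrite /zt exprVn -(@ler_pM2r _ (Lam r ^+ 2)) ?exprn_gt0 //.
rewrite -mulrA mulVf ?expf_neq0 ?gt_eqF // mulr1 -qq -exprMn.
nra.
Qed.

Lemma is_derive_ir r : rs < r -> is_derive r 1 ir (- ir r ^+ 2).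
Proof.
move=> rr; have r0 : r != 0 by rewrite gt_eqF // r_gt0.
have := @is_deriveV R id r 1 1 r0 (is_derive_id r 1) => H.
apply: (isd_eq H) => //; rewrite /ir [_ *: _]mulr1 exprVn //.
Qed.

Lemma is_derive_pow (f : R -> R) (m : nat) r df : is_derive r 1 f df ->
  is_derive r 1 (fun x => f x ^+ m.+1) (m.+1%:R * f r ^+ m * df).
Proof.
move=> h; have H := @is_deriveX R R f m.+1 r 1 df h.
by apply: (isd_eq H) => // x; rewrite exprfctE.
Qed.

Lemma is_derive_sc r : rs < r -> is_derive r 1 sc (- (N * sc r * ir r)).
Proof.
move=> rr; have H := is_derive_pow d (isdM (isd_cst rs r 1) (is_derive_ir rr)).
apply: (isd_eq H) => //; rewrite /sc [in RHS]exprS /ir; ring.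
Qed.

Lemma is_derive_lap r : rs < r -> is_derive r 1 lap (N * sc r * ir r).
Proof.
move=> rr; have H := isdD (isd_cst 1 r 1) (isdN (is_derive_sc rr)).
by apply: (isd_eq H) => //; rewrite add0r opprK.
Qed.

Lemma is_derive_Lam r : rs < r -> is_derive r 1 Lam (- (N * sc r * ir r / lap r)).
Proof.
move=> rr; have /andP[l0 _] := lap_bounds rr.
have h := @isd_comp _ _ (@ln R) lap r 1 _ _ (is_derive1_ln l0) (is_derive_lap rr).
have H := isdD (isd_cst 1 r 1) (isdN h).
by apply: (isd_eq H) => //; rewrite add0r mulrC.
Qed.

Lemma is_derive_zt r : rs < r ->
  is_derive r 1 zt (N * sc r * ir r * zt r ^+ 2 / lap r).
Proof.
move=> rr; have L0 : Lam r != 0.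
  by rewrite gt_eqF //; apply: lt_le_trans (Lam_ge1 rr).
have /andP[l0 _] := lap_bounds rr.
have H := @is_deriveV R Lam r _ 1 L0 (is_derive_Lam rr).
apply: (isd_eq H) => //.
have E (u v : R) : u *: v = u * v by [].
by rewrite E /zt; field; rewrite L0 gt_eqF.
Qed.

Lemma is_derive_vol r : rs < r -> is_derive r 1 vol (K * vol r * ir r).
Proof.
move=> rr; have H := is_derive_pow d.+1 (is_derive_id r 1).
have r0 : r != 0 by rewrite gt_eqF // r_gt0.
apply: (isd_eq H) => //.
by rewrite /vol /ir mulr1 (exprSr r d.+1) -!mulrA divff // mulr1.
Qed.

End radial_functions.


(** * Algebra of the Morawetz multiplier *)

Section multiplier_algebra.
Context {R : realType} (K A z0 : R).
Implicit Types s y z u phi g : R.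

Local Notation N := (K - 1).
Definition kap : R := (K + 1) / 2.

(** Values of the multiplier f = A (1 - kap s) + (z - z0), of its tortoise
   derivatives p = D f, D p, D D p, of the Hardy weight and of its derivative,
   and of the effective potential and its derivative. *)
Definition mf s z := A * (1 - kap * s) + (z - z0).
Definition mp s y z := N * s * y * (A * kap * (1 - s) + z ^+ 2).

(** D applied to N s y F is N y^2 g1, and D applied to N s y z^2 is N y^2 g2;
   the primes and the suffixes s and z denote partial derivatives. The function
   g3 is the Hardy correction of the first multiplier. *)
Definition g1 s := N * s ^+ 2 * (1 - s) - K * s * (1 - s) ^+ 2.
Definition g1' s :=
  2 * N * s * (1 - s) - N * s ^+ 2 - K * (1 - s) ^+ 2 + 2 * K * s * (1 - s).
Definition g2 s z := 2 * N * s ^+ 2 * z ^+ 3 - K * s * (1 - s) * z ^+ 2.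
Definition g2s s z := 4 * N * s * z ^+ 3 - K * (1 - s) * z ^+ 2 + K * s * z ^+ 2.
Definition g2z s z := 6 * N * s ^+ 2 * z ^+ 2 - 2 * K * s * (1 - s) * z.
Definition g3 s := s * (1 - s) * (3 / 4 - K * s / 2).
Definition g3' s := (1 - s - s) * (3 / 4 - K * s / 2) - K * s * (1 - s) / 2.

Definition mp1 s y z := N * y ^+ 2 * (A * kap * g1 s + g2 s z).
Definition mp2 s y z := N * y ^+ 3 *
  (A * kap * (- 2 * (1 - s) * g1 s - N * s * (1 - s) * g1' s) +
   (- 2 * (1 - s) * g2 s z - N * s * (1 - s) * g2s s z + N * s * z ^+ 2 * g2z s z)).
Definition mhh s y z := mp1 s y z + 2 * A * kap * N * y ^+ 2 * g3 s.
Definition mhh1 s y z := mp2 s y z +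
  2 * A * kap * N * y ^+ 3 * (- 2 * (1 - s) * g3 s - N * s * (1 - s) * g3' s).

Definition V0 s y := (1 - s) * y ^+ 2 * (K / 4) * (K - 2 + K * s).
Definition V01 s y := (1 - s) * y ^+ 3 * (K / 4) *
  (- 2 * (K - 2) - 2 * (K + 1) * s + 2 * K ^+ 2 * s ^+ 2).

(** The bulk term of the Morawetz identity, u being D phi + c phi and g the
   square of the spherical gradient. *)
Definition bulk s y z u phi g :=
  2 * mp s y z * u ^+ 2 + (mhh1 s y z - mp2 s y z / 2 - mf s z * V01 s y) * phi ^+ 2
  + 2 * mhh s y z * phi * u + mf s z * (1 - s) * y ^+ 3 * (2 - (K + 1) * s) * g.

(** The tortoise derivatives of the two parts of the multiplier and the shifts
   that complete the squares u + a phi. *)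
Definition q1 s y := kap * N * s * (1 - s) * y.
Definition q2 s y z := N * s * y * z ^+ 2.
Definition a1 s y := (3 / 4 - K * s / 2 + (N * s - K * (1 - s)) / 2) * y.
Definition a2 s y z := (2 * N * s * z - K * (1 - s)) / 2 * y.
Definition Hpol s := (2 * K * (K - 2) - (K + 1) * (9 * K - 21) / 4 * s
  + (K ^+ 2 - 4 * K - 3) * s ^+ 2 + K * (K + 1) * s ^+ 3) / 4.
Definition c2 s y z := q2 s y z / 2 * (y ^+ 2 * (2 * N ^+ 2 * s ^+ 2 * z ^+ 2 +
   (1 - s) * (K * (1 - s) - 2 * N * s * z - K * N * s - 2 * N ^+ 2 * s * z)))
  - (z - z0) * V01 s y.

(** Completing squares. The choice of the Hardy weight of the first multiplier
   turns the potential term into (1 - s) y^3 times the cubic [Hpol], which is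
   positive on [0, 1]. *)
Lemma bulkE s y z u phi g : bulk s y z u phi g =
  A * (2 * q1 s y * (u + a1 s y * phi) ^+ 2 + (1 - s) * y ^+ 3 * Hpol s * phi ^+ 2)
  + (2 * q2 s y z * (u + a2 s y z * phi) ^+ 2 + c2 s y z * phi ^+ 2)
  + 2 * (1 - s) * y ^+ 3 * (1 - kap * s) * mf s z * g.
Proof.
have e1 : 2 * mp s y z = A * (2 * q1 s y) + 2 * q2 s y z.
  by rewrite /mp /q1 /q2; ring.
have e2 : mhh s y z = A * (2 * q1 s y * a1 s y) + 2 * q2 s y z * a2 s y z.
  by rewrite /mhh /mp1 /g1 /g2 /g3 /q1 /q2 /a1 /a2; field.
(* the potential terms of the two multipliers *)
have e3 : kap * N * y ^+ 3 / 2 * (- 2 * (1 - s) * g1 s - N * s * (1 - s) * g1' s)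
    + 2 * kap * N * y ^+ 3 * (- 2 * (1 - s) * g3 s - N * s * (1 - s) * g3' s)
    - (1 - kap * s) * V01 s y =
    2 * q1 s y * a1 s y ^+ 2 + (1 - s) * y ^+ 3 * Hpol s.
  by rewrite /V01 /q1 /a1 /Hpol /g1 /g1' /g3 /g3' /kap; field.
have e4 : N * y ^+ 3 / 2 * (- 2 * (1 - s) * g2 s z - N * s * (1 - s) * g2s s z
      + N * s * z ^+ 2 * g2z s z) - (z - z0) * V01 s y =
    2 * q2 s y z * a2 s y z ^+ 2 + c2 s y z.
  by rewrite /c2 /q2 /a2 /g2 /g2s /g2z; field.
have e5 : mhh1 s y z - mp2 s y z / 2 - mf s z * V01 s y =
    A * (2 * q1 s y * a1 s y ^+ 2 + (1 - s) * y ^+ 3 * Hpol s)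
    + (2 * q2 s y z * a2 s y z ^+ 2 + c2 s y z).
  by rewrite -e3 -e4 /mhh1 /mp2 /mf; field.
by rewrite /bulk e1 e2 e5 /kap; field.
Qed.

Hypothesis K3 : 3 <= K.

(** Expanding around K = 3, each coefficient is nonnegative on [0, 1]. *)
Lemma Hpol_ge s : 0 <= s <= 1 -> 3 / 16 <= Hpol s.
Proof.
move=> /andP[s0 s1].
have s3 : 0 <= s ^+ 3 by rewrite exprn_ge0.
have s2 := sqr_ge0 s.
have h1 : 1 / 8 <= 1 - s - s ^+ 2 + 2 * s ^+ 3.
  have e : 1 - s - s ^+ 2 + 2 * s ^+ 3 = (1 - s) ^+ 2 * (1 + s) + s ^+ 3 by ring.
  rewrite e; case: (lerP s (1 / 2)) => h.
    have : 1 / 4 <= (1 - s) ^+ 2 by nra.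
    have : 0 <= (1 - s) ^+ 2 * s by rewrite mulr_ge0 ?sqr_ge0.
    by rewrite mulrDr mulr1; lra.
  have : 0 <= (1 - s) ^+ 2 * (1 + s) by rewrite mulr_ge0 ?sqr_ge0 //; lra.
  have : 1 / 8 <= s ^+ 3.
    have -> : (1 / 8 : R) = (1 / 2) ^+ 3 by field.
    by apply: lerXn2r; rewrite ?nnegrE ?ltW //; lra.
  lra.
(* the tangent line of the cube at 3 / 5 *)
have tg : (27 / 25) * s - 54 / 125 <= s ^+ 3.
  have : 0 <= (s - 3 / 5) ^+ 2 * (s + 6 / 5) by rewrite mulr_ge0 ?sqr_ge0 //; lra.
  have -> : (s - 3 / 5) ^+ 2 * (s + 6 / 5) = s ^+ 3 - (27 / 25) * s + 54 / 125 by field.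
  lra.
have h2 : 0 <= 32 - 42 * s + 8 * s ^+ 2 + 28 * s ^+ 3 by lra.
have h3 : 0 <= 8 - 9 * s + 4 * s ^+ 2 + 4 * s ^+ 3 by lra.
have j0 : 0 <= K - 3 by rewrite subr_ge0.
have e : 16 * Hpol s = 24 * (1 - s - s ^+ 2 + 2 * s ^+ 3)
   + (K - 3) * (32 - 42 * s + 8 * s ^+ 2 + 28 * s ^+ 3)
   + (K - 3) ^+ 2 * (8 - 9 * s + 4 * s ^+ 2 + 4 * s ^+ 3).
  by rewrite /Hpol; field.
have h4 := mulr_ge0 j0 h2; have h5 := mulr_ge0 (sqr_ge0 (K - 3)) h3.
lra.
Qed.

(** An upper bound for the terms of indefinite sign that z produces. *)
Definition err_const : R := N * (2 * N + K * N + 2 * N ^+ 2) / 2 + K / 4 * (2 * (K - 2) + 2 * (K + 1) + 2 * K ^+ 2).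

(** The only term that survives at the horizon is N^3 s^3 y^3 z^4; all others
   carry a factor F = 1 - s and can be absorbed by the first multiplier. *)
Lemma c2_ge s y z : 0 <= s <= 1 -> 0 <= y -> 0 <= z <= 1 -> 0 <= z0 <= 1 ->
  N ^+ 3 * s ^+ 3 * y ^+ 3 * z ^+ 4 - err_const * ((1 - s) * y ^+ 3) <= c2 s y z.
Proof.
move=> /andP[s0 s1] y0 /andP[z1 z2] /andP[z01 z02].
have K3' : 3 <= K := K3; have N2 : 2 <= N by lra.
have y3 : 0 <= (1 - s) * y ^+ 3 by rewrite mulr_ge0 ?subr_ge0 ?exprn_ge0.
pose P := K / 4 * (- 2 * (K - 2) - 2 * (K + 1) * s + 2 * K ^+ 2 * s ^+ 2).
pose B := K / 4 * (2 * (K - 2) + 2 * (K + 1) + 2 * K ^+ 2).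
have s2 : 0 <= s ^+ 2 <= 1 by rewrite sqr_ge0 exprn_ile1.
have PB : - B <= P <= B.
  have k0 : 0 <= K / 4 by lra.
  have Ks : 0 <= (K + 1) * s <= K + 1.
    by rewrite mulr_ge0 ?ler_piMr //; lra.
  have Ks2 : 0 <= K ^+ 2 * s ^+ 2 <= K ^+ 2.
    by case/andP: s2 => *; rewrite mulr_ge0 ?ler_piMr ?sqr_ge0.
  rewrite /P /B -mulrN; apply/andP; split; apply: ler_wpM2l => //; lra.
have zz : -1 <= z - z0 <= 1 by lra.
have B0 : 0 <= B by move: PB; lra.
have h1 : (z - z0) * P <= B by nra.
pose T := 2 * N * s * z + K * N * s + 2 * N ^+ 2 * s * z.
have T1 : T <= 2 * N + K * N + 2 * N ^+ 2.
  have sz : 0 <= s * z <= 1 by rewrite mulr_ge0 //= mulr_ile1.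
  have KN : 0 <= K * N by nra.
  have NN : 0 <= N ^+ 2 by exact: sqr_ge0.
  rewrite /T; have : 2 * N * s * z <= 2 * N by nra.
  have : K * N * s <= K * N by nra.
  have : 2 * N ^+ 2 * s * z <= 2 * N ^+ 2 by nra.
  lra.
have N0 : 0 <= N by lra.
have K0 : 0 <= K by lra.
have T0 : 0 <= T by rewrite /T !addr_ge0 // !mulr_ge0 // sqr_ge0.
have sz2 : 0 <= s * z ^+ 2 <= 1.
  by rewrite mulr_ge0 ?sqr_ge0 //= mulr_ile1 // ?sqr_ge0 // exprn_ile1.
have h2 : s * z ^+ 2 * (T - K * (1 - s)) <= 2 * N + K * N + 2 * N ^+ 2.
  have : T - K * (1 - s) <= 2 * N + K * N + 2 * N ^+ 2 by nra.
  nra.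
have e : c2 s y z - N ^+ 3 * s ^+ 3 * y ^+ 3 * z ^+ 4 =
   (1 - s) * y ^+ 3 * (- (N / 2 * (s * z ^+ 2 * (T - K * (1 - s)))) - (z - z0) * P).
  by rewrite /c2 /q2 /V01 /T /P; field.
suff : (1 - s) * y ^+ 3 * (- err_const) <=
   (1 - s) * y ^+ 3 * (- (N / 2 * (s * z ^+ 2 * (T - K * (1 - s)))) - (z - z0) * P) by rewrite -e; lra.
apply: ler_wpM2l => //; rewrite /err_const -/B.
have : N / 2 * (s * z ^+ 2 * (T - K * (1 - s))) <= N / 2 * (2 * N + K * N + 2 * N ^+ 2).
  by apply: ler_wpM2l => //; lra.
lra.
Qed.

Hypothesis A_large : err_const + 2 <= A * (3 / 16).

(** Coercivity of the bulk term: the zeroth-order term of the first multiplier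
   degenerates at the horizon like 1 - s, where the second one takes over. *)
Lemma bulk_ge s y z u phi g : 0 <= s <= 1 -> 0 <= y -> 0 <= z <= 1 ->
  0 <= z0 <= 1 -> 0 <= g -> 0 <= (1 - kap * s) * (z - z0) ->
  2 * q2 s y z * (u + a2 s y z * phi) ^+ 2 + y ^+ 3 * z ^+ 4 * phi ^+ 2
  + 2 * A * ((1 - s) * y ^+ 3 * (1 - kap * s) ^+ 2 * g) <= bulk s y z u phi g.
Proof.
move=> s01 y0 z01 z001 g0 sg.
have := c2_ge s01 y0 z01 z001; have := Hpol_ge s01.
move: s01 z01 z001 => /andP[s0 s1] /andP[z1 z2] /andP[z01 z02] H3 hc2.
have K3' : 3 <= K := K3; have N2 : 2 <= N by lra.
have Al : err_const + 2 <= A * (3 / 16) := A_large.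
have C20 : 0 <= err_const.
  rewrite /err_const; have : 0 <= N * (2 * N + K * N + 2 * N ^+ 2).
    by have := sqr_ge0 N; rewrite mulr_ge0 //; nra.
  have : 0 <= K / 4 * (2 * (K - 2) + 2 * (K + 1) + 2 * K ^+ 2).
    by have := sqr_ge0 K; rewrite mulr_ge0 //; nra.
  lra.
have A0 : 0 <= A by lra.
have y3 : 0 <= y ^+ 3 by rewrite exprn_ge0.
have F0 : 0 <= 1 - s by lra.
have Fy3 : 0 <= (1 - s) * y ^+ 3 by rewrite mulr_ge0.
have q10 : 0 <= q1 s y.
  by rewrite /q1 !mulr_ge0 // /kap; lra.
have z4 : 0 <= z ^+ 4 <= 1 by rewrite exprn_ge0 // exprn_ile1.
(* the zeroth-order coefficient *)
have coef : y ^+ 3 * z ^+ 4 <= A * ((1 - s) * y ^+ 3 * Hpol s) + c2 s y z.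
  have h1 : A * ((1 - s) * y ^+ 3 * (3 / 16)) <= A * ((1 - s) * y ^+ 3 * Hpol s).
    by rewrite ler_wpM2l // ler_wpM2l.
  have h2 : (err_const + 2) * ((1 - s) * y ^+ 3) <= A * (3 / 16) * ((1 - s) * y ^+ 3).
    by rewrite ler_wpM2r.
  have h3 : z ^+ 4 <= N ^+ 3 * s ^+ 3 * z ^+ 4 + 2 * (1 - s).
    have N4 : 4 <= N ^+ 2 by nra.
    have N3 : 8 <= N ^+ 3 by rewrite exprS; nra.
    case: (lerP s (1 / 2)) => hs.
      have : 0 <= N ^+ 3 * s ^+ 3 * z ^+ 4 by rewrite !mulr_ge0 ?exprn_ge0 //; lra.
      lra.
    have s3 : 1 / 8 <= s ^+ 3.
      have -> : (1 / 8 : R) = (1 / 2) ^+ 3 by field.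
      by apply: lerXn2r; rewrite ?nnegrE ?ltW //; lra.
    have : 1 <= N ^+ 3 * s ^+ 3 by nra.
    by move: z4 => /andP[z40 _]; nra.
  have h4 := ler_wpM2l y3 h3.
  move: h1 h2 h4 hc2; rewrite !mulrDr !mulrDl; lra.
have ang : 2 * A * ((1 - s) * y ^+ 3 * (1 - kap * s) ^+ 2 * g) <=
    2 * (1 - s) * y ^+ 3 * (1 - kap * s) * mf s z * g.
  have -> : 2 * (1 - s) * y ^+ 3 * (1 - kap * s) * mf s z * g =
    2 * A * ((1 - s) * y ^+ 3 * (1 - kap * s) ^+ 2 * g) +
    2 * ((1 - s) * y ^+ 3 * ((1 - kap * s) * (z - z0)) * g) by rewrite /mf; ring.
  by rewrite lerDl; apply: mulr_ge0 => //; apply: mulr_ge0 => //; apply: mulr_ge0.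
have sq1 : 0 <= A * (2 * q1 s y * (u + a1 s y * phi) ^+ 2).
  by apply: mulr_ge0 => //; apply: mulr_ge0; [apply: mulr_ge0|exact: sqr_ge0].
have := ler_wpM2r (sqr_ge0 phi) coef.
rewrite bulkE; move: sq1 ang; rewrite !mulrDr !mulrDl; lra.
Qed.

End multiplier_algebra.


(** * Solutions of the wave equation *)

Section nice_closure.
Context {R : realType} {n : nat} {rs : R}.
Local Notation V := (R * R * 'rV[R]_n)%type.
Local Notation nice := (@nice R n rs).
Implicit Types (G H : V -> R).

Lemma nice_cst (c : R) : nice (fun _ => c).
Proof. by move=> p _; exact: ct_cst. Qed.

Lemma niceD G H : nice G -> nice H -> nice (fun p => G p + H p).
Proof. by move=> h1 h2 p ep; apply: ctD; [exact: h1|exact: h2]. Qed.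

Lemma niceN G : nice G -> nice (fun p => - G p).
Proof. by move=> h1 p ep; apply: ctN; exact: h1. Qed.

Lemma niceM G H : nice G -> nice H -> nice (fun p => G p * H p).
Proof. by move=> h1 h2 p ep; apply: ctM; [exact: h1|exact: h2]. Qed.

Lemma niceX G m : nice G -> nice (fun p => G p ^+ m).
Proof. by move=> h1 p ep; apply: ctX; exact: h1. Qed.

Lemma nice_sum (I : Type) (s : seq I) (F : I -> V -> R) :
  (forall i, nice (F i)) -> nice (fun p => \sum_(i <- s) F i p).
Proof. by move=> h p ep; apply: ct_sum => i; exact: h. Qed.

Lemma nice_radial (f : R -> R) : (forall r, rs < r -> {for r, continuous f}) ->
  nice (fun p => f p.1.2).
Proof.
move=> h p [p1 _]; apply: (@ct_comp _ _ f (fun p : V => p.1.2)); first exact: h.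
by apply: (@continuous_comp _ _ _ fst snd); [exact: cvg_fst|exact: cvg_snd].
Qed.

Lemma nice_radial_derivable (f df : R -> R) :
  (forall r, rs < r -> is_derive r 1 f (df r)) -> nice (fun p => f p.1.2).
Proof.
move=> h; apply: nice_radial => r rr.
by apply/differentiable_continuous/derivable1_diffP; case: (h r rr).
Qed.

Lemma nice_time (f : R -> R) : continuous f -> nice (fun p => f p.1.1).
Proof.
move=> h p _; apply: (@ct_comp _ _ f (fun p : V => p.1.1)); first exact: h.
by apply: (@continuous_comp _ _ _ fst fst); [exact: cvg_fst|exact: cvg_fst].
Qed.

Lemma nice_at0 G : nice G -> nice (fun p => G (0, p.1.2, p.2)).
Proof.
move=> nG p ep; apply: (@continuous_comp _ _ _ (fun p : V => (0, p.1.2, p.2)) G).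
  apply: ct_pair; last exact: cvg_snd.
  apply: ct_pair; first exact: cst_continuous.
  by apply: (@continuous_comp _ _ _ fst snd); [exact: cvg_fst|exact: cvg_snd].
by apply: nG; case: ep.
Qed.

End nice_closure.

Section solution_facts.
Context {R : realType} {n : nat} (rs : R) (phi : R -> R -> 'rV[R]_n -> R).
Local Notation V := (R * R * 'rV[R]_n)%type.
Local Notation S := (@sphere R n).
Local Notation d := (n - 3)%N.
Local Notation ex i := (e_x (delta_mx ord0 i) : V).
Hypothesis rs_gt0 : 0 < rs.
Hypothesis wave : wave_solution rs phi.

Definition U0 : V -> R := ray_ext phi.
Definition Ut : V -> R := 'D_e_t U0.
Definition Ur : V -> R := 'D_e_r U0.
Definition Ui (i : 'I_n) : V -> R := 'D_(ex i) U0.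
Definition Utt : V -> R := 'D_e_t Ut.
Definition Utr : V -> R := 'D_e_r Ut.
Definition Urr : V -> R := 'D_e_r Ur.
Definition Uti (i : 'I_n) : V -> R := 'D_(ex i) Ut.
Definition Uri (i : 'I_n) : V -> R := 'D_(ex i) Ur.
Definition Uii (i : 'I_n) : V -> R := 'D_(ex i) (Ui i).

Definition gradsq (p : V) : R := \sum_i Ui i p ^+ 2.
Definition lapl (p : V) : R := \sum_i Uii i p.
Definition grad_t (p : V) : R := \sum_i Uti i p * Ui i p.
Definition grad_r (p : V) : R := \sum_i Uri i p * Ui i p.

Let CU : class_C 2 (exterior rs) U0. Proof. by case: wave. Qed.

Lemma nU0 : nice rs U0. Proof. by move=> p ep; exact: C2_continuous CU _ ep. Qed.
Lemma nUt : nice rs Ut. Proof. by move=> p ep; exact: (C2_continuous1 CU). Qed.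
Lemma nUr : nice rs Ur. Proof. by move=> p ep; exact: (C2_continuous1 CU). Qed.
Lemma nUi i : nice rs (Ui i). Proof. by move=> p ep; exact: (C2_continuous1 CU). Qed.
Lemma nUtt : nice rs Utt. Proof. by move=> p ep; exact: (C2_continuous2 CU). Qed.
Lemma nUtr : nice rs Utr. Proof. by move=> p ep; exact: (C2_continuous2 CU). Qed.
Lemma nUrr : nice rs Urr. Proof. by move=> p ep; exact: (C2_continuous2 CU). Qed.
Lemma nUti i : nice rs (Uti i). Proof. by move=> p ep; exact: (C2_continuous2 CU). Qed.
Lemma nUri i : nice rs (Uri i). Proof. by move=> p ep; exact: (C2_continuous2 CU). Qed.
Lemma nUii i : nice rs (Uii i). Proof. by move=> p ep; exact: (C2_continuous2 CU). Qed.

Lemma ngradsq : nice rs gradsq.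
Proof. by apply: nice_sum => i; apply: niceX; exact: nUi. Qed.
Lemma nlapl : nice rs lapl.
Proof. by apply: nice_sum => i; exact: nUii. Qed.
Lemma ngrad_t : nice rs grad_t.
Proof. by apply: nice_sum => i; apply: niceM; [exact: nUti|exact: nUi]. Qed.
Lemma ngrad_r : nice rs grad_r.
Proof. by apply: nice_sum => i; apply: niceM; [exact: nUri|exact: nUi]. Qed.

Lemma gradsq_ge0 p : 0 <= gradsq p.
Proof. by apply: sumr_ge0 => i _; exact: sqr_ge0. Qed.

Section at_point.
Variables (t r : R) (x : 'rV[R]_n).
Hypotheses (rr : rs < r) (x0 : x != 0).
Let ep : exterior rs (t, r, x) := conj rr x0.

Lemma dt_U0 : is_derive t 1 (fun s => U0 (s, r, x)) (Ut (t, r, x)).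
Proof. by apply: slice_t; apply: derivableP; exact: (C2_derivable CU). Qed.
Lemma dr_U0 : is_derive r 1 (fun s => U0 (t, s, x)) (Ur (t, r, x)).
Proof. by apply: slice_r; apply: derivableP; exact: (C2_derivable CU). Qed.
Lemma dt_Ut : is_derive t 1 (fun s => Ut (s, r, x)) (Utt (t, r, x)).
Proof. by apply: slice_t; apply: derivableP; exact: (C2_derivable2 CU). Qed.
Lemma dr_Ut : is_derive r 1 (fun s => Ut (t, s, x)) (Utr (t, r, x)).
Proof. by apply: slice_r; apply: derivableP; exact: (C2_derivable2 CU). Qed.
Lemma dt_Ur : is_derive t 1 (fun s => Ur (s, r, x)) (Utr (t, r, x)).
Proof.
rewrite /Utr (C2_sym CU e_t e_r ep).
by apply: slice_t; apply: derivableP; exact: (C2_derivable2 CU).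
Qed.
Lemma dr_Ur : is_derive r 1 (fun s => Ur (t, s, x)) (Urr (t, r, x)).
Proof. by apply: slice_r; apply: derivableP; exact: (C2_derivable2 CU). Qed.
Lemma dt_Ui i : is_derive t 1 (fun s => Ui i (s, r, x)) (Uti i (t, r, x)).
Proof.
rewrite /Uti (C2_sym CU e_t (ex i) ep).
by apply: slice_t; apply: derivableP; exact: (C2_derivable2 CU).
Qed.
Lemma dr_Ui i : is_derive r 1 (fun s => Ui i (t, s, x)) (Uri i (t, r, x)).
Proof.
rewrite /Uri (C2_sym CU e_r (ex i) ep).
by apply: slice_r; apply: derivableP; exact: (C2_derivable2 CU).
Qed.

Lemma dt_gradsq : is_derive t 1 (fun s => gradsq (s, r, x)) (2 * grad_t (t, r, x)).
Proof.
have H := isd_sum (index_enum 'I_n) (fun i => isdM (dt_Ui i) (dt_Ui i)).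
apply: (isd_eq H) => [s|]; first by apply: eq_bigr => i _; rewrite expr2.
by rewrite /grad_t mulr_sumr; apply: eq_bigr => i _; ring.
Qed.

Lemma dr_gradsq : is_derive r 1 (fun s => gradsq (t, s, x)) (2 * grad_r (t, r, x)).
Proof.
have H := isd_sum (index_enum 'I_n) (fun i => isdM (dr_Ui i) (dr_Ui i)).
apply: (isd_eq H) => [s|]; first by apply: eq_bigr => i _; rewrite expr2.
by rewrite /grad_r mulr_sumr; apply: eq_bigr => i _; ring.
Qed.

End at_point.

Lemma wave_eq t r w : rs < r -> S w -> Utt (t, r, w) = lap d rs r *
  ((d.+2%:R * ir r * lap d rs r + d.+1%:R * sc d rs r * ir r) * Ur (t, r, w)
   + lap d rs r * Urr (t, r, w) + ir r ^+ 2 * lapl (t, r, w)).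
Proof.
move=> rr sw; have [_ /(_ t r w rr sw)] := wave.
have /andP[l0 _] := lap_bounds d rs_gt0 rr; have r0 := r_gt0 rs_gt0 rr.
have E : derive1 (fun s => s ^+ d.+2 * lapse n rs s * dr phi t s w) r =
   vol d r * ((d.+2%:R * ir r * lap d rs r + d.+1%:R * sc d rs r * ir r) * Ur (t, r, w)
     + lap d rs r * Urr (t, r, w)).
  rewrite derive1E; apply: isd_val.
  have H := isdM (isdM (is_derive_vol d rs_gt0 rr) (is_derive_lap d rs_gt0 rr))
    (dr_Ur t rr (sphere_neq0 sw)).
  apply: (isd_eq H) => [s|]; first by rewrite /vol (drE phi).
  ring.
rewrite /box E dttE // sphere_laplacianE -/(vol d r).
rewrite -[lapse n rs r]/(lap d rs r).
have v0 : vol d r != 0 by rewrite gt_eqF // (vol_gt0 d rs_gt0 rr).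
rewrite mulrA mulVf // mul1r => H.
have E2 : r ^- 2 = ir r ^+ 2 by rewrite /ir exprVn.
rewrite E2 in H.
apply: (mulfI (x := (lap d rs r)^-1)); first by rewrite invr_eq0 gt_eqF.
rewrite mulKf ?gt_eqF //; apply/eqP; rewrite -subr_eq0; apply/eqP.
rewrite -[RHS]oppr0 -H; rewrite /Utt /Ut /lapl /Uii /Ui /U0; ring.
Qed.

(** The multipliers are combinations of the solution and of its derivatives in t
   and r with coefficients that are constant on spheres, and such combinations
   are constant along rays. *)
Lemma sphere_div (a b c : R) t r : rs < r ->
  (\int[@surface_measure R n]_(w in S)
    ((a * U0 (t, r, w) + b * Ut (t, r, w) + c * Ur (t, r, w)) * lapl (t, r, w) +
     (a * gradsq (t, r, w) + b * grad_t (t, r, w) + c * grad_r (t, r, w)))%:E = 0)%E.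
Proof.
move=> rr.
have RG (A B C : R) : (a * A + b * B + c * C) * A =
  a * A ^+ 2 + b * (B * A) + c * (C * A) by ring.
have SG (A B C : 'I_n -> R) : \sum_i (a * A i + b * B i + c * C i) =
    a * (\sum_i A i) + b * (\sum_i B i) + c * (\sum_i C i).
  by rewrite !big_split /= -!mulr_sumr.
pose f (x : 'rV[R]_n) := U0 (t, r, x).
pose h (x : 'rV[R]_n) := a * U0 (t, r, x) + b * Ut (t, r, x) + c * Ur (t, r, x).
have sl (G : V -> R) (v x : 'rV[R]_n) : 'D_v (fun y => G (t, r, y)) x = 'D_(e_x v) G (t, r, x).
  exact: slice_derive_x.
have dGx (G : V -> R) (x : 'rV[R]_n) (i : 'I_n) : derivable G (t, r, x) (ex i) -> is_derive x (delta_mx ord0 i)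
    (fun y => G (t, r, y)) ('D_(ex i) G (t, r, x)).
  by move=> dG; apply: slice_x; exact: derivableP.
have ep (x : 'rV[R]_n) : x != 0 -> exterior rs (t, r, x) by split.
have DD2 (x : 'rV[R]_n) (i : 'I_n) (v : V) : x != 0 -> derivable ('D_v U0) (t, r, x) (ex i).
  by move=> x0; exact: (@C2_derivable2 _ _ _ _ CU (t, r, x) v (ex i) (ep x x0)).
have hd (x : 'rV[R]_n) (i : 'I_n) : x != 0 -> is_derive x (delta_mx ord0 i) h
    (a * Ui i (t, r, x) + b * Uti i (t, r, x) + c * Uri i (t, r, x)).
  move=> x0.
  have h0 := isdZ a (dGx U0 x i (@C2_derivable _ _ _ _ CU (t, r, x) (ex i) (ep x x0))).
  have h1 := isdZ b (dGx Ut x i (DD2 x i _ x0)).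
  have h2 := isdZ c (dGx Ur x i (DD2 x i _ x0)).
  have H := isdD (isdD h0 h1) h2.
  exact: H.
have cs (G : V -> R) (x : 'rV[R]_n) : nice rs G -> x != 0 -> {for x, continuous (fun y => G (t, r, y))}.
  move=> nG x0; apply: (@continuous_comp _ _ _ (fun y : 'rV[R]_n => (t, r, y)) G).
    by apply: ct_pair; [exact: cst_continuous|exact: cvg_id].
  exact: nG (ep x x0).
have near0 (x : 'rV[R]_n) (P : 'rV[R]_n -> Prop) : x != 0 -> (forall y, y != 0 -> P y) ->
    \forall y \near x, P y.
  move=> x0 hP; have := near_exterior (ep x x0) (P := fun q => P q.2) (fun q hq => hP _ hq.2).
  have cp : {for x, continuous (fun y : 'rV[R]_n => (t, r, y))}.
    by apply: ct_pair; [exact: cst_continuous|exact: cvg_id].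
  by move=> hq; exact: (cp _ hq).
have Z (c0 : R) (x : 'rV[R]_n) : 0 < c0 -> h (c0 *: x) = h x.
  move=> c00; rewrite /h /Ut /Ur /U0 ray_extZ //; congr (_ + _ * _ + _ * _).
    by apply: derive_tr_ray => t' r' y; exact: ray_extZ.
  by apply: derive_tr_ray => t' r' y; exact: ray_extZ.
have dfE (i : 'I_n) : 'D_(delta_mx ord0 i) f = (fun x => Ui i (t, r, x)).
  by apply/funext => x; exact: sl.
have ddfE (i : 'I_n) : 'D_(delta_mx ord0 i) ('D_(delta_mx ord0 i) f) = (fun x => Uii i (t, r, x)).
  by rewrite dfE; apply/funext => x; exact: sl.
apply: etrans; last apply: (@sphere_integration_by_parts R n h f).
- apply: eq_integral => w; rewrite inE => sw; congr EFin.
  have E1 : \sum_i 'D_(delta_mx ord0 i) ('D_(delta_mx ord0 i) f) w = lapl (t, r, w).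
    by apply: eq_bigr => i _; exact: (congr1 (fun g => g w) (ddfE i)).
  have E2 i : 'D_(delta_mx ord0 i) h w * 'D_(delta_mx ord0 i) f w =
      a * Ui i (t, r, w) ^+ 2 + b * (Uti i (t, r, w) * Ui i (t, r, w))
      + c * (Uri i (t, r, w) * Ui i (t, r, w)).
    have e1 := congr1 (fun g => g w) (dfE i).
    have e2 := isd_val (hd w i (sphere_neq0 sw)).
    by rewrite e1 e2; exact: RG.
  rewrite E1; congr +%R.
  have E3 := SG (fun i => Ui i (t, r, w) ^+ 2) (fun i => Uti i (t, r, w) * Ui i (t, r, w))
    (fun i => Uri i (t, r, w) * Ui i (t, r, w)).
  rewrite [LHS]/= -[LHS]/(a * gradsq (t, r, w) + b * grad_t (t, r, w) + c * grad_r (t, r, w)).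
  apply: etrans; first exact: esym E3.
  by apply: eq_bigr => i _; exact: esym (E2 i).
- exact: Z.
- by move=> c0 x c00; exact: ray_extZ.
- by move=> x i x0; exact: isd_ex (hd x i x0).
- by move=> x i x0; exact: isd_ex (dGx U0 x i (@C2_derivable _ _ _ _ CU (t, r, x) (ex i) (ep x x0))).
- by move=> x i x0; rewrite dfE; exact: isd_ex (dGx (Ui i) x i (DD2 x i _ x0)).
- move=> x x0; apply: (cs (fun p => a * U0 p + b * Ut p + c * Ur p)) => //.
  apply: niceD; first apply: niceD; apply: niceM; try exact: nice_cst.
  + exact: nU0.
  + exact: nUt.
  + exact: nUr.
- move=> x i x0.
  have E : \forall y \near x, a * Ui i (t, r, y) + b * Uti i (t, r, y) + c * Uri i (t, r, y)
      = 'D_(delta_mx ord0 i) h y.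
    by apply: near0 => // y y0; rewrite (isd_val (hd y i y0)).
  have C : {for x, continuous (fun y => a * Ui i (t, r, y) + b * Uti i (t, r, y) + c * Uri i (t, r, y))}.
    apply: (cs (fun p => a * Ui i p + b * Uti i p + c * Uri i p)) => //.
    apply: niceD; first apply: niceD; apply: niceM; try exact: nice_cst.
    + exact: nUi.
    + exact: nUti.
    + exact: nUri.
  have E0 := nbhs_singleton E.
  exact: (@eq_rect _ _ (fun l : R => ('D_(delta_mx ord0 i) h) @ x --> l)
    (cvg_trans (near_eq_cvg E) C) _ E0).
- by move=> x i x0; rewrite dfE; exact: cs (@nUi i) x0.
- by move=> x i x0; rewrite ddfE; exact: cs (@nUii i) x0.
Qed.

End solution_facts.


(** * Derivatives and bounds of the radial coefficients *)

(** Derivatives of expressions in the radial functions. *)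
Ltac radial rs_gt0 rr :=
  lazymatch goal with
  | |- is_derive _ _ (fun _ => ?c) _ => exact: isd_cst
  | |- is_derive _ _ (fun q => @?f q + @?g q) _ => notypeclasses refine (@isdD _ _ f g _ _ _ _ _ _); radial rs_gt0 rr
  | |- is_derive _ _ (fun q => - @?f q) _ => notypeclasses refine (@isdN _ _ f _ _ _ _); radial rs_gt0 rr
  | |- is_derive _ _ (fun q => @?f q * @?g q) _ => notypeclasses refine (@isdM _ _ f g _ _ _ _ _ _); radial rs_gt0 rr
  | |- is_derive _ _ (fun q => @?f q ^+ ?m.+1) _ => notypeclasses refine (@is_derive_pow _ f m _ _ _); radial rs_gt0 rr
  | |- is_derive _ _ (fun q => sc _ _ q) _ => exact: (is_derive_sc _ rs_gt0 rr)
  | |- is_derive _ _ (fun q => ir q) _ => exact: (is_derive_ir rs_gt0 rr)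
  | |- is_derive _ _ (fun q => zt _ _ q) _ => exact: (is_derive_zt _ rs_gt0 rr)
  | |- is_derive _ _ (fun q => lap _ _ q) _ => exact: (is_derive_lap _ rs_gt0 rr)
  | |- is_derive _ _ (fun q => vol _ q) _ => exact: (is_derive_vol _ rs_gt0 rr)
  | |- is_derive _ _ (sc _ _) _ => exact: (is_derive_sc _ rs_gt0 rr)
  | |- is_derive _ _ ir _ => exact: (is_derive_ir rs_gt0 rr)
  | |- is_derive _ _ (zt _ _) _ => exact: (is_derive_zt _ rs_gt0 rr)
  | |- is_derive _ _ (lap _ _) _ => exact: (is_derive_lap _ rs_gt0 rr)
  | |- is_derive _ _ (vol _) _ => exact: (is_derive_vol _ rs_gt0 rr)
  end.

Section radial_multipliers.
Context {R : realType} (d : nat) (rs A z0 : R).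
Hypothesis rs_gt0 : 0 < rs.
Local Notation K := (d.+2%:R : R).
Local Notation N := (d.+1%:R : R).
Local Notation sc := (sc d rs).
Local Notation lap := (lap d rs).
Local Notation zt := (zt d rs).
Local Notation Lam := (Lam d rs).

Lemma natN : N = K - 1.
Proof. by rewrite -(natr1 d.+1) addrK. Qed.

Lemma isd_cval (f : R -> R) (r df dg : R) : is_derive r 1 f df -> df = dg -> is_derive r 1 f dg.
Proof. by move=> h <-. Qed.

Lemma isd_inv (f : R -> R) (r df : R) : f r != 0 -> is_derive r 1 f df ->
  is_derive r 1 (fun q => (f q)^-1) (- (f r) ^- 2 * df).
Proof. by move=> f0 h; have H := @is_deriveV R f r df 1 f0 h; apply: (isd_eq H). Qed.

Section at_radius.
Variables (r : R).
Hypothesis rr : rs < r.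

Let F0 : 1 - sc r != 0.
Proof. by have /andP[l0 _] := lap_bounds d rs_gt0 rr; rewrite gt_eqF. Qed.

Lemma is_derive_mf : is_derive r 1 (fun q => mf K A z0 (sc q) (zt q))
  (mp K A (sc r) (ir r) (zt r) / lap r).
Proof.
rewrite /mf /mp; notypeclasses refine (isd_cval _ _); first by radial rs_gt0 rr.
by rewrite -natN /lap; field.
Qed.

Lemma is_derive_mp : is_derive r 1 (fun q => mp K A (sc q) (ir q) (zt q))
  (mp1 K A (sc r) (ir r) (zt r) / lap r).
Proof.
rewrite /mp /mp1 -natN; notypeclasses refine (isd_cval _ _); first by radial rs_gt0 rr.
by rewrite /g1 /g2 natN /lap; field.
Qed.

Lemma is_derive_mp1 : is_derive r 1 (fun q => mp1 K A (sc q) (ir q) (zt q))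
  (mp2 K A (sc r) (ir r) (zt r) / lap r).
Proof.
rewrite /mp1 /g1 /g2; notypeclasses refine (isd_cval _ _); first by radial rs_gt0 rr.
by rewrite /mp2 /g1 /g2 /g1' /g2s /g2z /lap natN; field.
Qed.

Lemma is_derive_mhh : is_derive r 1 (fun q => mhh K A (sc q) (ir q) (zt q))
  (mhh1 K A (sc r) (ir r) (zt r) / lap r).
Proof.
rewrite /mhh; notypeclasses refine (isd_cval _ _).
  notypeclasses refine (isdD _ _); first exact: is_derive_mp1.
  by rewrite /g3; radial rs_gt0 rr.
by rewrite /mhh1 /g3 /g3' /lap natN; field.
Qed.

Lemma is_derive_V0 : is_derive r 1 (fun q => V0 K (sc q) (ir q))
  (V01 K (sc r) (ir r) / lap r).
Proof.
rewrite /V0; notypeclasses refine (isd_cval _ _); first by radial rs_gt0 rr.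
by rewrite /V01 /lap natN; field.
Qed.

Lemma is_derive_ang : is_derive r 1 (fun q => lap q * ir q ^+ 2)
  (ir r ^+ 3 * (- 2 + (K + 1) * sc r)).
Proof.
notypeclasses refine (isd_cval _ _); first by radial rs_gt0 rr.
by rewrite /lap natN; field.
Qed.

(** The zeroth order coefficient of the conjugated derivative. *)
Definition half_vol q : R := K / 2 * lap q * ir q.

Lemma is_derive_half_vol :
  is_derive r 1 half_vol ((V0 K (sc r) (ir r) - half_vol r ^+ 2) / lap r).
Proof.
rewrite /half_vol; notypeclasses refine (isd_cval _ _); first by radial rs_gt0 rr.
by rewrite /V0 /lap natN; field.
Qed.


(** The cutoffs are functions of m = r + (rs / N) Lam, which tends to infinity
   at the horizon as well as at infinity, and whose tortoise derivative is
   bounded. *)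
Definition exhaust q : R := q + rs / N * Lam q.

Lemma is_derive_exhaust :
  is_derive r 1 exhaust ((lap r - rs * ir r * sc r) / lap r).
Proof.
rewrite /exhaust; notypeclasses refine (isd_cval _ _).
  notypeclasses refine (isdD _ _); first exact: is_derive_id.
  notypeclasses refine (isdM _ _); first exact: isd_cst.
  exact: (is_derive_Lam d rs_gt0 rr).
have N0 : N != 0 by rewrite pnatr_eq0.
by move: N0 F0; rewrite /lap; move: (N) => N1 N0 F1; field; rewrite F1.
Qed.

Lemma exhaust_slope : `|lap r - rs * ir r * sc r| <= 1.
Proof.
have /andP[s0 s1] := sc_bounds d rs_gt0 rr.
have h0 := rs_ir rs_gt0 rr; have h1 := ir_gt0 rs_gt0 rr.
have h2 : 0 <= rs * ir r by rewrite mulr_ge0 ?ltW.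
have h3 : rs * ir r * sc r <= 1 by rewrite mulr_ile1 // ltW.
have h4 : 0 <= rs * ir r * sc r by rewrite mulr_ge0 // ltW.
rewrite ler_norml /lap; lra.
Qed.

Lemma exhaust_ge : r <= exhaust r.
Proof.
rewrite /exhaust lerDl mulr_ge0 ?divr_ge0 ?(ltW rs_gt0) //.
by rewrite (le_trans ler01) // (Lam_ge1 d rs_gt0).
Qed.

End at_radius.

Lemma bernoulli (x : R) m : 0 <= x <= 1 -> 1 - x ^+ m <= m%:R * (1 - x).
Proof.
move=> /andP[x0 x1]; elim: m => [|m ih]; first by rewrite expr0 subrr mul0r.
rewrite exprS -natr1 mulrDl mul1r.
have h : x * (1 - x ^+ m) <= 1 - x ^+ m by rewrite ler_piMl // subr_ge0 exprn_ile1.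
lra.
Qed.

(** Near the horizon, F <= N (r - rs) / rs turns a bound on the logarithm of F
   into a lower bound on r - rs. *)
Lemma exhaust_proper X : exists a b, [/\ rs < a, a <= b &
  forall q, rs < q -> exhaust q < X -> a < q < b].
Proof.
pose c := N * X / rs; pose e := expR (- c).
have N0 : 0 < N by rewrite ltr0n.
exists (rs + rs * e / N), (Num.max X (rs + rs * e / N)); split.
- by rewrite ltrDl divr_gt0 ?mulr_gt0 ?expR_gt0.
- by rewrite le_max lexx orbT.
move=> q qq hX; have q0 := r_gt0 rs_gt0 qq.
have qX : q < X by exact: le_lt_trans (exhaust_ge qq) hX.
rewrite lt_max qX andbT.
have /andP[l0 l1] := lap_bounds d rs_gt0 qq.
have h1 : 1 - ln (lap q) < c.
  have : rs / N * Lam q < X.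
    by apply: le_lt_trans hX; rewrite /exhaust lerDr ltW.
  rewrite /c ltr_pdivlMr // -[Lam q]/(1 - ln (lap q)) => h.
  have -> : (1 - ln (lap q)) * rs = N * (rs / N * (1 - ln (lap q))).
    by rewrite mulrA [N * _]mulrC divfK ?gt_eqF // mulrC.
  by rewrite ltr_pM2l.
have h2 : e < lap q.
  by rewrite -[X in _ < X]lnK ?posrE // ltr_expR; lra.
have h3 : lap q <= N * (1 - rs / q).
  by apply: bernoulli; have /andP[/ltW -> /ltW ->] := ratio_bounds rs_gt0 qq.
have h4 : 1 - rs / q <= (q - rs) / rs.
  have -> : 1 - rs / q = (q - rs) / q by rewrite mulrBl divff ?gt_eqF.
  apply: ler_wpM2l; first by rewrite subr_ge0 ltW.
  by rewrite lef_pV2 ?posrE // ltW.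
have h5 : e < N * ((q - rs) / rs).
  by apply: (lt_le_trans h2); apply: (le_trans h3); rewrite ler_wpM2l // ltW.
rewrite -ltrBrDl ltr_pdivrMr // -ltr_pdivlMl //.
by have -> : rs^-1 * ((q - rs) * N) = N * ((q - rs) / rs) by ring.
Qed.

End radial_multipliers.

Section coefficient_bounds.
Context {R : realType} (K A z0 : R).
Hypotheses (K3 : 3 <= K) (A0 : 0 <= A) (z01 : 0 <= z0 <= 1).

(** A common bound, not sharp, for the coefficients of the Morawetz flux. *)
Definition Cm : R := 40 * K ^+ 3 * (1 + A).

Variables (s y z : R).
Hypotheses (s01 : 0 <= s <= 1) (y0 : 0 <= y) (z01' : 0 <= z <= 1) (sz : 1 - s <= 4 * z ^+ 2).

Let bM (a b C D : R) : `|a| <= C -> `|b| <= D -> `|a * b| <= C * D.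
Proof. by move=> h1 h2; rewrite normrM ler_pM. Qed.


Let Kpow : [/\ 1 <= K ^+ 3, K <= K ^+ 3, K ^+ 2 <= K ^+ 3 & 0 <= A * (K ^+ 3 - K ^+ 2)]
  /\ [/\ 0 <= A * (K ^+ 3 - K), 0 <= A * K ^+ 3 & 0 <= A * (K ^+ 3 - 1)].
Proof.
have K1 : 1 <= K by have := K3; lra.
have h1 : 1 <= K ^+ 3 by rewrite exprn_ege1.
have h2 : K <= K ^+ 3 by rewrite -[X in X <= _]expr1 ler_weXn2l.
have h3 : K ^+ 2 <= K ^+ 3 by rewrite ler_weXn2l.
by split; split => //; rewrite mulr_ge0 // ?subr_ge0 //; apply: le_trans h1.
Qed.

Let kap_le : 0 <= kap K <= K.
Proof. have := K3; rewrite /kap; lra. Qed.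

Let bD (a b C D : R) : `|a| <= C -> `|b| <= D -> `|a + b| <= C + D.
Proof. by move=> h1 h2; apply: (le_trans (ler_normD _ _)); exact: lerD. Qed.

Let b1 : [/\ `|s| <= 1, `|z| <= 1, `|1 - s| <= 1, `|1 - s| <= 4 * z ^+ 2 & `|A * kap K| <= A * K]
  /\ [/\ `|K - 1| <= K, `|K| <= K, `|y| <= y, `|y ^+ 2| <= y ^+ 2 & `|z ^+ 2| <= z ^+ 2].
Proof.
have /andP[s0 s1] := s01; have /andP[zz0 z1] := z01'; have /andP[k0 k1] := kap_le.
have K3' := K3; have sz' := sz; have := sqr_ge0 z => zz.
have h : `|A * kap K| <= A * K.
  have e : 0 <= A * kap K by exact: mulr_ge0.
  by rewrite (ger0_norm e) ler_wpM2l.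
split; split => //; try by rewrite ler_norml; lra.
- by rewrite ger0_norm // sqr_ge0.
- by rewrite ger0_norm // sqr_ge0.
Qed.

Lemma mf_bound : `|mf K A z0 s z| <= Cm.
Proof.
have [[p1 p2 p3 p4] [p5 p6 p7]] := Kpow.
have /andP[s0 s1] := s01; have /andP[zz0 z1] := z01'; have /andP[h0 h1] := z01.
have /andP[k0 kK] := kap_le; have K3' := K3; have A0' := A0.
have h2 : 0 <= kap K * s <= K.
  by rewrite mulr_ge0 //=; apply: (le_trans _ kK); rewrite ler_piMr.
have [h3 h4] := andP h2.
have h5 : `|A * (1 - kap K * s)| <= A * K.
  by rewrite normrM (ger0_norm A0) ler_wpM2l // ler_norml; lra.
have h6 : `|z - z0| <= 1 by rewrite ler_norml; lra.
have := bD h5 h6; rewrite /mf /Cm; lra.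
Qed.

Lemma mp_bound : `|mp K A s y z| <= Cm * (y * z ^+ 2).
Proof.
have [[p1 p2 p3 p4] [p5 p6 p7]] := Kpow.
have [[q1 q2 q3 q4 q5] [q6 q7 q8 q9 q10]] := b1.
have h := bM (bM (bM q6 q1) q8) (bD (bM q5 q4) q10).
apply: (le_trans h).
have e : K * 1 * y * (A * K * (4 * z ^+ 2) + z ^+ 2) = (4 * (A * K ^+ 2) + K) * (y * z ^+ 2) by ring.
rewrite e ler_wpM2r ?(mulr_ge0 y0 (sqr_ge0 z)) // /Cm; lra.
Qed.

Let g1_bound : `|g1 K s| <= z ^+ 2 * (8 * K).
Proof.
have [[q1 q2 q3 q4 q5] [q6 q7 q8 q9 q10]] := b1.
have -> : g1 K s = (1 - s) * (((K - 1) * s) * s + - (K * s * (1 - s))) by rewrite /g1; ring.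
have q11 : `|- (K * s * (1 - s))| <= K * 1 * 1 by rewrite normrN; exact: bM (bM q7 q1) q3.
apply: (le_trans (bM q4 (bD (bM (bM q6 q1) q1) q11))).
lra.
Qed.

Let g2_bound : `|g2 K s z| <= z ^+ 2 * (3 * K).
Proof.
have [[q1 q2 q3 q4 q5] [q6 q7 q8 q9 q10]] := b1.
have -> : g2 K s z = z ^+ 2 * (2 * ((K - 1) * s * s * z) + - (K * s * (1 - s))) by rewrite /g2; ring.
have q11 : `|- (K * s * (1 - s))| <= K * 1 * 1 by rewrite normrN; exact: bM (bM q7 q1) q3.
have q12 : `|2 : R| <= 2 by rewrite ger0_norm.
apply: (le_trans (bM q10 (bD (bM q12 (bM (bM (bM q6 q1) q1) q2)) q11))).
lra.
Qed.

Let g3_bound : `|g3 K s| <= z ^+ 2 * (4 * K).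
Proof.
have [[q1 q2 q3 q4 q5] [q6 q7 q8 q9 q10]] := b1.
have -> : g3 K s = (1 - s) * (s * (3 / 4 - K * s / 2)) by rewrite /g3; ring.
have q11 : `|3 / 4 - K * s / 2| <= K.
  have /andP[s0 s1] := s01; have K3' := K3.
  have h : 0 <= K * s <= K by rewrite mulr_ge0 ?ler_piMr //; lra.
  have [h1 h2] := andP h; rewrite ler_norml; lra.
apply: (le_trans (bM q4 (bM q1 q11))).
lra.
Qed.

Lemma mp1_bound : `|mp1 K A s y z| <= Cm * (y ^+ 2 * z ^+ 2).
Proof.
have [[p1 p2 p3 p4] [p5 p6 p7]] := Kpow.
have [[q1 q2 q3 q4 q5] [q6 q7 q8 q9 q10]] := b1.
have h := bM (bM q6 q9) (bD (bM q5 g1_bound) g2_bound).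
apply: (le_trans h).
have -> : K * y ^+ 2 * (A * K * (z ^+ 2 * (8 * K)) + z ^+ 2 * (3 * K)) =
  (8 * (A * K ^+ 3) + 3 * K ^+ 2) * (y ^+ 2 * z ^+ 2) by ring.
rewrite ler_wpM2r ?(mulr_ge0 (sqr_ge0 y) (sqr_ge0 z)) // /Cm; lra.
Qed.

Lemma mhh_bound : `|mhh K A s y z| <= Cm * (y ^+ 2 * z ^+ 2).
Proof.
have [[p1 p2 p3 p4] [p5 p6 p7]] := Kpow.
have [[q1 q2 q3 q4 q5] [q6 q7 q8 q9 q10]] := b1.
have -> : mhh K A s y z = (K - 1) * y ^+ 2 * (A * kap K * g1 K s + g2 K s z) +
   2 * ((A * kap K) * (K - 1) * y ^+ 2 * g3 K s) by rewrite /mhh /mp1; ring.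
have q12 : `|2 : R| <= 2 by rewrite ger0_norm.
have h := bD (bM (bM q6 q9) (bD (bM q5 g1_bound) g2_bound)) (bM q12 (bM (bM (bM q5 q6) q9) g3_bound)).
apply: (le_trans h).
have -> : K * y ^+ 2 * (A * K * (z ^+ 2 * (8 * K)) + z ^+ 2 * (3 * K)) +
    2 * (A * K * K * y ^+ 2 * (z ^+ 2 * (4 * K))) =
  (16 * (A * K ^+ 3) + 3 * K ^+ 2) * (y ^+ 2 * z ^+ 2) by ring.
rewrite ler_wpM2r ?(mulr_ge0 (sqr_ge0 y) (sqr_ge0 z)) // /Cm; lra.
Qed.

Lemma V0_bound : `|V0 K s y| <= Cm * (y ^+ 2 * z ^+ 2).
Proof.
have [[p1 p2 p3 p4] [p5 p6 p7]] := Kpow.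
have [[q1 q2 q3 q4 q5] [q6 q7 q8 q9 q10]] := b1.
have -> : V0 K s y = (1 - s) * y ^+ 2 * ((K / 4) * (K - 2 + K * s)) by rewrite /V0; ring.
have q11 : `|(K / 4) * (K - 2 + K * s)| <= K / 2 * K.
  have /andP[s0 s1] := s01; have K3' := K3.
  have h : 0 <= K * s <= K by rewrite mulr_ge0 ?ler_piMr //; lra.
  have [h1 h2] := andP h.
  have h3 : `|K / 4| <= K / 4 by rewrite ger0_norm //; lra.
  have h4 : `|K - 2 + K * s| <= 2 * K by rewrite ler_norml; lra.
  apply: (le_trans (bM h3 h4)); lra.
apply: (le_trans (bM (bM q4 q9) q11)).
have -> : 4 * z ^+ 2 * y ^+ 2 * (K / 2 * K) = (2 * K ^+ 2) * (y ^+ 2 * z ^+ 2) by field.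
rewrite ler_wpM2r ?(mulr_ge0 (sqr_ge0 y) (sqr_ge0 z)) // /Cm; lra.
Qed.

End coefficient_bounds.


(** * Cutoffs in the radius *)

Section cutoff.
Context {R : realType} {n : nat} (d : nat) (rs : R).
Hypothesis rs_gt0 : 0 < rs.
Local Notation V := (R * R * 'rV[R]_n)%type.
Local Notation S := (@sphere R n).
Local Notation nice := (@nice R n rs).
Implicit Types (q : V -> R) (a b t r T X sg : R) (w : 'rV[R]_n).

(** The shift sg is 0 for a cutoff in space, and the time for a cutoff whose
   support shrinks at unit speed in the tortoise coordinate. *)
Definition chi sg X r : R := pp (1 - (exhaust d rs r + sg) / X).
Definition dchi sg X r : R := dpp (1 - (exhaust d rs r + sg) / X).

Lemma chi_ge0 sg X r : 0 <= chi sg X r. Proof. exact: pp_ge0. Qed.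
Lemma dchi_ge0 sg X r : 0 <= dchi sg X r. Proof. exact: dpp_ge0. Qed.

Section fixed_cutoff.
Variables (sg X : R).
Hypotheses (sg0 : 0 <= sg) (X0 : 0 < X).

Lemma chi_eq0 r : X <= exhaust d rs r + sg -> chi sg X r = 0.
Proof. by move=> h; apply: pp_le0; rewrite subr_le0 ler_pdivlMr // mul1r. Qed.

Let arg_le1 r : rs < r -> 1 - (exhaust d rs r + sg) / X <= 1.
Proof.
move=> rr; rewrite gerBl divr_ge0 ?ltW // ltr_wpDr //.
by apply: lt_le_trans (exhaust_ge d rs_gt0 rr); exact: (r_gt0 rs_gt0 rr).
Qed.

Lemma chi_le1 r : rs < r -> chi sg X r <= 1.
Proof. by move=> rr; apply: pp_le1; exact: arg_le1. Qed.

Lemma dchi_le2 r : rs < r -> dchi sg X r <= 2.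
Proof.
move=> rr; rewrite /dchi /dpp -[leRHS]mulr1 ler_wpM2l //.
by rewrite ge_max ler01 arg_le1.
Qed.

Lemma is_derive_chi r : rs < r -> is_derive r 1 (chi sg X)
  (- (dchi sg X r * ((lap d rs r - rs * ir r * sc d rs r) / lap d rs r) / X)).
Proof.
move=> rr; notypeclasses refine (isd_cval _ _).
  notypeclasses refine (isd_comp (is_derive_pp _) _).
  notypeclasses refine (isdD _ _); first exact: isd_cst.
  notypeclasses refine (isdN _).
  notypeclasses refine (isdM _ _); last exact: isd_cst.
  notypeclasses refine (isdD _ _); last exact: isd_cst.
  exact: (is_derive_exhaust d rs_gt0 rr).
by rewrite /dchi; move: (dpp _) => D; ring.
Qed.

Lemma nice_chi : nice (fun p => chi sg X p.1.2).
Proof. by apply: nice_radial_derivable => r rr; exact: is_derive_chi rr. Qed.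

Lemma nice_dchi : nice (fun p => dchi sg X p.1.2).
Proof.
apply: nice_radial => r rr.
apply: (@ct_comp _ _ (@dpp R) (fun r => 1 - (exhaust d rs r + sg) / X)).
  exact: dpp_continuous.
apply/differentiable_continuous/derivable1_diffP.
have H := isdD (isd_cst 1 r 1) (isdN (isdM (isdD (is_derive_exhaust d rs_gt0 rr)
  (isd_cst sg r 1)) (isd_cst X^-1 r 1))).
exact: isd_ex H.
Qed.

End fixed_cutoff.

Lemma box2_sub a b a' b' : a' <= a -> b <= b' -> box2 (n := n) a b `<=` box2 a' b'.
Proof.
move=> aa bb [w r] [/= sw]; rewrite /itv /= in_itv /= => /andP[h1 h2].
split => //=; rewrite /itv /= in_itv /=; apply/andP; split.
  exact: le_trans h1.
exact: le_trans bb.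
Qed.

Lemma Q2_sub q t a b a' b' : nice q -> rs < a' -> a' <= a -> b <= b' ->
  (forall r w, rs < r -> S w -> 0 <= q (t, r, w)) -> Q2 a b q t <= Q2 a' b' q t.
Proof.
move=> nq ra aa bb q0; have ra' : rs < a by exact: lt_le_trans aa.
rewrite -lee_fin !(EFin_Q2 (rs := rs)) //; apply: ge0_subset_integral.
- exact: measurable_box2.
- exact: measurable_box2.
- exact: measurable_funS (@measurable_ext2 R n rs) (box2_sub_ext2 ra (b := b')) (slab_measurable_ext2 t nq).
- move=> z /(box2_sub_ext2 ra); case: z => w r [/= sw].
  by rewrite in_itv /= andbT => rr; rewrite lee_fin; exact: q0.
- exact: box2_sub.
Qed.

Lemma Q3_sub q T a b a' b' : nice q -> rs < a' -> a' <= a -> b <= b' ->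
  (forall t r w, rs < r -> S w -> 0 <= q (t, r, w)) -> Q3 T a b q <= Q3 T a' b' q.
Proof.
move=> nq ra aa bb q0; have ra' : rs < a by exact: lt_le_trans aa.
rewrite -lee_fin !(EFin_Q3 (rs := rs)) //; apply: ge0_subset_integral.
- exact: measurable_box3.
- exact: measurable_box3.
- by apply/measurable_EFinP; exact: (@nice_measurable3 R n rs q T a' b' nq ra).
- move=> [t z] [/= _] /(box2_sub_ext2 ra); case: z => w r [/= sw].
  by rewrite in_itv /= andbT => rr; rewrite lee_fin; exact: q0.
- by move=> [t z] [/= h1 h2]; split => //=; exact: box2_sub h2.
Qed.

(* The limit of cutoffs at infinity: (1 - M/X)^2 is the least value of the
   cutoff on a fixed box. *)
Let letX (qv M C D : R) : 0 <= qv -> 0 <= M ->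
  (forall X, M + 1 <= X -> (1 - M / X) ^+ 2 * qv <= C + D / X) -> qv <= C.
Proof.
move=> q0 M0 h; rewrite leNgt; apply/negP => qC.
have e0 : 0 < qv - C by rewrite subr_gt0.
pose Y := (`|D| + 2 * M * qv) / (qv - C).
have m0 : 0 <= 2 * M * qv by rewrite mulr_ge0 // mulr_ge0.
have Y0 : 0 <= Y by apply: divr_ge0; [exact: addr_ge0|exact: ltW].
pose X := M + 1 + Y.
have X0 : 0 < X by rewrite /X; lra.
have := h X (ltac:(rewrite /X; lra)).
have -> : (1 - M / X) ^+ 2 * qv = qv - 2 * M * qv / X + (M / X) ^+ 2 * qv by ring.
have k1 : 0 <= (M / X) ^+ 2 * qv by rewrite mulr_ge0 // sqr_ge0.
have k2 : D / X <= `|D| / X by rewrite ler_pM2r ?invr_gt0 // ler_norm.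
have k3 : (`|D| + 2 * M * qv) / X < qv - C.
  have eY : `|D| + 2 * M * qv = Y * (qv - C) by rewrite divfK ?gt_eqF.
  rewrite ltr_pdivrMr // eY [ltRHS]mulrC ltr_pM2r //.
  by rewrite /X ltrDr; lra.
move: k3; rewrite mulrDl; lra.
Qed.

Let box_bound a b sg : rs < a -> exists2 M : R, 0 <= M &
  forall r, a <= r <= b -> exhaust d rs r + sg <= M.
Proof.
move=> ra; exists (Num.max 0 (b + rs / d.+1%:R * Lam d rs a + sg)).
  by rewrite le_max lexx.
move=> r /andP[ar rb]; rewrite le_max; apply/orP; right.
rewrite lerD2r /exhaust lerD // ler_wpM2l ?divr_ge0 ?(ltW rs_gt0) //.
have rr := lt_le_trans ra ar.
have /andP[l0 _] := lap_bounds d rs_gt0 rr; have /andP[l0' _] := lap_bounds d rs_gt0 ra.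
rewrite /Lam lerD2l lerN2 ler_ln ?posrE // /lap lerD2l lerN2 /sc.
have r0 := r_gt0 rs_gt0 rr; have a0 := r_gt0 rs_gt0 ra.
apply: lerXn2r; rewrite ?nnegrE; first by rewrite divr_ge0 ?ltW.
  by rewrite divr_ge0 ?ltW.
by rewrite ler_pM2l // lef_pV2.
Qed.

Let chi_low sg M X r : M + 1 <= X -> 0 <= M -> exhaust d rs r + sg <= M ->
  (1 - M / X) ^+ 2 <= chi sg X r.
Proof.
move=> MX M0 h; have X0 : 0 < X by lra.
have h1 : 0 <= 1 - M / X by rewrite subr_ge0 ler_pdivrMr // mul1r; lra.
rewrite -(pp_ge h1) /chi; apply: pp_homo.
by rewrite lerD2l lerN2 ler_pM2r // invr_gt0.
Qed.

(** Bounds for all cutoffs, up to errors that vanish with the cutoff, pass to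
   the quantity without cutoff. *)
Lemma uncut2 q t sg (C D : R) : nice q -> 0 <= sg ->
  (forall r w, rs < r -> S w -> 0 <= q (t, r, w)) ->
  (forall X a b, 1 <= X -> rs < a -> a <= b ->
    (forall r, rs < r -> exhaust d rs r < X -> a < r < b) ->
    Q2 a b (fun p => chi sg X p.1.2 * q p) t <= C + D / X) ->
  forall a b, rs < a -> a <= b -> Q2 a b q t <= C.
Proof.
move=> nq sg0 q0 h a b ra ab.
have [M M0 hM] := box_bound b sg ra.
apply: (letX (M := M) (D := D)) => // [|X MX].
  by apply: Q2_ge0 => r w /andP[ar _]; apply: q0; exact: lt_le_trans ar.
have X1 : 1 <= X by lra.
have X0 : 0 < X by lra.
have [a' [b' [ra' ab' hp]]] := exhaust_proper d rs_gt0 X.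
have inb r : a <= r <= b -> a' < r < b'.
  move=> rab; have /andP[ar _] := rab.
  by apply: hp; [exact: lt_le_trans ar|have := hM _ rab; lra].
have /andP[/ltW aa _] := inb a (ltac:(by rewrite lexx ab)).
have /andP[_ /ltW bb] := inb b (ltac:(by rewrite lexx ab)).
have nc : nice (fun p => chi sg X p.1.2) by exact: nice_chi.
apply: (le_trans _ (h X a' b' X1 ra' ab' hp)).
rewrite -(Q2Z b t ((1 - M / X) ^+ 2) nq ra).
apply: (le_trans (y := Q2 a b (fun p => chi sg X p.1.2 * q p) t)).
  apply: (Q2_le (rs := rs)) => //.
  - by apply: niceM => //; exact: nice_cst.
  - exact: niceM.
  - move=> r w rab sw /=; have /andP[ar _] := rab.
    by rewrite ler_wpM2r ?q0 ?(lt_le_trans ra ar) // chi_low // hM.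
apply: Q2_sub => // [|r w rr sw]; first exact: niceM.
by rewrite mulr_ge0 ?chi_ge0 ?q0.
Qed.

Lemma uncut3 q T (C D : R) : nice q ->
  (forall t r w, rs < r -> S w -> 0 <= q (t, r, w)) ->
  (forall X a b, 1 <= X -> rs < a -> a <= b ->
    (forall r, rs < r -> exhaust d rs r < X -> a < r < b) ->
    Q3 T a b (fun p => chi 0 X p.1.2 * q p) <= C + D / X) ->
  forall a b, rs < a -> a <= b -> Q3 T a b q <= C.
Proof.
move=> nq q0 h a b ra ab.
have [M M0 hM] := box_bound b 0 ra.
apply: (letX (M := M) (D := D)) => // [|X MX].
  apply: Rintegral_ge0 => -[t [w r]] [/= _ [/= sw]]; rewrite /itv /= in_itv /= => /andP[ar _].
  by apply: q0 => //; exact: lt_le_trans ar.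
have X1 : 1 <= X by lra.
have X0 : 0 < X by lra.
have [a' [b' [ra' ab' hp]]] := exhaust_proper d rs_gt0 X.
have inb r : a <= r <= b -> a' < r < b'.
  move=> rab; have /andP[ar _] := rab.
  by apply: hp; [exact: lt_le_trans ar|have := hM _ rab; lra].
have /andP[/ltW aa _] := inb a (ltac:(by rewrite lexx ab)).
have /andP[_ /ltW bb] := inb b (ltac:(by rewrite lexx ab)).
have nc : nice (fun p => chi 0 X p.1.2) by exact: nice_chi.
apply: (le_trans _ (h X a' b' X1 ra' ab' hp)).
rewrite -(Q3Z T b ((1 - M / X) ^+ 2) nq ra).
apply: (le_trans (y := Q3 T a b (fun p => chi 0 X p.1.2 * q p))).
  apply: (Q3_le (rs := rs)) => //.
  - by apply: niceM => //; exact: nice_cst.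
  - exact: niceM.
  - move=> t r w _ rab sw /=; have /andP[ar _] := rab.
    by rewrite ler_wpM2r ?q0 ?(lt_le_trans ra ar) // chi_low // hM.
apply: Q3_sub => // [|t r w rr sw]; first exact: niceM.
by rewrite mulr_ge0 ?chi_ge0 ?q0.
Qed.

End cutoff.


(** * Divergence identities on boxes *)

Section radial_nice.
Context {R : realType} {n : nat} (d : nat) (rs : R).
Hypothesis rs_gt0 : 0 < rs.
Local Notation V := (R * R * 'rV[R]_n)%type.
Local Notation nice := (@nice R n rs).

Lemma nice_sc : nice (fun p => sc d rs p.1.2).
Proof. exact: (nice_radial_derivable (fun r rr => is_derive_sc d rs_gt0 rr)). Qed.
Lemma nice_ir : nice (fun p => ir p.1.2).
Proof. exact: (nice_radial_derivable (fun r rr => is_derive_ir rs_gt0 rr)). Qed.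
Lemma nice_lap : nice (fun p => lap d rs p.1.2).
Proof. exact: (nice_radial_derivable (fun r rr => is_derive_lap d rs_gt0 rr)). Qed.
Lemma nice_zt : nice (fun p => zt d rs p.1.2).
Proof. exact: (nice_radial_derivable (fun r rr => is_derive_zt d rs_gt0 rr)). Qed.
Lemma nice_vol : nice (fun p => vol d p.1.2).
Proof. exact: (nice_radial_derivable (fun r rr => is_derive_vol d rs_gt0 rr)). Qed.
Lemma nice_exhaust : nice (fun p => exhaust d rs p.1.2).
Proof. exact: (nice_radial_derivable (fun r rr => is_derive_exhaust d rs_gt0 rr)). Qed.
Lemma nice_lapV : nice (fun p => (lap d rs p.1.2)^-1).
Proof.
have F0 (r : R) : rs < r -> lap d rs r != 0.
  by move=> rr; have /andP[l0 _] := lap_bounds d rs_gt0 rr; rewrite gt_eqF.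
exact: (nice_radial_derivable (fun r rr =>
  @isd_inv R (lap d rs) r _ (F0 r rr) (is_derive_lap d rs_gt0 rr))).
Qed.
Lemma nice_t : nice (fun p => p.1.1).
Proof. by apply: (@nice_time _ _ _ id) => t; exact: cvg_id. Qed.
Lemma nice_chi_t X : nice (fun p => chi d rs p.1.1 X p.1.2).
Proof.
move=> p ep; apply: (@ct_comp _ _ (@pp R)); first exact: pp_continuous.
have H : nice (fun p => 1 - (exhaust d rs p.1.2 + p.1.1) * X^-1).
  apply: niceD; first exact: nice_cst.
  apply: niceN; apply: niceM; last exact: nice_cst.
  by apply: niceD; [exact: nice_exhaust|exact: nice_t].
exact: H.
Qed.
Lemma nice_dchi_t X : nice (fun p => dchi d rs p.1.1 X p.1.2).
Proof.
move=> p ep; apply: (@ct_comp _ _ (@dpp R)); first exact: dpp_continuous.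
have H : nice (fun p => 1 - (exhaust d rs p.1.2 + p.1.1) * X^-1).
  apply: niceD; first exact: nice_cst.
  apply: niceN; apply: niceM; last exact: nice_cst.
  by apply: niceD; [exact: nice_exhaust|exact: nice_t].
exact: H.
Qed.
End radial_nice.

(** Continuity of an expression on the exterior, from that of its parts. *)
Ltac nice_with rs_gt0 wave :=
  lazymatch goal with
  | |- nice _ (fun _ => ?c) => refine (@nice_cst _ _ _ c)
  | |- nice _ (fun p => @?f p + @?g p) => refine (@niceD _ _ _ f g _ _); nice_with rs_gt0 wave
  | |- nice _ (fun p => - @?f p) => refine (@niceN _ _ _ f _); nice_with rs_gt0 wave
  | |- nice _ (fun p => @?f p * @?g p) => refine (@niceM _ _ _ f g _ _); nice_with rs_gt0 wave
  | |- nice _ (fun p => @?f p ^+ ?m) => refine (@niceX _ _ _ f m _); nice_with rs_gt0 wave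
  | |- nice _ (fun p => U0 _ p) => refine (nU0 wave)
  | |- nice _ (fun p => Ut _ p) => refine (nUt wave)
  | |- nice _ (fun p => Ur _ p) => refine (nUr wave)
  | |- nice _ (fun p => Utt _ p) => refine (nUtt wave)
  | |- nice _ (fun p => Utr _ p) => refine (nUtr wave)
  | |- nice _ (fun p => Urr _ p) => refine (nUrr wave)
  | |- nice _ (fun p => gradsq _ p) => refine (ngradsq wave)
  | |- nice _ (fun p => lapl _ p) => refine (nlapl wave)
  | |- nice _ (fun p => grad_t _ p) => refine (ngrad_t wave)
  | |- nice _ (fun p => grad_r _ p) => refine (ngrad_r wave)
  | |- nice _ (fun p => sc _ _ _) => refine (nice_sc rs_gt0)
  | |- nice _ (fun p => ir _) => refine (nice_ir rs_gt0)
  | |- nice _ (fun p => (lap _ _ _)^-1) => refine (nice_lapV rs_gt0)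
  | |- nice _ (fun p => lap _ _ _) => refine (nice_lap rs_gt0)
  | |- nice _ (fun p => zt _ _ _) => refine (nice_zt rs_gt0)
  | |- nice _ (fun p => vol _ _) => refine (nice_vol rs_gt0)
  | |- nice _ (fun p => chi _ _ p.1.1 _ _) => refine (@nice_chi_t _ _ _ _ rs_gt0 _)
  | |- nice _ (fun p => dchi _ _ p.1.1 _ _) => refine (@nice_dchi_t _ _ _ _ rs_gt0 _)
  | |- nice _ (fun p => chi _ _ _ _ _) => refine (@nice_chi _ _ _ _ rs_gt0 _ _)
  | |- nice _ (fun p => dchi _ _ _ _ _) => refine (@nice_dchi _ _ _ _ rs_gt0 _ _)
  | |- nice _ (fun p => p.1.1) => refine (@nice_t _ _ _)
  | |- _ => idtac
  end.

Section flux.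
Context {R : realType} {n : nat} (rs : R) (phi : R -> R -> 'rV[R]_n -> R).
Local Notation V := (R * R * 'rV[R]_n)%type.
Local Notation S := (@sphere R n).
Local Notation nice := (@nice R n rs).
Hypothesis rs_gt0 : 0 < rs.
Hypothesis wave : wave_solution rs phi.

(** The integrated form of a divergence identity. The angular part of the
   divergence is that of a multiple of the gradient of the solution. *)
Lemma flux_balance (T a b : R) (M dM J dJ P : V -> R) (al be ga : R -> R -> R) :
  nice M -> nice dM -> nice dJ -> nice P ->
  nice (fun p => al p.1.1 p.1.2) -> nice (fun p => be p.1.1 p.1.2) ->
  nice (fun p => ga p.1.1 p.1.2) ->
  rs < a -> a <= b -> 0 <= T ->
  (forall (t r : R) (w : 'rV[R]_n), a <= r <= b -> S w -> is_derive t 1 (fun s => M (s, r, w)) (dM (t, r, w))) ->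
  (forall (t r : R) (w : 'rV[R]_n), a <= r <= b -> S w -> is_derive r 1 (fun s => J (t, s, w)) (dJ (t, r, w))) ->
  (forall (t : R) (w : 'rV[R]_n), 0 <= t <= T -> S w -> J (t, a, w) = 0) ->
  (forall (t : R) (w : 'rV[R]_n), 0 <= t <= T -> S w -> J (t, b, w) = 0) ->
  (forall (t r : R) (w : 'rV[R]_n), 0 <= t <= T -> a <= r <= b -> S w ->
    dM (t, r, w) + P (t, r, w) <= dJ (t, r, w) +
     ((al t r * U0 phi (t, r, w) + be t r * Ut phi (t, r, w) + ga t r * Ur phi (t, r, w))
        * lapl phi (t, r, w) +
     (al t r * gradsq phi (t, r, w) + be t r * grad_t phi (t, r, w)
        + ga t r * grad_r phi (t, r, w)))) ->
  Q2 a b M T + Q3 T a b P <= Q2 a b M 0.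
Proof.
move=> nM ndM ndJ nP nal nbe nga ra ab T0 hM hJ Ja Jb le.
pose B (p : V) := (al p.1.1 p.1.2 * U0 phi p + be p.1.1 p.1.2 * Ut phi p
    + ga p.1.1 p.1.2 * Ur phi p) * lapl phi p +
  (al p.1.1 p.1.2 * gradsq phi p + be p.1.1 p.1.2 * grad_t phi p
    + ga p.1.1 p.1.2 * grad_r phi p).
have nB : nice B.
  have m1 := niceM nal (nU0 wave); have m2 := niceM nbe (nUt wave).
  have m3 := niceM nga (nUr wave); have m4 := niceM nal (ngradsq wave).
  have m5 := niceM nbe (ngrad_t wave); have m6 := niceM nga (ngrad_r wave).
  exact: (niceD (niceM (niceD (niceD m1 m2) m3) (nlapl wave)) (niceD (niceD m4 m5) m6)).
have e1 := Q3_dt nM ndM ra T0 hM.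
have e2 := Q3_dr ndJ ra ab hJ Ja Jb.
have e3 : Q3 T a b B = 0.
  refine (@Q3_sphere R n rs T a b B nB ra _) => t r /andP[ar _].
  exact: (sphere_div wave (al t r) (be t r) (ga t r) t (lt_le_trans ra ar)).
have h : Q3 T a b (fun p => dM p + P p) <= Q3 T a b (fun p => dJ p + B p).
  exact: (@Q3_le R n rs T a b _ _ (niceD ndM nP) (niceD ndJ nB) ra le).
move: h; rewrite (Q3D T b ndM nP ra) (Q3D T b ndJ nB ra) e1 e2 e3; lra.
Qed.

End flux.


(** * The energy bound *)

(** Derivative in t or in r of an expression built from radial functions and
   from derivatives of the solution. *)
Ltac der_with_sol rs_gt0 wave rr x0 :=
  lazymatch goal with
  | |- is_derive _ _ (fun _ => ?c) _ => notypeclasses refine (isd_cst _ _ _)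
  | |- is_derive _ _ (fun q => @?f q + @?g q) _ =>
      notypeclasses refine (@isdD _ _ f g _ _ _ _ _ _); der_with_sol rs_gt0 wave rr x0
  | |- is_derive _ _ (fun q => - @?f q) _ =>
      notypeclasses refine (@isdN _ _ f _ _ _ _); der_with_sol rs_gt0 wave rr x0
  | |- is_derive _ _ (fun q => @?f q * @?g q) _ =>
      notypeclasses refine (@isdM _ _ f g _ _ _ _ _ _); der_with_sol rs_gt0 wave rr x0
  | |- is_derive _ _ (fun q => @?f q ^+ ?m.+1) _ =>
      notypeclasses refine (@is_derive_pow _ f m _ _ _); der_with_sol rs_gt0 wave rr x0
  | |- is_derive _ _ (fun q => sc _ _ q) _ => notypeclasses refine (is_derive_sc _ rs_gt0 rr)
  | |- is_derive _ _ (fun q => ir q) _ => notypeclasses refine (is_derive_ir rs_gt0 rr)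
  | |- is_derive _ _ (fun q => zt _ _ q) _ => notypeclasses refine (is_derive_zt _ rs_gt0 rr)
  | |- is_derive _ _ (fun q => lap _ _ q) _ => notypeclasses refine (is_derive_lap _ rs_gt0 rr)
  | |- is_derive _ _ (fun q => vol _ q) _ => notypeclasses refine (is_derive_vol _ rs_gt0 rr)
  | |- is_derive _ _ (fun q => chi _ _ _ _ q) _ => notypeclasses refine (is_derive_chi _ rs_gt0 _ _ rr)
  | |- is_derive _ _ (fun q => U0 _ (q, _, _)) _ => notypeclasses refine (dt_U0 wave _ rr x0)
  | |- is_derive _ _ (fun q => Ut _ (q, _, _)) _ => notypeclasses refine (dt_Ut wave _ rr x0)
  | |- is_derive _ _ (fun q => Ur _ (q, _, _)) _ => notypeclasses refine (dt_Ur wave _ rr x0)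
  | |- is_derive _ _ (fun q => gradsq _ (q, _, _)) _ => notypeclasses refine (dt_gradsq wave _ rr x0)
  | |- is_derive _ _ (fun q => U0 _ (_, q, _)) _ => notypeclasses refine (dr_U0 wave _ rr x0)
  | |- is_derive _ _ (fun q => Ut _ (_, q, _)) _ => notypeclasses refine (dr_Ut wave _ rr x0)
  | |- is_derive _ _ (fun q => Ur _ (_, q, _)) _ => notypeclasses refine (dr_Ur wave _ rr x0)
  | |- is_derive _ _ (fun q => gradsq _ (_, q, _)) _ => notypeclasses refine (dr_gradsq wave _ rr x0)
  | |- _ => idtac
  end.

Section energy_bound.
Context {R : realType} {n : nat} (rs : R) (phi : R -> R -> 'rV[R]_n -> R).
Local Notation V := (R * R * 'rV[R]_n)%type.
Local Notation S := (@sphere R n).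
Local Notation nice := (@nice R n rs).
Local Notation d := (n - 3)%N.
Local Notation K := (d.+2%:R : R).
Local Notation N := (d.+1%:R : R).
Hypothesis rs_gt0 : 0 < rs.
Hypothesis wave : wave_solution rs phi.

(** The density [qen] of the energy with respect to dr and to the measure of the
   unit sphere is [eden] times r^k / F. *)
Definition eden (p : V) : R := Ut phi p ^+ 2 + (lap d rs p.1.2 * Ur phi p) ^+ 2
  + lap d rs p.1.2 * ir p.1.2 ^+ 2 * gradsq phi p.
Definition qen (p : V) : R := vol d p.1.2 * (lap d rs p.1.2)^-1 * eden p.

Lemma qenE p : qen p = vol d p.1.2 * (lap d rs p.1.2)^-1 * eden p.
Proof. by []. Qed.

Lemma nice_eden : nice eden.
Proof. by rewrite /eden; nice_with rs_gt0 wave. Qed.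

Lemma nice_qen : nice qen.
Proof.
refine (niceM (G := fun p => vol d p.1.2 * (lap d rs p.1.2)^-1) _ nice_eden).
by nice_with rs_gt0 wave.
Qed.

Lemma rho_gt0 r : rs < r -> 0 < vol d r * (lap d rs r)^-1.
Proof.
move=> rr; have /andP[l0 _] := lap_bounds d rs_gt0 rr.
by rewrite divr_gt0 // (vol_gt0 d rs_gt0 rr).
Qed.

Lemma eden_ge0 t r w : rs < r -> 0 <= eden (t, r, w).
Proof.
move=> rr; have /andP[l0 _] := lap_bounds d rs_gt0 rr.
rewrite /eden addr_ge0 ?addr_ge0 ?sqr_ge0 //= mulr_ge0 ?gradsq_ge0 //.
by rewrite mulr_ge0 ?sqr_ge0 // ltW.
Qed.

Lemma qen_ge0 t r w : rs < r -> 0 <= qen (t, r, w).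
Proof. by move=> rr; rewrite mulr_ge0 ?eden_ge0 // ltW // rho_gt0. Qed.

Lemma energyE t : energy rs phi t = (\int[slab]_(z in ext2 rs) (qen (t, z.2, z.1))%:E)%E.
Proof.
rewrite -(@ext2_tonelli R n rs qen t nice_qen) => [|r w rr sw]; last exact: qen_ge0.
apply: eq_integral => w; rewrite inE => sw; apply: eq_integral => r; rewrite inE /=.
rewrite in_itv /= andbT => rr; congr EFin.
have /andP[l0 _] := lap_bounds d rs_gt0 rr.
rewrite /qen /eden /= dtE // drE // ang_grad_sqE.
rewrite -[lapse n rs r]/(lap d rs r) -[r ^+ d.+2]/(vol d r).
have -> : r ^- 2 = ir r ^+ 2 by rewrite /ir exprVn.
have l1 : lap d rs r != 0 by rewrite gt_eqF.
rewrite /Ut /Ur /gradsq /Ui /U0.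
move: ('D_e_t _ _) ('D_e_r _ _) (\sum_i _) (ir r) (vol _ _) => A B C y w0.
by field.
Qed.

(** Multiplication by the time derivative, cut off by a function that is
   nonincreasing along all causal directions. *)
Let energy_identity (c dc X w F y s sl ut utt ur utr urr g l gt : R) :
  F != 0 -> X != 0 ->
  utt = F * ((K * y * F + N * s * y) * ur + F * urr + y ^+ 2 * l) ->
  - (dc / X) * (w * F^-1 * (ut ^+ 2 + (F * ur) ^+ 2 + F * y ^+ 2 * g)) +
   c * (w * F^-1 * (2 * (ut * utt) + 2 * F ^+ 2 * (ur * utr) + 2 * F * y ^+ 2 * gt))
   + dc / X * (w * F^-1 * (ut ^+ 2 + (F * ur) ^+ 2 + F * y ^+ 2 * g - 2 * sl * ut * (F * ur)))
  = 2 * (- (dc * (sl / F) / X) * (w * F * ut * ur) +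
      c * (w * y * (K * F + N * s) * ut * ur + w * F * (utr * ur + ut * urr)))
   + (2 * c * w * y ^+ 2 * ut * l + 2 * c * w * y ^+ 2 * gt).
Proof. by move=> F0 X0 ->; move: (K) (N) => k n1; field; rewrite F0 X0. Qed.

Let zero_terms (be u0 ut ur l g gt gr j : R) : j + (be * ut * l + be * gt) <=
  j + ((0 * u0 + be * ut + 0 * ur) * l + (0 * g + be * gt + 0 * gr)).
Proof. by rewrite !mul0r !add0r !addr0. Qed.

Lemma dt_chi (X t r : R) : is_derive t 1 (fun s => chi d rs s X r) (- (dchi d rs t X r / X)).
Proof.
notypeclasses refine (isd_cval _ _).
  notypeclasses refine (isd_comp (is_derive_pp _) _).
  notypeclasses refine (isdD _ _); first exact: isd_cst.
  notypeclasses refine (isdN _).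
  notypeclasses refine (isdM _ _); last exact: isd_cst.
  notypeclasses refine (isdD _ _); first exact: isd_cst.
  exact: is_derive_id.
by rewrite /dchi; move: (dpp _) => D; ring.
Qed.

Variable E : R.
Hypothesis E0 : (energy rs phi 0 <= E%:E)%E.

Lemma data_bound a b : rs < a -> Q2 a b qen 0 <= E.
Proof.
move=> ra; rewrite -lee_fin; apply: le_trans E0; rewrite energyE.
by apply: (@Q2_le_ext R n rs qen 0 a b nice_qen ra) => r w rr sw; exact: qen_ge0.
Qed.

Let dM X (p : V) : R :=
  - (dchi d rs p.1.1 X p.1.2 / X) * (vol d p.1.2 * (lap d rs p.1.2)^-1 *
     (Ut phi p ^+ 2 + (lap d rs p.1.2 * Ur phi p) ^+ 2 + lap d rs p.1.2 * ir p.1.2 ^+ 2 * gradsq phi p)) +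
  chi d rs p.1.1 X p.1.2 * (vol d p.1.2 * (lap d rs p.1.2)^-1 * (2 * (Ut phi p * Utt phi p)
    + 2 * lap d rs p.1.2 ^+ 2 * (Ur phi p * Utr phi p) + 2 * lap d rs p.1.2 * ir p.1.2 ^+ 2 * grad_t phi p)).

Let sl r := lap d rs r - rs * ir r * sc d rs r.

Let J X (p : V) : R := 2 * (chi d rs p.1.1 X p.1.2 * (vol d p.1.2 * lap d rs p.1.2 * Ut phi p * Ur phi p)).

Let dJ X (p : V) : R :=
  2 * (- (dchi d rs p.1.1 X p.1.2 * ((lap d rs p.1.2 - rs * ir p.1.2 * sc d rs p.1.2) / lap d rs p.1.2) / X)
     * (vol d p.1.2 * lap d rs p.1.2 * Ut phi p * Ur phi p) +
  chi d rs p.1.1 X p.1.2 * (vol d p.1.2 * ir p.1.2 * (K * lap d rs p.1.2 + N * sc d rs p.1.2)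
      * Ut phi p * Ur phi p + vol d p.1.2 * lap d rs p.1.2 * (Utr phi p * Ur phi p + Ut phi p * Urr phi p))).

Let P X (p : V) : R := dchi d rs p.1.1 X p.1.2 / X * (vol d p.1.2 * (lap d rs p.1.2)^-1 *
   (Ut phi p ^+ 2 + (lap d rs p.1.2 * Ur phi p) ^+ 2 + lap d rs p.1.2 * ir p.1.2 ^+ 2 * gradsq phi p
     - 2 * (lap d rs p.1.2 - rs * ir p.1.2 * sc d rs p.1.2) * Ut phi p * (lap d rs p.1.2 * Ur phi p))).

(* The sign of the cutoff error: e - 2 l Ut (F Ur) >= 0 for |l| <= 1. *)
Let P_ge0 X t r w : 0 < X -> rs < r -> 0 <= P X (t, r, w).
Proof.
move=> X0 rr; rewrite /P /=; apply: mulr_ge0; first by rewrite divr_ge0 ?dchi_ge0 // ltW.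
apply: mulr_ge0; first by rewrite ltW // rho_gt0.
have h := exhaust_slope d rs_gt0 rr; have /andP[l0 _] := lap_bounds d rs_gt0 rr.
have : 0 <= lap d rs r * ir r ^+ 2 * gradsq phi (t, r, w).
  by rewrite mulr_ge0 ?gradsq_ge0 // mulr_ge0 ?sqr_ge0 // ltW.
move: h; rewrite -/(sl r).
move: (sl r) (Ut phi _) (lap d rs r * Ur phi _) (_ * gradsq _ _) => s u v g.
rewrite ler_norml => /andP[s1 s2] g0.
have e : u ^+ 2 + v ^+ 2 + g - 2 * s * u * v =
  ((1 + s) * (u - v) ^+ 2 + (1 - s) * (u + v) ^+ 2) / 2 + g by field.
by rewrite e addr_ge0 // divr_ge0 // addr_ge0 // mulr_ge0 ?sqr_ge0 //; lra.
Qed.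

Let M X (p : V) : R := chi d rs p.1.1 X p.1.2 * qen p.

Let hM (X t r : R) (w : 'rV[R]_n) : rs < r -> S w ->
  is_derive t 1 (fun s => M X (s, r, w)) (dM X (t, r, w)).
Proof.
move=> rr sw; have x0 := sphere_neq0 sw.
rewrite /M /qen /eden /dM; cbv beta; rewrite /=.
notypeclasses refine (isd_cval _ _).
  notypeclasses refine (@isdM _ _ (fun s => chi d rs s X r) _ _ _ _ _ (dt_chi X t r) _).
  by der_with_sol rs_gt0 wave rr x0.
cbv beta.
move: (Ut phi (t, r, w)) (Utt phi (t, r, w)) (Ur phi (t, r, w)) (Utr phi (t, r, w)) => a1 a2 a3 a4.
move: (gradsq phi (t, r, w)) (grad_t phi (t, r, w)) => a5 a6.
ring.
Qed.

Let hJ (X t r : R) (w : 'rV[R]_n) : rs < r -> S w ->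
  is_derive r 1 (fun s => J X (t, s, w)) (dJ X (t, r, w)).
Proof.
move=> rr sw; have x0 := sphere_neq0 sw.
rewrite /J /dJ; cbv beta; rewrite /=.
notypeclasses refine (isd_cval _ _); first by der_with_sol rs_gt0 wave rr x0.
cbv beta.
move: (Ut phi (t, r, w)) (Urr phi (t, r, w)) (Ur phi (t, r, w)) (Utr phi (t, r, w)) => a1 a2 a3 a4.
ring.
Qed.

(** No energy enters through the boundary of the support of the cutoff, which
   recedes at the speed of light. *)
Theorem energy_bound T a b : 0 <= T -> rs < a -> a <= b -> Q2 a b qen T <= E.
Proof.
move=> T0; apply: (uncut2 (d := d) rs_gt0 nice_qen T0 (D := 0)) => [r w rr sw|]; first exact: qen_ge0.
move=> X {}a {}b X1 ra ab hp; have X0 : 0 < X by lra.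
rewrite mul0r addr0.
have nM : nice (M X) by refine (niceM (@nice_chi_t _ _ _ _ rs_gt0 X) nice_qen).
have ndM : nice (dM X) by rewrite /dM; nice_with rs_gt0 wave.
have ndJ : nice (dJ X) by rewrite /dJ; nice_with rs_gt0 wave.
have nP : nice (P X) by rewrite /P; nice_with rs_gt0 wave.
have nb : nice (fun p => 2 * chi d rs p.1.1 X p.1.2 * vol d p.1.2 * ir p.1.2 ^+ 2).
  by nice_with rs_gt0 wave.
have b0 := lt_le_trans ra ab.
have JX (t r : R) (w : 'rV[R]_n) : 0 <= t -> rs < r -> ~~ (a < r < b) -> J X (t, r, w) = 0.
  move=> t0 rr nr; rewrite /J /= chi_eq0 ?mul0r ?mulr0 //.
  have : ~~ (exhaust d rs r < X) by apply: contra nr; exact: hp.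
  by rewrite -leNgt => h; apply: (le_trans h); rewrite lerDl.
have H : Q2 a b (M X) T + Q3 T a b (P X) <= Q2 a b (M X) 0.
  refine (@flux_balance R n rs phi wave T a b (M X) (dM X) (J X) (dJ X) (P X) (fun _ _ => 0)
    (fun t r => 2 * chi d rs t X r * vol d r * ir r ^+ 2) (fun _ _ => 0)
    nM ndM ndJ nP (@nice_cst _ _ _ 0) nb (@nice_cst _ _ _ 0) ra ab T0 _ _ _ _ _).
  - by move=> t r w /andP[ar _] sw; apply: hM => //; exact: lt_le_trans ar.
  - by move=> t r w /andP[ar _] sw; apply: hJ => //; exact: lt_le_trans ar.
  - by move=> t w /andP[t0 _] sw; apply: JX => //; rewrite ltxx.
  - by move=> t w /andP[t0 _] sw; apply: JX => //; rewrite ltxx andbF.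
  - move=> t r w _ /andP[ar _] sw; have rr := lt_le_trans ra ar.
    have /andP[l0 _] := lap_bounds d rs_gt0 rr.
    have I := @energy_identity (chi d rs t X r) (dchi d rs t X r) X (vol d r) (lap d rs r)
      (ir r) (sc d rs r) (sl r) (Ut phi (t, r, w)) (Utt phi (t, r, w)) (Ur phi (t, r, w))
      (Utr phi (t, r, w)) (Urr phi (t, r, w)) (gradsq phi (t, r, w)) (lapl phi (t, r, w))
      (grad_t phi (t, r, w)) (lt0r_neq0 l0) (lt0r_neq0 X0) (wave_eq rs_gt0 wave t rr sw).
    lazymatch type of I with ?l = _ => change (l <= dJ X (t, r, w) +
      ((0 * U0 phi (t, r, w) + 2 * chi d rs t X r * vol d r * ir r ^+ 2 * Ut phi (t, r, w)
        + 0 * Ur phi (t, r, w)) * lapl phi (t, r, w) + (0 * gradsq phi (t, r, w)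
        + 2 * chi d rs t X r * vol d r * ir r ^+ 2 * grad_t phi (t, r, w)
        + 0 * grad_r phi (t, r, w)))) end.
    by rewrite I; exact: zero_terms.
have hP : 0 <= Q3 T a b (P X).
  apply: Rintegral_ge0 => -[t [w r]] [/= _ [/= sw]]; rewrite /itv /= in_itv /= => /andP[ar _].
  by apply: P_ge0 => //; exact: lt_le_trans ar.
have h0 : Q2 a b (M X) 0 <= Q2 a b qen 0.
  apply: (@Q2_le R n rs a b _ _ 0 0 nM nice_qen ra) => r w /andP[ar _] sw.
  have rr := lt_le_trans ra ar.
  by rewrite /M /= ler_piMl ?qen_ge0 // (chi_le1 d rs_gt0).
have h1 : Q2 a b (fun p => chi d rs T X p.1.2 * qen p) T <= Q2 a b (M X) T.
  apply: (@Q2_le R n rs a b _ _ T T _ nM ra) => [|r w _ _]; last exact: lexx.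
  exact: (niceM (@nice_chi _ _ _ _ rs_gt0 _ _) nice_qen).
apply: (le_trans h1); apply: (le_trans _ (data_bound b ra)); apply: (le_trans _ h0).
by apply: (le_trans _ H); rewrite lerDl.
Qed.

End energy_bound.


(** * The Hardy weight *)

Section hardy_weight.
Context {R : realType} (d : nat) (rs : R).
Hypothesis rs_gt0 : 0 < rs.
Local Notation N := (d.+1%:R : R).
Local Notation K := (d.+2%:R : R).

(** The Hardy weight, the density that it controls, and its derivative, for
   which [hardy_pointwise] uses F + s z >= z. *)
Definition hh r : R := vol d r * ir r * zt d rs r.
Definition rho_h r : R := vol d r * (lap d rs r)^-1 * (ir r ^+ 2 * zt d rs r ^+ 2).
Definition dhh r : R := N * (vol d r * ir r ^+ 2 * zt d rs r)
  * (lap d rs r + sc d rs r * zt d rs r) / lap d rs r.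

Lemma is_derive_hh (r : R) : rs < r -> is_derive r 1 hh (dhh r).
Proof.
move=> rr; have /andP[l0 _] := lap_bounds d rs_gt0 rr.
have F0 : lap d rs r != 0 by rewrite gt_eqF.
have h1 := isdM (isdM (is_derive_vol d rs_gt0 rr) (is_derive_ir rs_gt0 rr)) (is_derive_zt d rs_gt0 rr).
notypeclasses refine (isd_cval h1 _); rewrite /dhh natN; cbv beta.
by move: (K) => k; field.
Qed.

Lemma rho_h_gt0 (r : R) : rs < r -> 0 < rho_h r.
Proof.
move=> rr; have /andP[l0 _] := lap_bounds d rs_gt0 rr.
have /andP[z0 _] := zt_bounds d rs_gt0 rr.
apply: mulr_gt0; first by rewrite divr_gt0 // (vol_gt0 d rs_gt0 rr).
by rewrite mulr_gt0 ?exprn_gt0 // (ir_gt0 rs_gt0 rr).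
Qed.

(** The weighted Hardy inequality before integration: after completing the
   square, half of the derivative of the weight controls the weight
   [rho_h]. *)
Lemma hardy_pointwise (r v vr : R) : rs < r ->
  N / 2 * (rho_h r * v ^+ 2) <=
  dhh r * v ^+ 2 + 2 * hh r * v * vr + 2 / N * (vol d r * lap d rs r * vr ^+ 2).
Proof.
move=> rr; have /andP[l0 l1] := lap_bounds d rs_gt0 rr.
have /andP[z0 z1] := zt_bounds d rs_gt0 rr; have w0 := vol_gt0 d rs_gt0 rr.
have N0 : 0 < N by rewrite ltr0n.
have y0 := ir_gt0 rs_gt0 rr.
have h : N * rho_h r <= dhh r.
  have -> : dhh r = N * (vol d r * ir r ^+ 2 * zt d rs r / lap d rs r)
    * (lap d rs r + sc d rs r * zt d rs r) by rewrite /dhh; ring.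
  have -> : N * rho_h r = N * (vol d r * ir r ^+ 2 * zt d rs r / lap d rs r) * zt d rs r.
    by rewrite /rho_h; ring.
  apply: ler_wpM2l.
    by rewrite mulr_ge0 ?ltW // divr_gt0 // mulr_gt0 // mulr_gt0 // exprn_gt0.
  have -> : sc d rs r = 1 - lap d rs r by rewrite /lap; ring.
  have : 0 <= lap d rs r * (1 - zt d rs r) by rewrite mulr_ge0 ?(ltW l0) // subr_ge0.
  lra.
have sq : 0 <= vol d r / (2 * lap d rs r * N) * (N * ir r * zt d rs r * v + 2 * lap d rs r * vr) ^+ 2.
  by rewrite mulr_ge0 ?sqr_ge0 // divr_ge0 ?ltW // mulr_gt0 // mulr_gt0.
have e : vol d r / (2 * lap d rs r * N) * (N * ir r * zt d rs r * v + 2 * lap d rs r * vr) ^+ 2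
  = N / 2 * (rho_h r * v ^+ 2) + 2 * hh r * v * vr + 2 / N * (vol d r * lap d rs r * vr ^+ 2).
  rewrite /rho_h /hh.
  have F0 : lap d rs r != 0 by rewrite gt_eqF.
  have N1 : N != 0 by rewrite gt_eqF.
  by move: N1; move: (N) => k k0; field; rewrite F0 k0.
rewrite e in sq; have := ler_wpM2r (sqr_ge0 v) h; move: sq.
move: (rho_h r) (dhh r) (hh r) (2 / N * _) => A B C D; lra.
Qed.

End hardy_weight.

Section ray_integrals.
Context {R : realType} {n : nat} (rs : R).
Local Notation V := (R * R * 'rV[R]_n)%type.
Local Notation S := (@sphere R n).
Local Notation nice := (@nice R n rs).
Variables (t : R) (w : 'rV[R]_n).
Hypothesis sw : S w.

Definition Q1 (a b : R) (G : V -> R) : R := (\int[leb]_(r in itv a b) G (t, r, w))%R.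

Lemma ray_integrable a b G : nice G -> rs < a ->
  leb.-integrable (itv a b) (EFin \o (fun r => G (t, r, w))).
Proof.
move=> nG ra; apply: continuous_compact_integrable; first exact: segment_compact.
apply: continuous_in_subspaceT => r; rewrite inE /itv /= in_itv /= => /andP[ar _].
exact: (@nice_slice_r R n rs G r w t nG (lt_le_trans ra ar) sw).
Qed.

Lemma EFin_Q1 a b G : nice G -> rs < a ->
  (Q1 a b G)%:E = (\int[leb]_(r in itv a b) (G (t, r, w))%:E)%E.
Proof.
move=> nG ra; rewrite fineK //; apply: integrable_fin_num; last exact: ray_integrable.
exact: measurable_itvR.
Qed.

Lemma Q1_le a b G H : nice G -> nice H -> rs < a ->
  (forall r, a <= r <= b -> G (t, r, w) <= H (t, r, w)) -> Q1 a b G <= Q1 a b H.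
Proof.
move=> nG nH ra le; apply: le_Rintegral.
- exact: measurable_itvR.
- exact: ray_integrable.
- exact: ray_integrable.
- by move=> r; rewrite /itv /= in_itv /=; exact: le.
Qed.

Lemma Q1D a b G H : nice G -> nice H -> rs < a ->
  Q1 a b (fun p => G p + H p) = Q1 a b G + Q1 a b H.
Proof.
move=> nG nH ra; apply: RintegralD.
- exact: measurable_itvR.
- exact: ray_integrable.
- exact: ray_integrable.
Qed.

Lemma Q1Z a b G (c : R) : nice G -> rs < a -> Q1 a b (fun p => c * G p) = c * Q1 a b G.
Proof.
move=> nG ra; apply: RintegralZl; first exact: measurable_itvR.
exact: ray_integrable.
Qed.

Lemma Q1_sub a b b' G : nice G -> rs < a -> b <= b' ->
  (forall r, rs < r -> 0 <= G (t, r, w)) -> Q1 a b G <= Q1 a b' G.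
Proof.
move=> nG ra bb G0; rewrite -lee_fin !EFin_Q1 //; apply: ge0_subset_integral.
- exact: measurable_itvR.
- exact: measurable_itvR.
- by apply: measurable_int; exact: (ray_integrable b' nG ra).
- move=> r; rewrite /itv /= in_itv /= => /andP[ar _]; rewrite lee_fin; apply: G0.
  exact: lt_le_trans ar.
- move=> r; rewrite /itv /= !in_itv /= => /andP[-> h] /=; exact: le_trans bb.
Qed.

Lemma Q1_dr a b J dJ : nice dJ -> rs < a -> a <= b ->
  (forall r : R, a <= r <= b -> is_derive r 1 (fun s => J (t, s, w)) (dJ (t, r, w))) ->
  Q1 a b dJ = J (t, b, w) - J (t, a, w).
Proof.
move=> ndJ ra ab h; apply: EFin_inj; rewrite EFin_Q1 //.
have h2 (r : R) : a <= r <= b -> {for r, continuous (fun r => dJ (t, r, w))}.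
  by move=> /andP[r1 _]; exact: (@nice_slice_r R n rs dJ r w t ndJ (lt_le_trans ra r1) sw).
exact: (ftc_segment ab h h2).
Qed.

End ray_integrals.


(** * The Hardy inequality for the data *)

Section hardy.
Context {R : realType} {n : nat} (rs : R) (phi : R -> R -> 'rV[R]_n -> R).
Local Notation V := (R * R * 'rV[R]_n)%type.
Local Notation S := (@sphere R n).
Local Notation nice := (@nice R n rs).
Local Notation d := (n - 3)%N.
Local Notation N := (d.+1%:R : R).
Local Notation qen := (qen rs phi).
Hypothesis rs_gt0 : 0 < rs.
Hypothesis wave : wave_solution rs phi.

Let N0 : 0 < N. Proof. by rewrite ltr0n. Qed.
Let N1 : 1 <= N. Proof. by rewrite ler1n. Qed.

Lemma nice_rho_h : nice (fun p => rho_h d rs p.1.2).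
Proof. by rewrite /rho_h; nice_with rs_gt0 wave. Qed.

Lemma nice_hh : nice (fun p => hh d rs p.1.2).
Proof. by rewrite /hh; nice_with rs_gt0 wave. Qed.

Lemma nice_dhh : nice (fun p => dhh d rs p.1.2).
Proof. by rewrite /dhh; nice_with rs_gt0 wave. Qed.

Lemma radial_energy_le t r w : rs < r ->
  vol d r * lap d rs r * Ur phi (t, r, w) ^+ 2 <= qen (t, r, w).
Proof.
move=> rr; have /andP[l0 _] := lap_bounds d rs_gt0 rr.
have r0 := rho_gt0 rs_gt0 rr.
rewrite /qen /eden /=.
have -> : vol d r * lap d rs r * Ur phi (t, r, w) ^+ 2 =
   vol d r * (lap d rs r)^-1 * (lap d rs r * Ur phi (t, r, w)) ^+ 2.
  have F0 : lap d rs r != 0 by rewrite gt_eqF.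
  by move: (Ur phi (t, r, w)) => u; field.
apply: ler_wpM2l; first exact: ltW.
rewrite -addrA addrCA lerDl addr_ge0 ?sqr_ge0 // mulr_ge0 ?gradsq_ge0 //.
by rewrite mulr_ge0 ?sqr_ge0 // ltW.
Qed.

Lemma time_energy_le t r w : rs < r ->
  vol d r * (lap d rs r)^-1 * Ut phi (t, r, w) ^+ 2 <= qen (t, r, w).
Proof.
move=> rr; have /andP[l0 _] := lap_bounds d rs_gt0 rr.
apply: ler_wpM2l; first by rewrite ltW // rho_gt0.
rewrite /eden /= -addrA lerDl addr_ge0 ?sqr_ge0 // mulr_ge0 ?gradsq_ge0 //.
by rewrite mulr_ge0 ?sqr_ge0 // ltW.
Qed.

Section one_ray.
Variables (w : 'rV[R]_n).
Hypothesis sw : S w.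

(* Integrating from a to a far radius b and subtracting the value at b, the
   boundary term at b vanishes and the one at a has the good sign. *)
Let ray_segment a b : rs < a -> a <= b ->
  N / 2 * Q1 0 w a b (fun p => rho_h d rs p.1.2 * (U0 phi p - U0 phi (0, b, w)) ^+ 2)
  <= 2 / N * Q1 0 w a b (fun p => vol d p.1.2 * lap d rs p.1.2 * Ur phi p ^+ 2).
Proof.
move=> ra ab; pose c := U0 phi (0, b, w).
pose G (p : V) := rho_h d rs p.1.2 * (U0 phi p - c) ^+ 2.
pose H (p : V) := vol d p.1.2 * lap d rs p.1.2 * Ur phi p ^+ 2.
pose J (p : V) := hh d rs p.1.2 * (U0 phi p - c) ^+ 2.
pose dJ (p : V) := dhh d rs p.1.2 * (U0 phi p - c) ^+ 2 +
   2 * hh d rs p.1.2 * (U0 phi p - c) * Ur phi p.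
have nv : nice (fun p => U0 phi p - c) by nice_with rs_gt0 wave.
have nG : nice G by rewrite /G /rho_h; nice_with rs_gt0 wave.
have nH : nice H by rewrite /H; nice_with rs_gt0 wave.
have ndJ : nice dJ by rewrite /dJ /dhh /hh; nice_with rs_gt0 wave.
have hJ (r : R) : a <= r <= b -> is_derive r 1 (fun s => J (0, s, w)) (dJ (0, r, w)).
  move=> /andP[ar _]; have rr := lt_le_trans ra ar; have x0 := sphere_neq0 sw.
  rewrite /J /dJ /=; notypeclasses refine (isd_cval _ _).
    notypeclasses refine (isdM (is_derive_hh d rs_gt0 rr) _).
    by der_with_sol rs_gt0 wave rr x0.
  cbv beta; move: (U0 phi (0, r, w)) (Ur phi (0, r, w)) => u v; ring.
have e := Q1_dr sw ndJ ra ab hJ.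
have le : Q1 0 w a b (fun p => N / 2 * G p) <= Q1 0 w a b (fun p => dJ p + 2 / N * H p).
  apply: (@Q1_le R n rs 0 w sw a b _ _ _ _ ra) => [||r /andP[ar _]].
  - by rewrite /G /rho_h; nice_with rs_gt0 wave.
  - by rewrite /dJ /H /hh /dhh; nice_with rs_gt0 wave.
  - exact: (hardy_pointwise d rs_gt0 _ _ (lt_le_trans ra ar)).
rewrite -(Q1Z 0 sw b (N / 2) nG ra); apply: (le_trans le).
have nH2 : nice (fun p => 2 / N * H p) by rewrite /H; nice_with rs_gt0 wave.
rewrite (Q1D 0 sw b ndJ nH2 ra) (Q1Z 0 sw b (2 / N) nH ra) e.
rewrite gerDr /J /= subrr expr0n mulr0 sub0r oppr_le0.
rewrite mulr_ge0 ?sqr_ge0 // /hh mulr_ge0 //; last first.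
  by have /andP[/ltW] := zt_bounds d rs_gt0 ra.
by rewrite mulr_ge0 ?ltW // ?(vol_gt0 d rs_gt0 ra) ?(ir_gt0 rs_gt0 ra).
Qed.

Let combine (k i e x y c z : R) : k / 4 * x <= i -> k / 4 * c * z <= e -> 0 <= k / 8 ->
  y <= 2 * x + 2 * c * z -> k / 8 * y <= i + e.
Proof. by move=> h1 h2 h3 /(ler_wpM2l h3); lra. Qed.

(* The values at far radii tend to 0, so the constants subtracted in the
   previous estimate disappear in the limit. *)
Let ray_bound a b (i : R) : rs < a -> a <= b ->
  phi 0 r w @[r --> +oo] --> 0 ->
  (forall b', a <= b' -> Q1 0 w a b' (fun p => vol d p.1.2 * lap d rs p.1.2 * Ur phi p ^+ 2) <= i) ->
  N ^+ 2 / 8 * Q1 0 w a b (fun p => rho_h d rs p.1.2 * U0 phi p ^+ 2) <= i.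
Proof.
move=> ra ab lim hi.
pose Z := Q1 0 w a b (fun p => rho_h d rs p.1.2).
have Z0 : 0 <= Z.
  apply: Rintegral_ge0 => r; rewrite /itv /= in_itv /= => /andP[ar _].
  by apply/ltW/rho_h_gt0 => //; exact: lt_le_trans ar.
apply/ler_addgt0Pr => e e0.
pose del := e / (N ^+ 2 / 4 * Z + 1).
have den0 : 0 < N ^+ 2 / 4 * Z + 1.
  by rewrite ltr_wpDl // mulr_ge0 // divr_ge0 // sqr_ge0.
have del0 : 0 < del by rewrite divr_gt0.
have [B hB] : exists2 B : R, b <= B & phi 0 B w ^+ 2 <= del.
  have h : (phi 0 r w) ^+ 2 @[r --> +oo] --> (0 : R).
    have := cvgM lim lim; rewrite mulr0.
    have -> : (fun r => phi 0 r w ^+ 2) = (fun r => phi 0 r w) \* (fun r => phi 0 r w).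
      by apply/funext => r; rewrite expr2.
    exact.
  have : \forall r \near +oo, `|0 - phi 0 r w ^+ 2| < del.
    by move/cvgrPdist_lt : h => /(_ _ del0).
  move=> [M [_ hM]]; exists (Num.max b (M + 1)); first by rewrite le_max lexx.
  have /hM : M < Num.max b (M + 1) by rewrite lt_max ltrDl ltr01 orbT.
  by rewrite sub0r normrN => /ltW; apply: le_trans; exact: ler_norm.
move=> hdel.
have aB := le_trans ab hB.
pose c := U0 phi (0, B, w).
have cE : c = phi 0 B w by exact: ray_ext_sphere.
pose G (p : V) := rho_h d rs p.1.2 * (U0 phi p - c) ^+ 2.
have nv : nice (fun p => U0 phi p - c) by nice_with rs_gt0 wave.
have nG : nice G by rewrite /G /rho_h; nice_with rs_gt0 wave.
have h1 := ray_segment ra aB.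
have h2 : Q1 0 w a b G <= Q1 0 w a B G.
  apply: (Q1_sub sw nG ra hB) => r rr; rewrite mulr_ge0 ?sqr_ge0 //.
  exact/ltW/rho_h_gt0.
have nG2 : nice (fun p => 2 * G p) by rewrite /G /rho_h; nice_with rs_gt0 wave.
have nZ2 : nice (fun p => 2 * c ^+ 2 * rho_h d rs p.1.2).
  by rewrite /rho_h; nice_with rs_gt0 wave.
have h3 : Q1 0 w a b (fun p => rho_h d rs p.1.2 * U0 phi p ^+ 2) <= 2 * Q1 0 w a b G + 2 * c ^+ 2 * Z.
  rewrite -(Q1Z 0 sw b 2 nG ra) -(Q1Z 0 sw b (2 * c ^+ 2) nice_rho_h ra).
  rewrite -(Q1D 0 sw b nG2 nZ2 ra); apply: (@Q1_le R n rs 0 w sw a b _ _ _ _ ra) => [||r /andP[ar _]].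
  - by rewrite /rho_h; nice_with rs_gt0 wave.
  - by rewrite /G /rho_h; nice_with rs_gt0 wave.
  - rewrite /G /=; have := rho_h_gt0 d rs_gt0 (lt_le_trans ra ar).
    move: (rho_h d rs r) (U0 phi (0, r, w)) => x u x0.
    have : 0 <= x * (u - 2 * c) ^+ 2 by rewrite mulr_ge0 ?sqr_ge0 // ltW.
    have -> : x * (u - 2 * c) ^+ 2 = 2 * (x * (u - c) ^+ 2) + 2 * c ^+ 2 * x - x * u ^+ 2 by ring.
    by rewrite subr_ge0.
have h4 : N ^+ 2 / 4 * Q1 0 w a b G <= i.
  apply: (le_trans _ (hi B aB)).
  rewrite -(ler_pM2l (x := 2 / N)) ?divr_gt0 //; apply: (le_trans _ h1).
  have -> : 2 / N * (N ^+ 2 / 4 * Q1 0 w a b G) = N / 2 * Q1 0 w a b G.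
    have NN : N != 0 by rewrite gt_eqF.
    by move: NN; move: (N) => k k0; field.
  by rewrite ler_pM2l // divr_gt0.
have h5 : N ^+ 2 / 4 * c ^+ 2 * Z <= e.
  have k0 : 0 <= N ^+ 2 / 4 * Z by rewrite mulr_ge0 // divr_ge0 // sqr_ge0.
  have : c ^+ 2 * (N ^+ 2 / 4 * Z) <= del * (N ^+ 2 / 4 * Z) by rewrite cE ler_wpM2r.
  have : del * (N ^+ 2 / 4 * Z + 1) = e by rewrite /del divfK ?gt_eqF.
  have := ltW del0; clear; move: (N ^+ 2 / 4) => k; rewrite mulrDr mulr1; lra.
have k0 : 0 <= N ^+ 2 / 8 by rewrite divr_ge0 // sqr_ge0.
exact: (combine h4 h5 k0 h3).
Qed.

(** The Hardy inequality at the initial time on a single ray; it is here that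
   the decay of the data at infinity enters. *)
Lemma hardy_ray a b : rs < a -> a <= b -> phi 0 r w @[r --> +oo] --> 0 ->
  (\int[leb]_(r in itv a b) (N ^+ 2 / 8 * (rho_h d rs r * U0 phi (0, r, w) ^+ 2))%:E <=
   \int[leb]_(r in `]rs, +oo[) (qen (0, r, w))%:E)%E.
Proof.
move=> ra ab lim.
pose G (p : V) := rho_h d rs p.1.2 * U0 phi p ^+ 2.
have nG : nice G by rewrite /G /rho_h; nice_with rs_gt0 wave.
have nG2 : nice (fun p => N ^+ 2 / 8 * G p) by rewrite /G /rho_h; nice_with rs_gt0 wave.
rewrite -(EFin_Q1 0 sw b nG2 ra) (Q1Z 0 sw b _ nG ra).
have I0 : (0 <= \int[leb]_(r in `]rs, +oo[) (qen (0, r, w))%:E)%E.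
  apply: integral_ge0 => r /=; rewrite in_itv /= andbT => rr; rewrite lee_fin.
  exact: qen_ge0.
have [/fineK E|] := boolP ((\int[leb]_(r in `]rs, +oo[) (qen (0, r, w))%:E)%E \is a fin_num); last first.
  by rewrite ge0_fin_numE // -leNgt leye_eq => /eqP ->; rewrite leey.
rewrite -E lee_fin; apply: ray_bound => // b' ab'.
have nH : nice (fun p => vol d p.1.2 * lap d rs p.1.2 * Ur phi p ^+ 2).
  by nice_with rs_gt0 wave.
have nQ := nice_qen rs_gt0 wave.
rewrite -lee_fin E (EFin_Q1 0 sw b' nH ra).
apply: (@le_trans _ _ (\int[leb]_(r in itv a b') (qen (0, r, w))%:E)%E).
  rewrite -(EFin_Q1 0 sw b' nH ra) -(EFin_Q1 0 sw b' nQ ra).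
  rewrite lee_fin; apply: (@Q1_le R n rs 0 w sw a b' _ _ nH nQ ra) => r /andP[ar _].
  by apply: radial_energy_le; exact: lt_le_trans ar.
apply: ge0_subset_integral.
- exact: measurable_itvR.
- exact: measurable_itv.
- apply/measurable_EFinP; apply: open_continuous_measurable_fun; first exact: interval_open.
  move=> r; rewrite inE /= in_itv /= andbT => rr.
  exact: (@nice_slice_r R n rs qen r w 0 nQ rr sw).
- by move=> r /=; rewrite in_itv /= andbT => rr; rewrite lee_fin; exact: (qen_ge0 _ rs_gt0).
- by move=> r; rewrite /itv /= !in_itv /= andbT => /andP[ar _]; exact: lt_le_trans ar.
Qed.

End one_ray.
End hardy.


(** * The Hardy inequality at later times *)

Section hardy_in_time.
Context {R : realType} {n : nat} (rs : R) (phi : R -> R -> 'rV[R]_n -> R).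
Local Notation V := (R * R * 'rV[R]_n)%type.
Local Notation S := (@sphere R n).
Local Notation nice := (@nice R n rs).
Local Notation d := (n - 3)%N.
Local Notation N := (d.+1%:R : R).
Local Notation qen := (qen rs phi).
Hypothesis rs_gt0 : 0 < rs.
Hypothesis wave : wave_solution rs phi.
Variable E : R.
Hypothesis E0 : (energy rs phi 0 <= E%:E)%E.
Hypothesis decay : vanishes_at_infinity (phi 0).

Let N1 : 1 <= N. Proof. by rewrite ler1n. Qed.
Let N0 : 0 < N. Proof. by rewrite ltr0n. Qed.

Let E_ge0 : 0 <= E.
Proof.
rewrite -lee_fin; apply: le_trans E0; rewrite energyE //.
apply: integral_ge0 => -[w r] [/= _]; rewrite in_itv /= andbT => rr.
by rewrite lee_fin; exact: qen_ge0.
Qed.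

Lemma hardy_data a b : rs < a -> a <= b ->
  Q2 a b (fun p => rho_h d rs p.1.2 * U0 phi p ^+ 2) 0 <= 8 / N ^+ 2 * E.
Proof.
move=> ra ab.
pose G (p : V) := rho_h d rs p.1.2 * U0 phi p ^+ 2.
have nG : nice G by rewrite /G /rho_h; nice_with rs_gt0 wave.
have nG2 : nice (fun p => N ^+ 2 / 8 * G p) by rewrite /G /rho_h; nice_with rs_gt0 wave.
have nQ := nice_qen rs_gt0 wave.
have k0 : 0 < N ^+ 2 / 8 by rewrite divr_gt0 // exprn_gt0.
have h : N ^+ 2 / 8 * Q2 a b G 0 <= E.
  rewrite -(Q2Z b 0 (N ^+ 2 / 8) nG ra) -lee_fin; apply: le_trans E0; rewrite energyE //.
  apply: (@Q2_le_rays R n rs _ _ 0 a b nG2 nQ ra).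
  - move=> r w rr sw; rewrite mulr_ge0 ?(ltW k0) // mulr_ge0 ?sqr_ge0 //.
    exact/ltW/rho_h_gt0.
  - by move=> r w rr sw; exact: qen_ge0.
  - apply: filterS decay => w lim sw.
    exact: (hardy_ray rs_gt0 wave sw ra ab (lim sw)).
have -> : 8 / N ^+ 2 = (N ^+ 2 / 8)^-1 by rewrite invf_div.
by rewrite ler_pdivlMl.
Qed.

Let v (p : V) : R := U0 phi p - U0 phi (0, p.1.2, p.2).

Let nv : nice v.
Proof. exact: (niceD (nU0 wave) (niceN (nice_at0 (nU0 wave)))). Qed.

Let rho r : R := vol d r * (lap d rs r)^-1.

(** The change of the solution since the initial time is square integrable:
   the weight T + 1 - t absorbs the square that d/dt (v^2) = 2 v Ut produces. *)
Lemma growth (T a b : R) : 0 <= T -> rs < a -> a <= b ->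
  Q2 a b (fun p => rho p.1.2 * v p ^+ 2) T <= (T + 1) ^+ 2 * E * T.
Proof.
move=> T0 ra ab.
pose M (p : V) := (T + 1 - p.1.1) * (rho p.1.2 * v p ^+ 2).
pose dM (p : V) := rho p.1.2 * ((T + 1 - p.1.1) * (2 * (v p * Ut phi p)) - v p ^+ 2).
pose H (p : V) := (T + 1) ^+ 2 * qen p.
have nr : nice (fun p => rho p.1.2) by rewrite /rho; nice_with rs_gt0 wave.
have nv2 : nice (fun p => v p ^+ 2) := niceX nv.
have nt : nice (fun p : V => T + 1 - p.1.1) by nice_with rs_gt0 wave.
have nM : nice M := niceM nt (niceM nr nv2).
have n2 : nice (fun p => 2 * (v p * Ut phi p)).
  exact: (niceM (@nice_cst _ _ _ 2) (niceM nv (nUt wave))).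
have ndM : nice dM := niceM nr (niceD (niceM nt n2) (niceN nv2)).
have nQ := nice_qen rs_gt0 wave.
have nH : nice H := niceM (@nice_cst _ _ _ _) nQ.
have hM (t r : R) (w : 'rV[R]_n) : a <= r <= b -> S w ->
    is_derive t 1 (fun s => M (s, r, w)) (dM (t, r, w)).
  move=> /andP[ar _] sw; have rr := lt_le_trans ra ar; have x0 := sphere_neq0 sw.
  rewrite /M /dM /v /=; notypeclasses refine (isd_cval _ _).
    notypeclasses refine (isdM _ _).
      notypeclasses refine (isdD (isd_cst _ _ _) _); notypeclasses refine (isdN _).
      exact: is_derive_id.
    by der_with_sol rs_gt0 wave rr x0.
  cbv beta; move: (U0 phi (0, r, w)) (U0 phi (t, r, w)) (Ut phi (t, r, w)) (rho r) => u0 u1 u2 x; ring.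
have e := Q3_dt nM ndM ra T0 hM.
have h1 : Q3 T a b dM <= Q3 T a b H.
  apply: (@Q3_le R n rs T a b _ _ ndM nH ra) => t r w /andP[t0 tT] /andP[ar _] sw.
  have rr := lt_le_trans ra ar.
  have h := time_energy_le phi rs_gt0 t w rr.
  apply: (@le_trans _ _ ((T + 1) ^+ 2 * (rho r * Ut phi (t, r, w) ^+ 2))); last first.
    by rewrite /H ler_wpM2l // sqr_ge0.
  have r0 : 0 <= rho r by rewrite ltW // rho_gt0.
  rewrite /dM /= [leRHS]mulrCA; apply: ler_wpM2l => //.
  move: (v _) (Ut phi _) => x u.
  have : 0 <= (x - (T + 1 - t) * u) ^+ 2 by exact: sqr_ge0.
  have : (T + 1 - t) ^+ 2 <= (T + 1) ^+ 2 by rewrite lerXn2r ?nnegrE; lra.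
  move=> /(ler_wpM2r (sqr_ge0 u)).
  have -> : (x - (T + 1 - t) * u) ^+ 2 = x ^+ 2 - (T + 1 - t) * (2 * (x * u))
    + (T + 1 - t) ^+ 2 * u ^+ 2 by ring.
  by move=> h1 h2; lra.
have h2 : Q3 T a b H <= (T + 1) ^+ 2 * E * T.
  apply: (@Q3_le_time R n rs T a b H _ nH ra T0) => [t r w _ /andP[ar _] sw|t /andP[t0 _]].
    by rewrite /H mulr_ge0 ?sqr_ge0 ?qen_ge0 // (lt_le_trans ra).
  rewrite (Q2Z b t _ nQ ra) ler_wpM2l ?sqr_ge0 //.
  exact: (energy_bound rs_gt0 wave E0 t0 ra ab).
have M0 : Q2 a b M 0 <= 0.
  have n0 : nice (fun _ : V => 0 * (0 : R)) by exact: nice_cst.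
  have z : Q2 a b (fun _ : V => 0 * (0 : R)) 0 = 0.
    by rewrite (@Q2Z R n rs a b (fun _ => 0) 0 0 (@nice_cst _ _ _ 0) ra) mul0r.
  rewrite -[leRHS]z; apply: (@Q2_le R n rs a b _ _ 0 0 nM n0 ra) => r w _ _.
  by rewrite /M /v /= subrr expr0n !mulr0.
have MT : Q2 a b (fun p => rho p.1.2 * v p ^+ 2) T <= Q2 a b M T.
  apply: (@Q2_le R n rs a b _ _ T T (niceM nr nv2) nM ra) => r w _ _.
  by rewrite /M /= addrAC subrr add0r mul1r.
apply: (le_trans MT); apply: (le_trans _ h2); apply: (le_trans _ h1).
by rewrite e lerDl oppr_ge0.
Qed.

Let sq_split (m x a b qa qb : R) : 0 <= m -> x ^+ 2 <= 2 * a ^+ 2 + 2 * b ^+ 2 ->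
  m * a ^+ 2 <= qa -> m * b ^+ 2 <= qb -> m * x ^+ 2 <= 2 * (qa + qb).
Proof. by move=> m0 /(ler_wpM2l m0) h1 h2 h3; lra. Qed.

Let combine (a1 a2 a3 a4 a5 a6 : R) : a1 <= a2 + a3 -> a3 <= a5 -> - a4 <= a6 ->
  a1 <= a4 + a2 + (a5 + a6).
Proof. by move=> h1 h2 h3; lra. Qed.

(** The cutoff error is the term with the derivative of the cutoff: it is
   bounded by the growth estimate divided by X, and disappears in the limit,
   so that no decay in space is needed at positive times. *)
Lemma hardy_difference (T a b : R) : 0 <= T -> rs < a -> a <= b ->
  Q2 a b (fun p => rho_h d rs p.1.2 * v p ^+ 2) T <= 16 / N ^+ 2 * E.
Proof.
move=> T0.
have nv2 : nice (fun p => v p ^+ 2) := niceX nv.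
have nrh : nice (fun p => rho_h d rs p.1.2) by exact: nice_rho_h.
have nG : nice (fun p => rho_h d rs p.1.2 * v p ^+ 2) := niceM nrh nv2.
pose D := 2 / N * (2 / rs * ((T + 1) ^+ 2 * E * T)).
apply: (uncut2 (d := d) rs_gt0 nG (lexx 0) (D := D)) => [r w rr sw|].
  by rewrite mulr_ge0 ?sqr_ge0 // ltW // rho_h_gt0.
move=> X {}a {}b X1 ra ab hp; have X0 : 0 < X by lra.
have b0 := lt_le_trans ra ab.
pose c r := chi d rs 0 X r.
pose vr (p : V) := Ur phi p - Ur phi (0, p.1.2, p.2).
pose J (p : V) := c p.1.2 * (hh d rs p.1.2 * v p ^+ 2).
pose dc r := - (dchi d rs 0 X r * ((lap d rs r - rs * ir r * sc d rs r) / lap d rs r) / X).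
pose dJ (p : V) := dc p.1.2 * (hh d rs p.1.2 * v p ^+ 2)
  + c p.1.2 * (dhh d rs p.1.2 * v p ^+ 2 + 2 * hh d rs p.1.2 * v p * vr p).
have nvr : nice vr := niceD (nUr wave) (niceN (nice_at0 (nUr wave))).
have nc : nice (fun p => c p.1.2) by rewrite /c; nice_with rs_gt0 wave.
have ndc : nice (fun p => dc p.1.2) by rewrite /dc; nice_with rs_gt0 wave.
have nh : nice (fun p => hh d rs p.1.2) by exact: nice_hh.
have ndh : nice (fun p => dhh d rs p.1.2) by exact: nice_dhh.
have ndJ : nice dJ.
  apply: (niceD (niceM ndc (niceM nh nv2))).
  exact: (niceM nc (niceD (niceM ndh nv2) (niceM (niceM (niceM (@nice_cst _ _ _ 2) nh) nv) nvr))).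
have hJ (r : R) (w : 'rV[R]_n) : a <= r <= b -> S w ->
    is_derive r 1 (fun s => J (T, s, w)) (dJ (T, r, w)).
  move=> /andP[ar _] sw; have rr := lt_le_trans ra ar; have x0 := sphere_neq0 sw.
  rewrite /J /dJ /v /vr /=; notypeclasses refine (isd_cval _ _).
    notypeclasses refine (isdM (is_derive_chi d rs_gt0 0 X rr) _).
    notypeclasses refine (isdM (is_derive_hh d rs_gt0 rr) _).
    by der_with_sol rs_gt0 wave rr x0.
  cbv beta; rewrite -/(dc r) -/(c r).
  move: (U0 phi (0, r, w)) (U0 phi (T, r, w)) (Ur phi (T, r, w)) (Ur phi (0, r, w)) => u0 u1 u2 u3; ring.
have Jend (r : R) (w : 'rV[R]_n) : rs < r -> ~~ (a < r < b) -> J (T, r, w) = 0.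
  move=> rr nr; rewrite /J /= /c chi_eq0 ?mul0r // addr0 leNgt.
  by apply: contra nr; exact: hp.
have e : Q2 a b dJ T = 0.
  apply: (@Q2_dr R n rs T a b J dJ ndJ ra ab hJ) => w sw.
  - by apply: Jend => //; rewrite ltxx.
  - by apply: Jend => //; rewrite ltxx andbF.
pose G1 (p : V) := qen p.
pose G2 (p : V) := qen (0, p.1.2, p.2).
pose G3 (p : V) := rho p.1.2 * v p ^+ 2.
have nQ := nice_qen rs_gt0 wave.
have n2 : nice G2 := nice_at0 nQ.
have nr : nice (fun p => rho p.1.2) by rewrite /rho; nice_with rs_gt0 wave.
have n3 : nice G3 := niceM nr nv2.
have m1 : nice (fun p => 4 / N * (qen p + G2 p)) := niceM (@nice_cst _ _ _ _) (niceD nQ n2).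
have m2 : nice (fun p => 2 / rs / X * G3 p) := niceM (@nice_cst _ _ _ _) n3.
have nL : nice (fun p => c p.1.2 * (rho_h d rs p.1.2 * v p ^+ 2)) := niceM nc nG.
have main : Q2 a b (fun p => N / 2 * (c p.1.2 * (rho_h d rs p.1.2 * v p ^+ 2))) T <=
    Q2 a b (fun p => dJ p + (4 / N * (qen p + G2 p) + 2 / rs / X * G3 p)) T.
  apply: (@Q2_le R n rs a b _ _ T T (niceM (@nice_cst _ _ _ _) nL) (niceD ndJ (niceD m1 m2)) ra).
  move=> r w /andP[ar _] sw; have rr := lt_le_trans ra ar.
  have /andP[l0 l1] := lap_bounds d rs_gt0 rr.
  have c0 : 0 <= c r by exact: chi_ge0.
  have c1 : c r <= 1 by exact: chi_le1.
  have hp1 := ler_wpM2l c0 (hardy_pointwise d rs_gt0 (v (T, r, w)) (vr (T, r, w)) rr).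
  have wF0 : 0 <= vol d r * lap d rs r by rewrite mulr_ge0 ?ltW // (vol_gt0 d rs_gt0 rr).
  have k1 : c r * (2 / N * (vol d r * lap d rs r * vr (T, r, w) ^+ 2)) <=
      4 / N * (qen (T, r, w) + qen (0, r, w)).
    have z0 : 0 <= 2 / N * (vol d r * lap d rs r * vr (T, r, w) ^+ 2).
      by rewrite mulr_ge0 ?divr_ge0 ?(ltW N0) // mulr_ge0 // sqr_ge0.
    apply: (le_trans (ler_piMl z0 c1)).
    have -> : 4 / N * (qen (T, r, w) + qen (0, r, w)) = 2 / N * (2 * (qen (T, r, w) + qen (0, r, w))).
      by move: (qen _ + qen _) => x; field; rewrite gt_eqF.
    apply: ler_wpM2l; first by rewrite divr_ge0 // ltW.
    have q1 := radial_energy_le phi rs_gt0 T w rr.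
    have q2 := radial_energy_le phi rs_gt0 0 w rr.
    have s : vr (T, r, w) ^+ 2 <= 2 * Ur phi (T, r, w) ^+ 2 + 2 * Ur phi (0, r, w) ^+ 2.
      rewrite /vr /=; move: (Ur phi (T, r, w)) (Ur phi (0, r, w)) => x y.
      have := sqr_ge0 (x + y); have -> : (x + y) ^+ 2 = 2 * x ^+ 2 + 2 * y ^+ 2 - (x - y) ^+ 2 by ring.
      by rewrite subr_ge0.
    exact: (sq_split wF0 s q1 q2).
  have k2 : - (dc r * (hh d rs r * v (T, r, w) ^+ 2)) <= 2 / rs / X * (rho r * v (T, r, w) ^+ 2).
    have -> : - (dc r * (hh d rs r * v (T, r, w) ^+ 2)) =
       (dchi d rs 0 X r * (lap d rs r - rs * ir r * sc d rs r)) * (rs * ir r * zt d rs r)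
         * (rs^-1 / X * (rho r * v (T, r, w) ^+ 2)).
      rewrite /dc /hh /rho; move: (dchi _ _ _ _ _) (v _) => x1 x2.
      have F0 : lap d rs r != 0 by rewrite gt_eqF.
      by field; rewrite F0 !gt_eqF.
    have -> : 2 / rs / X * (rho r * v (T, r, w) ^+ 2) = 2 * (rs^-1 / X * (rho r * v (T, r, w) ^+ 2)).
      by rewrite !mulrA.
    apply: ler_wpM2r.
      rewrite mulr_ge0 ?divr_ge0 ?invr_ge0 ?(ltW rs_gt0) ?(ltW X0) //.
      by rewrite mulr_ge0 ?sqr_ge0 // ltW // rho_gt0.
    have sl := exhaust_slope d rs_gt0 rr; have dc0 := dchi_ge0 d rs 0 X r.
    have dc2 : dchi d rs 0 X r <= 2 by exact: dchi_le2.
    have /andP[z0 z1] := zt_bounds d rs_gt0 rr.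
    have y1 := rs_ir rs_gt0 rr; have y0 := ir_gt0 rs_gt0 rr.
    have y2 : 0 <= rs * ir r by rewrite mulr_ge0 ?ltW.
    have yz : 0 <= rs * ir r * zt d rs r <= 1.
      by rewrite mulr_ge0 ?(ltW z0) //= mulr_ile1 // ltW.
    have [yz0 yz1] := andP yz.
    apply: (le_trans (ler_norm _)); rewrite normrM normrM (ger0_norm dc0) (ger0_norm yz0).
    rewrite -[leRHS]mulr1; apply: ler_pM => //; first by rewrite mulr_ge0.
    by rewrite -[leRHS]mulr1; apply: ler_pM.
  rewrite [leRHS]mulrDr [leLHS]mulrCA in hp1.
  exact: (combine hp1 k1 k2).
rewrite (Q2Z b T (N / 2) nL ra) (Q2D b T ndJ (niceD m1 m2) ra) (Q2D b T m1 m2 ra) e add0r in main.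
rewrite (Q2Z b T _ (niceD nQ n2) ra) (Q2Z b T _ n3 ra) (Q2D b T nQ n2 ra) in main.
have b1 := energy_bound rs_gt0 wave E0 T0 ra ab.
have b2 : Q2 a b G2 T <= E.
  apply: le_trans (data_bound rs_gt0 wave E0 b ra).
  by apply: (@Q2_le R n rs a b _ _ T 0 n2 nQ ra) => r w _ _; exact: lexx.
have b3 := growth T0 ra ab.
have k4 : 0 < 4 / N by rewrite divr_gt0.
have k5 : 0 <= 2 / rs / X by rewrite divr_ge0 ?divr_ge0 // ltW.
have b4 : 4 / N * (Q2 a b qen T + Q2 a b G2 T) <= 4 / N * (2 * E).
  rewrite ler_pM2l //; apply: (le_trans (lerD b1 b2)).
  by have -> : 2 * E = E + E by ring.
have b5 := ler_wpM2l k5 b3.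
rewrite -(ler_pM2l (x := N / 2)) ?divr_gt0 //.
apply: (le_trans main); apply: (le_trans (lerD b4 b5)).
have -> : N / 2 * (16 / N ^+ 2 * E + D / X) = 4 / N * (2 * E) + 2 / rs / X * ((T + 1) ^+ 2 * E * T).
  by rewrite /D; field; rewrite !gt_eqF.
exact: lexx.
Qed.

(** By phi(T)^2 <= 2 (phi(T) - phi(0))^2 + 2 phi(0)^2. *)
Theorem hardy (T a b : R) : 0 <= T -> rs < a -> a <= b ->
  Q2 a b (fun p => rho_h d rs p.1.2 * U0 phi p ^+ 2) T <= 48 * E.
Proof.
move=> T0 ra ab.
have nrh : nice (fun p => rho_h d rs p.1.2) by exact: nice_rho_h.
have nv2 : nice (fun p => v p ^+ 2) := niceX nv.
pose G (p : V) := rho_h d rs p.1.2 * U0 phi p ^+ 2.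
have nG : nice G := niceM nrh (niceX (nU0 wave)).
pose G0 (p : V) := G (0, p.1.2, p.2).
have nG0 : nice G0 := nice_at0 nG.
have nH : nice (fun p => rho_h d rs p.1.2 * v p ^+ 2) := niceM nrh nv2.
have m1 : nice (fun p => 2 * (rho_h d rs p.1.2 * v p ^+ 2)) := niceM (@nice_cst _ _ _ _) nH.
have m2 : nice (fun p => 2 * G0 p) := niceM (@nice_cst _ _ _ _) nG0.
have h : Q2 a b G T <= Q2 a b (fun p => 2 * (rho_h d rs p.1.2 * v p ^+ 2) + 2 * G0 p) T.
  apply: (@Q2_le R n rs a b _ _ T T nG (niceD m1 m2) ra) => r w /andP[ar _] sw.
  have := rho_h_gt0 d rs_gt0 (lt_le_trans ra ar); rewrite /G0 /G /v /=.
  move: (rho_h d rs r) (U0 phi (T, r, w)) (U0 phi (0, r, w)) => x u0 u1 x0.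
  have : 0 <= x * (u0 - 2 * u1) ^+ 2 by rewrite mulr_ge0 ?sqr_ge0 // ltW.
  have -> : x * (u0 - 2 * u1) ^+ 2 = 2 * (x * (u0 - u1) ^+ 2) + 2 * (x * u1 ^+ 2) - x * u0 ^+ 2 by ring.
  by rewrite subr_ge0.
rewrite (Q2D b T m1 m2 ra) (Q2Z b T 2 nH ra) (Q2Z b T 2 nG0 ra) in h.
have h1 := hardy_difference T0 ra ab.
have h2 : Q2 a b G0 T <= 8 / N ^+ 2 * E.
  apply: le_trans (hardy_data ra ab).
  by apply: (@Q2_le R n rs a b _ _ T 0 nG0 nG ra) => r w _ _; exact: lexx.
have i1 : (N ^+ 2)^-1 <= 1.
  by rewrite invf_le1 ?exprn_gt0 // exprn_ege1.
have i2 : (N ^+ 2)^-1 * E <= E by rewrite ler_piMl.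
apply: (le_trans h).
have h3 : 16 / N ^+ 2 * E <= 16 * E by rewrite -mulrA ler_pM2l.
have h4 : 8 / N ^+ 2 * E <= 8 * E by rewrite -mulrA ler_pM2l.
have h5 := le_trans h1 h3; have h6 := le_trans h2 h4.
have two : 0 <= 2 :> R by [].
apply: (le_trans (lerD (ler_wpM2l two h5) (ler_wpM2l two h6))).
by have -> : 48 * E = 2 * (16 * E) + 2 * (8 * E) by ring.
Qed.

End hardy_in_time.


(** * The Morawetz identity *)

Section flux_algebra.
Context {R : realType}.
Variables (C k F y z ut ux u0 g f p p1 h v : R).
Hypotheses (C40 : 40 <= C) (kC : k ^+ 2 <= C) (F0 : 0 <= F) (Fz : F <= z) (z1 : z <= 1).
Hypotheses (y0 : 0 <= y) (g0 : 0 <= g) (fC : `|f| <= C) (pC : `|p| <= C * (y * z ^+ 2)).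
Hypotheses (p1C : `|p1| <= C * (y ^+ 2 * z ^+ 2)) (hC : `|h| <= C * (y ^+ 2 * z ^+ 2))
  (vC : `|v| <= C * (y ^+ 2 * z ^+ 2)).

Let u := ux + k / 2 * F * y * u0.
Let H := y ^+ 2 * z ^+ 2 * u0 ^+ 2.
Let e := ut ^+ 2 + ux ^+ 2 + F * y ^+ 2 * g.

Let z0 : 0 <= z. Proof. exact: le_trans Fz. Qed.
Let C0 : 0 <= C. Proof. have := C40; lra. Qed.
Let H0 : 0 <= H. Proof. by rewrite /H mulr_ge0 ?sqr_ge0 // mulr_ge0 ?sqr_ge0. Qed.
Let g1 : 0 <= F * y ^+ 2 * g. Proof. by rewrite mulr_ge0 // mulr_ge0 ?sqr_ge0. Qed.
Let err_const : 40 * C <= C ^+ 2. Proof. by rewrite expr2 ler_wpM2r. Qed.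

Let u_sq : u ^+ 2 <= 2 * ux ^+ 2 + C / 2 * H.
Proof.
pose m := k / 2 * F * y * u0.
have h1 : u ^+ 2 <= 2 * ux ^+ 2 + 2 * m ^+ 2.
  have := sqr_ge0 (ux - m); rewrite /u -/m.
  have -> : (ux - m) ^+ 2 = 2 * ux ^+ 2 + 2 * m ^+ 2 - (ux + m) ^+ 2 by ring.
  by rewrite subr_ge0.
have h2 : F ^+ 2 <= z ^+ 2 by rewrite lerXn2r ?nnegrE.
have h3 : 2 * m ^+ 2 <= C / 2 * H.
  have -> : 2 * m ^+ 2 = (k ^+ 2 / 2 * (y ^+ 2 * u0 ^+ 2)) * F ^+ 2 by rewrite /m; field.
  have -> : C / 2 * H = (C / 2 * (y ^+ 2 * u0 ^+ 2)) * z ^+ 2 by rewrite /H; field.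
  have yu : 0 <= y ^+ 2 * u0 ^+ 2 by rewrite mulr_ge0 ?sqr_ge0.
  apply: ler_pM => //; rewrite ?sqr_ge0 //.
    by rewrite mulr_ge0 // divr_ge0 // sqr_ge0.
  by apply: ler_wpM2r => //; rewrite ler_pM2r.
lra.
Qed.

Let cross (a : R) : `|p * (u0 * a)| <= C / 2 * (H + a ^+ 2).
Proof.
have zz : z ^+ 2 <= z by rewrite expr2 ler_piMr.
have h1 : `|p| <= C * (y * z).
  by apply: (le_trans pC); apply: ler_wpM2l => //; exact: ler_wpM2l.
have h2 : `|p * (u0 * a)| <= C * (y * z) * `|u0 * a| by rewrite normrM ler_wpM2r.
apply: (le_trans h2).
have -> : C * (y * z) * `|u0 * a| = C * ((y * z * `|u0|) * `|a|) by rewrite normrM; ring.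
have -> : C / 2 * (H + a ^+ 2) = C * ((H + a ^+ 2) / 2) by field.
apply: ler_wpM2l => //.
have -> : H = (y * z * `|u0|) ^+ 2 by rewrite /H !exprMn real_normK ?num_real.
rewrite -[a ^+ 2]real_normK ?num_real //.
have := sqr_ge0 (y * z * `|u0| - `|a|); lra.
Qed.

Let sq_bound (q m : R) : `|q| <= C * (y ^+ 2 * z ^+ 2) -> `|q * u0 ^+ 2| <= C * H.
Proof.
move=> h1; rewrite normrM (ger0_norm (sqr_ge0 u0)) /H mulrA.
by apply: ler_wpM2r; rewrite ?sqr_ge0.
Qed.

Let collect (a1 a2 a3 a4 W T X G Q : R) :
  a1 <= C * (T + W + C * Q + G) -> a2 <= C / 2 * (Q + W) -> a3 <= C * Q -> a4 <= C * Q ->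
  C * W <= C * (2 * X + C / 2 * Q) -> 0 <= C * Q -> 40 * C * Q <= C ^+ 2 * Q ->
  40 * C * T <= C ^+ 2 * T -> 40 * C * X <= C ^+ 2 * X -> 40 * C * G <= C ^+ 2 * G ->
  0 <= C * T -> 0 <= C * X -> 0 <= C * G ->
  a1 + a2 + 1 / 2 * a3 + a4 <= 4 * C ^+ 2 * (T + X + G + Q).
Proof. by move=> *; lra. Qed.

Let collect' (a1 a2 W T X G Q : R) :
  a1 <= C * (T + W) -> a2 <= C / 2 * (Q + T) ->
  C * W <= C * (2 * X + C / 2 * Q) -> 0 <= C * Q -> 40 * C * Q <= C ^+ 2 * Q ->
  40 * C * T <= C ^+ 2 * T -> 40 * C * X <= C ^+ 2 * X -> 40 * C * G <= C ^+ 2 * G ->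
  0 <= C * T -> 0 <= C * X -> 0 <= C * G ->
  a1 + a2 <= 4 * C ^+ 2 * (T + X + G + Q).
Proof. by move=> *; lra. Qed.

Lemma flux_space_bound :
  `|f * (ut ^+ 2 + u ^+ 2 - v * u0 ^+ 2 - F * y ^+ 2 * g) + p * (u0 * u)
     - 1 / 2 * (p1 * u0 ^+ 2) + h * u0 ^+ 2| <= 4 * C ^+ 2 * (e + H).
Proof.
have b1 : `|f * (ut ^+ 2 + u ^+ 2 - v * u0 ^+ 2 - F * y ^+ 2 * g)| <=
    C * (ut ^+ 2 + u ^+ 2 + C * H + F * y ^+ 2 * g).
  rewrite normrM; apply: ler_pM => //.
  have := sq_bound 0 vC; rewrite !ler_norml => /andP[v1 v2].
  have := sqr_ge0 ut; have := sqr_ge0 u; move: g1.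
  move: (v * u0 ^+ 2) (C * H) (F * y ^+ 2 * g) (u ^+ 2) (ut ^+ 2) v1 v2 => a1 a2 a3 a4 a5 v1 v2 k1 k2 k3.
  by apply/andP; split; lra.
have b2 := cross u; have b3 := sq_bound 0 p1C; have b4 := sq_bound 0 hC.
have tri (a b c d : R) : `|a + b - 1 / 2 * c + d| <= `|a| + `|b| + 1 / 2 * `|c| + `|d|.
  apply: (le_trans (ler_normD _ _)); rewrite lerD2r; apply: (le_trans (ler_normB _ _)).
  by rewrite normrM ger0_norm ?divr_ge0 // lerD2r ler_normD.
apply: (le_trans (tri _ _ _ _)).
have us := ler_wpM2l C0 u_sq.
have k1 := mulr_ge0 C0 H0; have k2 := ler_wpM2r H0 err_const.
have k3 := ler_wpM2r (sqr_ge0 ut) err_const; have k4 := ler_wpM2r (sqr_ge0 ux) err_const.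
have k5 := ler_wpM2r g1 err_const.
have k6 := mulr_ge0 C0 (sqr_ge0 ut); have k7 := mulr_ge0 C0 (sqr_ge0 ux); have k8 := mulr_ge0 C0 g1.
exact: (collect b1 b2 b3 b4 us k1 k2 k3 k4 k5 k6 k7 k8).
Qed.

Lemma flux_time_bound : `|ut * (2 * f * u + p * u0)| <= 4 * C ^+ 2 * (e + H).
Proof.
have b1 : `|2 * (f * (ut * u))| <= C * (ut ^+ 2 + u ^+ 2).
  rewrite normrM normrM (ger0_norm (ltac:(by []) : 0 <= 2 :> R)).
  have h1 : `|f| * `|ut * u| <= C * `|ut * u| by apply: ler_wpM2r.
  have h2 : 2 * `|ut * u| <= ut ^+ 2 + u ^+ 2.
    rewrite normrM -[ut ^+ 2]real_normK ?num_real // -[u ^+ 2]real_normK ?num_real //.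
    have := sqr_ge0 (`|ut| - `|u|); lra.
  have := ler_wpM2l C0 h2; lra.
have b2 := cross ut.
have -> : ut * (2 * f * u + p * u0) = 2 * (f * (ut * u)) + p * (u0 * ut) by ring.
apply: (le_trans (ler_normD _ _)).
have us := ler_wpM2l C0 u_sq.
have k1 := mulr_ge0 C0 H0; have k2 := ler_wpM2r H0 err_const.
have k3 := ler_wpM2r (sqr_ge0 ut) err_const; have k4 := ler_wpM2r (sqr_ge0 ux) err_const.
have k5 := ler_wpM2r g1 err_const.
have k6 := mulr_ge0 C0 (sqr_ge0 ut); have k7 := mulr_ge0 C0 (sqr_ge0 ux); have k8 := mulr_ge0 C0 g1.
exact: (collect' b1 b2 us k1 k2 k3 k4 k5 k6 k7 k8).
Qed.

End flux_algebra.

Section morawetz.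
Context {R : realType} {n : nat} (rs : R) (phi : R -> R -> 'rV[R]_n -> R) (A z0 : R).
Local Notation V := (R * R * 'rV[R]_n)%type.
Local Notation S := (@sphere R n).
Local Notation nice := (@nice R n rs).
Local Notation d := (n - 3)%N.
Local Notation K := (d.+2%:R : R).
Local Notation N := (d.+1%:R : R).
Local Notation qen := (qen rs phi).
Local Notation eden := (eden rs phi).
Hypothesis rs_gt0 : 0 < rs.
Hypothesis wave : wave_solution rs phi.
Hypotheses (n4 : (4 <= n)%N) (A0 : 0 <= A) (z01 : 0 <= z0 <= 1).

Let f r := mf K A z0 (sc d rs r) (zt d rs r).
Let p r := mp K A (sc d rs r) (ir r) (zt d rs r).
Let p1 r := mp1 K A (sc d rs r) (ir r) (zt d rs r).
Let hv r := mhh K A (sc d rs r) (ir r) (zt d rs r).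
Let pot r := V0 K (sc d rs r) (ir r).
Let ang r := lap d rs r * ir r ^+ 2.
Let c r := half_vol d rs r.
Let rho r := vol d r * (lap d rs r)^-1.

(** The tortoise derivative of the solution conjugated by the square root of
   the volume density. *)
Definition Uc (q : V) : R := lap d rs q.1.2 * Ur phi q + half_vol d rs q.1.2 * U0 phi q.

Definition mbulk (q : V) : R := bulk K A z0 (sc d rs q.1.2) (ir q.1.2) (zt d rs q.1.2)
  (Uc q) (U0 phi q) (gradsq phi q).

(* The spatial flux J and the multiplier h = 2 f U + (D f) phi. *)
Let j (q : V) : R := f q.1.2 * (Ut phi q ^+ 2 + Uc q ^+ 2 - pot q.1.2 * U0 phi q ^+ 2
    - ang q.1.2 * gradsq phi q)
  + p q.1.2 * (U0 phi q * Uc q) - 1 / 2 * (p1 q.1.2 * U0 phi q ^+ 2) + hv q.1.2 * U0 phi q ^+ 2.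

Let h (q : V) : R := 2 * f q.1.2 * Uc q + p q.1.2 * U0 phi q.

Let nf : nice (fun q => f q.1.2).
Proof. by rewrite /f /mf; nice_with rs_gt0 wave. Qed.
Let np : nice (fun q => p q.1.2).
Proof. by rewrite /p /mp; nice_with rs_gt0 wave. Qed.
Let np1 : nice (fun q => p1 q.1.2).
Proof. by rewrite /p1 /mp1 /g1 /g2; nice_with rs_gt0 wave. Qed.
Let nhv : nice (fun q => hv q.1.2).
Proof. by rewrite /hv /mhh /mp1 /g1 /g2 /g3; nice_with rs_gt0 wave. Qed.
Let npot : nice (fun q => pot q.1.2).
Proof. by rewrite /pot /V0; nice_with rs_gt0 wave. Qed.
Let nang : nice (fun q => ang q.1.2).
Proof. by rewrite /ang; nice_with rs_gt0 wave. Qed.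
Let nhalf : nice (fun q => c q.1.2).
Proof. by rewrite /c /half_vol; nice_with rs_gt0 wave. Qed.
Let nrho : nice (fun q => rho q.1.2).
Proof. by rewrite /rho; nice_with rs_gt0 wave. Qed.

Let nUc : nice Uc.
Proof. by rewrite /Uc /half_vol; nice_with rs_gt0 wave. Qed.

Lemma nice_mbulk : nice mbulk.
Proof.
rewrite /mbulk /bulk.
have nmhh1 : nice (fun q => mhh1 K A (sc d rs q.1.2) (ir q.1.2) (zt d rs q.1.2)).
  by rewrite /mhh1 /mp2 /g1 /g1' /g2 /g2s /g2z /g3 /g3'; nice_with rs_gt0 wave.
have nmp2 : nice (fun q => mp2 K A (sc d rs q.1.2) (ir q.1.2) (zt d rs q.1.2)).
  by rewrite /mp2 /g1 /g1' /g2 /g2s /g2z; nice_with rs_gt0 wave.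
have nV01 : nice (fun q => V01 K (sc d rs q.1.2) (ir q.1.2)).
  by rewrite /V01; nice_with rs_gt0 wave.
have np' : nice (fun q => mp K A (sc d rs q.1.2) (ir q.1.2) (zt d rs q.1.2)) by exact: np.
have nf' : nice (fun q => mf K A z0 (sc d rs q.1.2) (zt d rs q.1.2)) by exact: nf.
have nh' : nice (fun q => mhh K A (sc d rs q.1.2) (ir q.1.2) (zt d rs q.1.2)) by exact: nhv.
by nice_with rs_gt0 wave.
Qed.

Let nj : nice j.
Proof.
have n0 := nU0 wave; have ng := ngradsq wave.
have m1 : nice (fun q => U0 phi q ^+ 2) by nice_with rs_gt0 wave.
have m2 : nice (fun q => Ut phi q ^+ 2) by nice_with rs_gt0 wave.
by rewrite /j; nice_with rs_gt0 wave.
Qed.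

Let nh : nice h.
Proof. by rewrite /h; nice_with rs_gt0 wave. Qed.

Section at_point.
Variables (t r : R) (w : 'rV[R]_n).
Hypotheses (rr : rs < r) (sw : S w).
Let x0 := sphere_neq0 sw.

Let F0 : lap d rs r != 0.
Proof. by have /andP[l0 _] := lap_bounds d rs_gt0 rr; rewrite gt_eqF. Qed.

(** The wave equation in first order form. *)
Lemma dr_Uc : is_derive r 1 (fun q => Uc (t, q, w))
  ((Utt phi (t, r, w) - half_vol d rs r * Uc (t, r, w) + pot r * U0 phi (t, r, w)
    - lap d rs r * ir r ^+ 2 * lapl phi (t, r, w)) / lap d rs r).
Proof.
have H := isdD (isdM (is_derive_lap d rs_gt0 rr) (dr_Ur wave t rr x0))
  (isdM (is_derive_half_vol d rs_gt0 rr) (dr_U0 wave t rr x0)).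
notypeclasses refine (isd_cval H _); cbv beta.
rewrite (wave_eq rs_gt0 wave t rr sw) /Uc /pot /=.
move: (Ur phi (t, r, w)) (Urr phi (t, r, w)) (lapl phi (t, r, w)) (U0 phi (t, r, w)) => a1 a2 a3 a4.
rewrite /half_vol; move: (V0 _ _ _) F0 => v; move: (K) (N) (lap d rs r) => k n1 F F1.
by field.
Qed.

Lemma dt_Uc : is_derive t 1 (fun q => Uc (q, r, w))
  (lap d rs r * Utr phi (t, r, w) + half_vol d rs r * Ut phi (t, r, w)).
Proof.
have H := isdD (isdZ (lap d rs r) (dt_Ur wave t rr x0)) (isdZ (half_vol d rs r) (dt_U0 wave t rr x0)).
notypeclasses refine (isd_cval H _); exact: erefl.
Qed.

Let B (al ga : R) : R :=
  (al * U0 phi (t, r, w) + 0 * Ut phi (t, r, w) + ga * Ur phi (t, r, w)) * lapl phi (t, r, w)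
  + (al * gradsq phi (t, r, w) + 0 * grad_t phi (t, r, w) + ga * grad_r phi (t, r, w)).

(** The spatial half of the multiplier identity. *)
Lemma dr_flux : is_derive r 1 (fun q => vol d q * j (t, q, w))
  (rho r * (Utt phi (t, r, w) * h (t, r, w) + Ut phi (t, r, w) *
      (2 * f r * (lap d rs r * Utr phi (t, r, w) + half_vol d rs r * Ut phi (t, r, w))
       + p r * Ut phi (t, r, w)))
   - ir r ^+ 2 * vol d r * B (2 * f r * half_vol d rs r + p r) (2 * f r * lap d rs r)
   + rho r * mbulk (t, r, w)).
Proof.
have hU := dr_Uc; have hu := dr_U0 wave t rr x0; have ht := dr_Ut wave t rr x0.
have hg := dr_gradsq wave t rr x0.
have hu2 := @is_derive_pow R (fun q => U0 phi (t, q, w)) 1 r _ hu.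
have ht2 := @is_derive_pow R (fun q => Ut phi (t, q, w)) 1 r _ ht.
have hU2 := @is_derive_pow R (fun q => Uc (t, q, w)) 1 r _ hU.
have H := isdM (is_derive_vol d rs_gt0 rr) (isdD (isdD (isdD
  (isdM (is_derive_mf d A z0 rs_gt0 rr)
     (isdD (isdD (isdD ht2 hU2) (isdN (isdM (is_derive_V0 d rs_gt0 rr) hu2)))
        (isdN (isdM (is_derive_ang d rs_gt0 rr) hg))))
  (isdM (is_derive_mp d A rs_gt0 rr) (isdM hu hU)))
  (isdN (isdZ (1 / 2) (isdM (is_derive_mp1 d A rs_gt0 rr) hu2))))
  (isdM (is_derive_mhh d A rs_gt0 rr) hu2)).
notypeclasses refine (isd_cval H _); cbv beta; clear H hU hu ht hg hu2 ht2 hU2.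
rewrite /B /h /mbulk /bulk /Uc /half_vol /pot /f /p /p1 /hv /rho /=.
move: (mf K A z0 (sc d rs r) (zt d rs r)) (mp K A (sc d rs r) (ir r) (zt d rs r)) => f' p'.
move: (mp1 K A (sc d rs r) (ir r) (zt d rs r)) (mp2 K A (sc d rs r) (ir r) (zt d rs r)) => p1' p2'.
move: (mhh K A (sc d rs r) (ir r) (zt d rs r)) (mhh1 K A (sc d rs r) (ir r) (zt d rs r)) => h1' h2'.
move: (V0 K (sc d rs r) (ir r)) (V01 K (sc d rs r) (ir r)) => v' v1'.
move: (U0 phi (t, r, w)) (Ut phi (t, r, w)) (Ur phi (t, r, w)) (Utt phi (t, r, w)) => b1 b2 b3 b4.
move: (Utr phi (t, r, w)) (gradsq phi (t, r, w)) (grad_r phi (t, r, w)) (lapl phi (t, r, w)) => b5 b6 b7 b8.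
move: (grad_t phi (t, r, w)) F0 => b9; rewrite /lap; move: (vol d r) (sc d rs r) (ir r) (K) => w' s y k F1.
by field.
Qed.

Lemma dt_flux : is_derive t 1 (fun q => rho r * (Ut phi (q, r, w) * h (q, r, w)))
  (rho r * (Utt phi (t, r, w) * h (t, r, w) + Ut phi (t, r, w) *
      (2 * f r * (lap d rs r * Utr phi (t, r, w) + half_vol d rs r * Ut phi (t, r, w))
       + p r * Ut phi (t, r, w)))).
Proof.
have H := isdZ (rho r) (isdM (dt_Ut wave t rr x0)
  (isdD (isdZ (2 * f r) dt_Uc) (isdZ (p r) (dt_U0 wave t rr x0)))).
notypeclasses refine (isd_cval H _); cbv beta; rewrite /h /=.
move: (Uc (t, r, w)) (Utt phi (t, r, w)) (Ut phi (t, r, w)) (Utr phi (t, r, w)) (U0 phi (t, r, w)) => b1 b2 b3 b4 b5.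
ring.
Qed.

(** Pointwise, the densities of the flux are controlled by those of the energy
   and of the Hardy inequality. *)
Let hden : R := ir r ^+ 2 * zt d rs r ^+ 2 * U0 phi (t, r, w) ^+ 2.
Let CJ : R := 4 * Cm K A ^+ 2.

Let K3 : 3 <= K.
Proof. by rewrite ler_nat !ltnS subn_gt0. Qed.

Let bounds : [/\ `|f r| <= Cm K A, `|p r| <= Cm K A * (ir r * zt d rs r ^+ 2),
   `|p1 r| <= Cm K A * (ir r ^+ 2 * zt d rs r ^+ 2), `|hv r| <= Cm K A * (ir r ^+ 2 * zt d rs r ^+ 2)
   & `|pot r| <= Cm K A * (ir r ^+ 2 * zt d rs r ^+ 2)].
Proof.
have /andP[s0 s1] := sc_bounds d rs_gt0 rr; have s01 : 0 <= sc d rs r <= 1 by rewrite !ltW.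
have /andP[u0 u1] := zt_bounds d rs_gt0 rr; have u01 : 0 <= zt d rs r <= 1 by rewrite ltW.
have y0 := ltW (ir_gt0 rs_gt0 rr).
have sz : 1 - sc d rs r <= 4 * zt d rs r ^+ 2 := lap_le_zt2 d rs_gt0 rr.
split.
- exact: mf_bound.
- exact: mp_bound.
- exact: mp1_bound.
- exact: mhh_bound.
- exact: V0_bound.
Qed.

Let CmK : 40 <= Cm K A /\ K ^+ 2 <= Cm K A.
Proof.
have K1 : 1 <= K by have := K3; lra.
have h1 : 1 <= K ^+ 3 by rewrite exprn_ege1.
have h2 : K ^+ 2 <= K ^+ 3 by rewrite ler_weXn2l.
have h3 : 0 <= A * K ^+ 3 by rewrite mulr_ge0 // (le_trans ler01).
by rewrite /Cm; split; lra.
Qed.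

Lemma j_bound : `|j (t, r, w)| <= CJ * (eden (t, r, w) + hden).
Proof.
have [h1 h2 h3 h4 h5] := bounds; have [c1 c2] := CmK.
have /andP[l0 l1] := lap_bounds d rs_gt0 rr; have /andP[u0 u1] := zt_bounds d rs_gt0 rr.
exact: (flux_space_bound (Ut phi (t, r, w)) (lap d rs r * Ur phi (t, r, w)) (U0 phi (t, r, w))
  c1 c2 (ltW l0) (lap_le_zt d rs_gt0 rr) u1 (ltW (ir_gt0 rs_gt0 rr)) (gradsq_ge0 phi (t, r, w))
  h1 h2 h3 h4 h5).
Qed.

Lemma m_bound : `|Ut phi (t, r, w) * h (t, r, w)| <= CJ * (eden (t, r, w) + hden).
Proof.
have [h1 h2 h3 h4 h5] := bounds; have [c1 c2] := CmK.
have /andP[l0 l1] := lap_bounds d rs_gt0 rr; have /andP[u0 u1] := zt_bounds d rs_gt0 rr.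
exact: (flux_time_bound (Ut phi (t, r, w)) (lap d rs r * Ur phi (t, r, w)) (U0 phi (t, r, w))
  c1 c2 (ltW l0) (lap_le_zt d rs_gt0 rr) u1 (ltW (ir_gt0 rs_gt0 rr)) (gradsq_ge0 phi (t, r, w))
  h1 h2).
Qed.

End at_point.

Let collect_flux (m0 mT q3 wv a b : R) : mT + (q3 + wv) <= m0 -> m0 <= a -> -1 * mT <= a ->
  -1 * wv <= b -> q3 <= a + a + b.
Proof. by move=> *; lra. Qed.

Variable E : R.
Hypothesis E0 : (energy rs phi 0 <= E%:E)%E.
Hypothesis decay : vanishes_at_infinity (phi 0).

Let CJ : R := 4 * Cm K A ^+ 2.
Let L (q : V) : R := CJ * (qen q + rho_h d rs q.1.2 * U0 phi q ^+ 2).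

Let CJ0 : 0 <= CJ. Proof. by rewrite /CJ mulr_ge0 ?sqr_ge0. Qed.

Let nhardy : nice (fun q => rho_h d rs q.1.2 * U0 phi q ^+ 2).
Proof. by rewrite /rho_h; nice_with rs_gt0 wave. Qed.

Let nL : nice L.
Proof. exact: (niceM (@nice_cst _ _ _ CJ) (niceD (nice_qen rs_gt0 wave) nhardy)). Qed.

Let L_E (t r : R) (w : 'rV[R]_n) : L (t, r, w) = rho r * (CJ * (eden (t, r, w)
  + ir r ^+ 2 * zt d rs r ^+ 2 * U0 phi (t, r, w) ^+ 2)).
Proof. by rewrite /L qenE /rho_h /rho /=; move: (eden _) => x; ring. Qed.

Let L_ge0 (t r : R) (w : 'rV[R]_n) : rs < r -> 0 <= L (t, r, w).
Proof.
move=> rr; rewrite /L mulr_ge0 // addr_ge0 ?qen_ge0 //.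
by rewrite mulr_ge0 ?sqr_ge0 // ltW // rho_h_gt0.
Qed.

Let L_bound (t a b : R) : 0 <= t -> rs < a -> a <= b -> Q2 a b L t <= 49 * CJ * E.
Proof.
move=> t0 ra ab; have nQ := nice_qen rs_gt0 wave.
rewrite (Q2Z b t CJ (niceD nQ nhardy) ra) (Q2D b t nQ nhardy ra).
have h1 := energy_bound rs_gt0 wave E0 t0 ra ab.
have h2 := hardy rs_gt0 wave E0 decay t0 ra ab.
have -> : 49 * CJ * E = CJ * (E + 48 * E) by ring.
by apply: ler_wpM2l => //; exact: lerD.
Qed.

Section cutoff_identity.
Variables (X : R).
Hypothesis X0 : 0 < X.

Let ch r := chi d rs 0 X r.
Let dch r := - (dchi d rs 0 X r * ((lap d rs r - rs * ir r * sc d rs r) / lap d rs r) / X).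

(* The time derivative of M and the angular divergence, without cutoff. *)
Let T1 (q : V) : R := rho q.1.2 * (Utt phi q * h q + Ut phi q *
      (2 * f q.1.2 * (lap d rs q.1.2 * Utr phi q + half_vol d rs q.1.2 * Ut phi q)
       + p q.1.2 * Ut phi q)).
Let al r := 2 * f r * half_vol d rs r + p r.
Let ga r := 2 * f r * lap d rs r.
Let T2 (q : V) : R := ir q.1.2 ^+ 2 * vol d q.1.2 *
  ((al q.1.2 * U0 phi q + 0 * Ut phi q + ga q.1.2 * Ur phi q) * lapl phi q
  + (al q.1.2 * gradsq phi q + 0 * grad_t phi q + ga q.1.2 * grad_r phi q)).

Let M (q : V) : R := ch q.1.2 * (rho q.1.2 * (Ut phi q * h q)).
Let dM (q : V) : R := ch q.1.2 * T1 q.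
Let J (q : V) : R := ch q.1.2 * (vol d q.1.2 * j q).
Let dJ (q : V) : R := ch q.1.2 * (T1 q - T2 q + rho q.1.2 * mbulk q)
  + vol d q.1.2 * j q * dch q.1.2.
Let W (q : V) : R := vol d q.1.2 * j q * dch q.1.2.
Let Bk (q : V) : R := ch q.1.2 * (rho q.1.2 * mbulk q).

Let nch : nice (fun q => ch q.1.2).
Proof. by rewrite /ch; nice_with rs_gt0 wave. Qed.
Let ndch : nice (fun q => dch q.1.2).
Proof. by rewrite /dch; nice_with rs_gt0 wave. Qed.
Let nvol : nice (fun q => vol d q.1.2).
Proof. by nice_with rs_gt0 wave. Qed.
Let nal : nice (fun q => al q.1.2).
Proof. by rewrite /al; exact: (niceD (niceM (niceM (@nice_cst _ _ _ 2) nf) nhalf) np). Qed.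
Let nlap' : nice (fun q => lap d rs q.1.2).
Proof. by nice_with rs_gt0 wave. Qed.
Let nga : nice (fun q => ga q.1.2).
Proof. by rewrite /ga; exact: (niceM (niceM (@nice_cst _ _ _ 2) nf) nlap'). Qed.
Let nT1 : nice T1.
Proof.
have n1 : nice (fun q => lap d rs q.1.2 * Utr phi q + half_vol d rs q.1.2 * Ut phi q).
  exact: (niceD (niceM nlap' (nUtr wave)) (niceM nhalf (nUt wave))).
have n2 : nice (fun q => 2 * f q.1.2) := niceM (@nice_cst _ _ _ 2) nf.
exact: (niceM nrho (niceD (niceM (nUtt wave) nh) (niceM (nUt wave)
  (niceD (niceM n2 n1) (niceM np (nUt wave)))))).
Qed.
Let nT2 : nice T2.
Proof.
have n0 : nice (fun q => ir q.1.2 ^+ 2 * vol d q.1.2) by nice_with rs_gt0 wave.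
have z := @nice_cst R n rs 0.
exact: (niceM n0 (niceD (niceM (niceD (niceD (niceM nal (nU0 wave)) (niceM z (nUt wave)))
   (niceM nga (nUr wave))) (nlapl wave)) (niceD (niceD (niceM nal (ngradsq wave))
   (niceM z (ngrad_t wave))) (niceM nga (ngrad_r wave))))).
Qed.
Let nM : nice M := niceM nch (niceM nrho (niceM (nUt wave) nh)).
Let ndM : nice dM := niceM nch nT1.
Let nW : nice W := niceM (niceM nvol nj) ndch.
Let nBk : nice Bk := niceM nch (niceM nrho nice_mbulk).
Let ndJ : nice dJ :=
  niceD (niceM nch (niceD (niceD nT1 (niceN nT2)) (niceM nrho nice_mbulk))) nW.

Let M_le (t r : R) (w : 'rV[R]_n) : rs < r -> S w -> `|M (t, r, w)| <= L (t, r, w).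
Proof.
move=> rr sw; rewrite L_E -[M _]/(ch r * (rho r * (Ut phi (t, r, w) * h (t, r, w)))).
rewrite (normrM (ch r)) (normrM (rho r)).
have c0 : 0 <= ch r by exact: chi_ge0.
have c1 : ch r <= 1 by exact: chi_le1.
have r0 : 0 < rho r by exact: rho_gt0.
rewrite (ger0_norm c0) (gtr0_norm r0); apply: le_trans (ler_piMl _ c1) _.
  by rewrite mulr_ge0 // ltW.
by rewrite ler_pM2l //; exact: (m_bound t w rr).
Qed.

Let W_le (t r : R) (w : 'rV[R]_n) : rs < r -> S w -> `|W (t, r, w)| <= 2 / X * L (t, r, w).
Proof.
move=> rr sw; have /andP[l0 l1] := lap_bounds d rs_gt0 rr.
have -> : W (t, r, w) = - (dchi d rs 0 X r * (lap d rs r - rs * ir r * sc d rs r))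
    * (X^-1 * (rho r * j (t, r, w))).
  rewrite -[W _]/(vol d r * j (t, r, w) * dch r) /dch /rho.
  move: (j _) (dchi _ _ _ _ _) => a1 a2; ring.
rewrite L_E (normrM (- _)) normrN.
have r0 : 0 < rho r by exact: rho_gt0.
have Xi : 0 < X^-1 by rewrite invr_gt0.
have -> : 2 / X * (rho r * (CJ * (eden (t, r, w) + ir r ^+ 2 * zt d rs r ^+ 2 * U0 phi (t, r, w) ^+ 2)))
  = (2 * 1) * (X^-1 * (rho r * (CJ * (eden (t, r, w) + ir r ^+ 2 * zt d rs r ^+ 2 * U0 phi (t, r, w) ^+ 2)))).
  by rewrite [2 * 1]mulr1 -[LHS]mulrA.
apply: ler_pM => //.
  rewrite (normrM (dchi _ _ _ _ _)) (ger0_norm (dchi_ge0 d rs 0 X r)); apply: ler_pM => //.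
  - exact: dchi_ge0.
  - exact: dchi_le2.
  - exact: (exhaust_slope d rs_gt0 rr).
rewrite (normrM X^-1) (normrM (rho r)) (gtr0_norm Xi) (gtr0_norm r0) !ler_pM2l //.
exact: (j_bound t w rr).
Qed.

(** The integrated Morawetz identity. The bulk term is bounded by the flux M
   at both ends of the time interval and by the cutoff error, and all of these
   by the energy and the Hardy inequality. *)
Lemma morawetz_cutoff (T a b : R) : 0 <= T -> rs < a -> a <= b ->
  (forall r, rs < r -> exhaust d rs r < X -> a < r < b) ->
  Q3 T a b Bk <= 98 * CJ * E + (98 * CJ * E * T) / X.
Proof.
move=> T0 ra ab hp; have b0 := lt_le_trans ra ab.
have Jend (t r : R) (w : 'rV[R]_n) : rs < r -> ~~ (a < r < b) -> J (t, r, w) = 0.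
  move=> rr nr; rewrite /J /= /ch chi_eq0 ?mul0r // addr0 leNgt.
  by apply: contra nr; exact: hp.
have nal2 : nice (fun q : V => ch q.1.2 * (ir q.1.2 ^+ 2 * vol d q.1.2) * al q.1.2).
  by apply: (niceM (niceM nch _) nal); nice_with rs_gt0 wave.
have nga2 : nice (fun q : V => ch q.1.2 * (ir q.1.2 ^+ 2 * vol d q.1.2) * ga q.1.2).
  by apply: (niceM (niceM nch _) nga); nice_with rs_gt0 wave.
have H : Q2 a b M T + Q3 T a b (fun q => Bk q + W q) <= Q2 a b M 0.
  refine (@flux_balance R n rs phi wave T a b M dM J dJ (fun q => Bk q + W q)
    (fun _ r => ch r * (ir r ^+ 2 * vol d r) * al r) (fun _ _ => 0)
    (fun _ r => ch r * (ir r ^+ 2 * vol d r) * ga r)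
    nM ndM ndJ (niceD nBk nW) nal2 (@nice_cst _ _ _ 0) nga2 ra ab T0 _ _ _ _ _).
  - move=> t r w /andP[ar _] sw; have rr := lt_le_trans ra ar.
    exact: (isdZ (ch r) (dt_flux t rr sw)).
  - move=> t r w /andP[ar _] sw; have rr := lt_le_trans ra ar.
    exact: (isdM (is_derive_chi d rs_gt0 0 X rr) (dr_flux t rr sw)).
  - by move=> t w _ sw; apply: Jend => //; rewrite ltxx.
  - by move=> t w _ sw; apply: Jend => //; rewrite ltxx andbF.
  - move=> t r w _ _ _; rewrite /dM /Bk /W /dJ /T2 /=.
    move: (T1 (t, r, w)) (mbulk (t, r, w)) (j (t, r, w)) (al r) (ga r) (ch r) (dch r) (rho r).
    move: (U0 phi (t, r, w)) (Ut phi (t, r, w)) (Ur phi (t, r, w)) (lapl phi (t, r, w)).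
    move: (gradsq phi (t, r, w)) (grad_t phi (t, r, w)) (grad_r phi (t, r, w)) (ir r) (vol d r).
    by move=> *; rewrite le_eqVlt; apply/orP; left; apply/eqP; ring.
have nW2 : nice (fun q => -1 * W q) := niceM (@nice_cst _ _ _ (-1)) nW.
have nM2 : nice (fun q => -1 * M q) := niceM (@nice_cst _ _ _ (-1)) nM.
have nL2 : nice (fun q => 2 / X * L q) := niceM (@nice_cst _ _ _ (2 / X)) nL.
have h1 : Q2 a b M 0 <= 49 * CJ * E.
  apply: le_trans (L_bound (lexx 0) ra ab).
  apply: (@Q2_le R n rs a b _ _ 0 0 nM nL ra) => r w /andP[ar _] sw.
  by apply: le_trans (ler_norm _) (M_le 0 (lt_le_trans ra ar) sw).
have h2 : -1 * Q2 a b M T <= 49 * CJ * E.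
  rewrite -(Q2Z b T (-1) nM ra); apply: le_trans (L_bound T0 ra ab).
  apply: (@Q2_le R n rs a b _ _ T T nM2 nL ra) => r w /andP[ar _] sw.
  by rewrite mulN1r; apply: le_trans (ler_norm _) _; rewrite normrN; exact: (M_le T (lt_le_trans ra ar) sw).
have h3 : -1 * Q3 T a b W <= 2 / X * (49 * CJ * E * T).
  rewrite -(Q3Z T b (-1) nW ra).
  apply: (@le_trans _ _ (Q3 T a b (fun q => 2 / X * L q))).
    apply: (@Q3_le R n rs T a b _ _ nW2 nL2 ra) => t r w _ /andP[ar _] sw.
    rewrite mulN1r; apply: le_trans (ler_norm _) _; rewrite normrN.
    exact: (W_le t (lt_le_trans ra ar) sw).
  rewrite (Q3Z T b (2 / X) nL ra); apply: ler_wpM2l; first by rewrite divr_ge0 // ltW.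
  apply: (@Q3_le_time R n rs T a b L _ nL ra T0) => [t r w _ /andP[ar _] sw|t /andP[t0 _]].
    by apply: L_ge0; exact: lt_le_trans ar.
  exact: L_bound.
rewrite (Q3D T b nBk nW ra) in H.
have -> : 98 * CJ * E + (98 * CJ * E * T) / X = 49 * CJ * E + 49 * CJ * E + 2 / X * (49 * CJ * E * T) by ring.
exact: (collect_flux H h1 h2 h3).
Qed.

End cutoff_identity.

End morawetz.


(** * The photon sphere and the local energy density *)

Section photon_sphere.
Context {R : realType} (n : nat) (rs : R).
Hypothesis rs_gt0 : 0 < rs.
Local Notation d := (n - 3)%N.
Local Notation K := (d.+2%:R : R).
Local Notation rps := (photon_sphere n rs).

Lemma kap_gt1 : 1 < kap K.
Proof.
have : (2 : R) <= K by rewrite (ler_nat R 2).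
by rewrite /kap; lra.
Qed.

Lemma photon_sphere_gt0 : 0 < rps.
Proof.
have h : 0 < (d.+3%:R / 2 : R) by rewrite divr_gt0.
by rewrite mulr_gt0 // powR_gt0.
Qed.

Lemma photon_sphereX : rps ^+ d.+1 = kap K * rs ^+ d.+1.
Proof.
rewrite /photon_sphere exprMn; congr (_ * _).
rewrite -powR_mulrn ?powR_ge0 // -powRrM mulVf ?pnatr_eq0 // powRr1.
  by rewrite /kap -(natr1 d.+2).
by rewrite divr_ge0.
Qed.

Lemma photon_sphere_gt : rs < rps.
Proof.
rewrite ltNge; apply/negP => h.
have h1 : rps ^+ d.+1 <= rs ^+ d.+1.
  by apply: lerXn2r; rewrite ?nnegrE ?(ltW rs_gt0) ?(ltW photon_sphere_gt0).
have k : 0 < rs ^+ d.+1 by rewrite exprn_gt0.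
have := kap_gt1; rewrite -(ltr_pM2r k) mul1r -photon_sphereX; lra.
Qed.

Lemma kap_sc r : kap K * sc d rs r = (rps / r) ^+ d.+1.
Proof. by rewrite /sc (exprMn _ rs) (exprMn _ (photon_sphere n rs)) photon_sphereX mulrA. Qed.

Lemma zt_homo r r' : rs < r -> r <= r' -> zt d rs r <= zt d rs r'.
Proof.
move=> rr h; have rr' := lt_le_trans rr h.
have /andP[l0 _] := lap_bounds d rs_gt0 rr; have /andP[l0' _] := lap_bounds d rs_gt0 rr'.
have L1 := Lam_ge1 d rs_gt0 rr; have L1' := Lam_ge1 d rs_gt0 rr'.
rewrite lef_pV2 ?posrE; try lra.
rewrite /Lam lerD2l lerN2 ler_ln ?posrE // /lap lerD2l lerN2 /sc.
have r0 := r_gt0 rs_gt0 rr; have r0' := r_gt0 rs_gt0 rr'.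
apply: lerXn2r; rewrite ?nnegrE; try by rewrite divr_ge0 ?ltW.
by rewrite ler_pM2l // lef_pV2.
Qed.

(** Here kap s = (r_ps / r)^N, and z increases with r. *)
Lemma multiplier_sign r : rs < r ->
  0 <= (1 - kap K * sc d rs r) * (zt d rs r - zt d rs rps).
Proof.
move=> rr; have r0 := r_gt0 rs_gt0 rr; rewrite kap_sc.
have p0 := photon_sphere_gt0.
have [h|h] := leP rps r.
  apply: mulr_ge0; last by rewrite subr_ge0 zt_homo // photon_sphere_gt.
  rewrite subr_ge0; apply: exprn_ile1; first by rewrite divr_ge0 ?ltW.
  by rewrite ler_pdivrMr // mul1r.
apply: mulr_le0; last by rewrite subr_le0 zt_homo // ltW.
rewrite subr_le0; apply: exprn_ege1.
by rewrite ler_pdivlMr // mul1r ltW.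
Qed.

End photon_sphere.

Section le_density.
Context {R : realType} (n : nat) (rs : R).
Hypothesis rs_gt0 : 0 < rs.
Local Notation d := (n - 3)%N.
Local Notation K := (d.+2%:R : R).
Local Notation N := (d.+1%:R : R).
Local Notation rps := (photon_sphere n rs).

(** With x = r_ps / r this compares the weight of the angular term in the local
   energy with the one produced by the multiplier, both vanishing to second
   order at the photon sphere. *)
Lemma one_sub_pow_sq (x : R) m : 0 <= x -> (1 - x) ^+ 2 <= (1 - x ^+ m.+1) ^+ 2.
Proof.
move=> x0; have [x1|x1] := leP x 1.
  have h : x ^+ m.+1 <= x by rewrite exprS ler_piMr // exprn_ile1.
  by apply: lerXn2r; rewrite ?nnegrE; lra.
have h : x <= x ^+ m.+1 by rewrite exprS ler_peMr // exprn_ege1 // ltW.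
rewrite -[(1 - x) ^+ 2]sqrrN -[(1 - x ^+ _) ^+ 2]sqrrN.
by apply: lerXn2r; rewrite ?nnegrE; lra.
Qed.

(** The logarithm in the local energy norm is that of 1 - rs / r, whereas the
   multipliers involve that of F. *)
Definition logw r : R := 1 - ln (1 - rs * ir r).

Lemma rs_ir_lt1 r : rs < r -> 0 < 1 - rs * ir r.
Proof. by move=> rr; have /andP[_ h] := ratio_bounds rs_gt0 rr; rewrite subr_gt0. Qed.

Lemma logw_ge r : rs < r -> Lam d rs r <= logw r.
Proof.
move=> rr; have /andP[l0 _] := lap_bounds d rs_gt0 rr.
rewrite /Lam lerD2l lerN2 ler_ln ?posrE ?rs_ir_lt1 // /lap lerD2l lerN2 /sc.
have /andP[/ltW h0 /ltW h1] := ratio_bounds rs_gt0 rr.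
by rewrite exprS -[leRHS]mulr1 ler_wpM2l // exprn_ile1.
Qed.

Lemma logwV_le r : rs < r -> 0 <= (logw r)^-1 <= zt d rs r.
Proof.
move=> rr; have h := logw_ge rr; have h1 := Lam_ge1 d rs_gt0 rr.
have h2 : 0 < logw r by lra.
rewrite invr_ge0 (ltW h2) /= /zt lef_pV2 ?posrE //; lra.
Qed.

Lemma is_derive_logw (r : R) : rs < r -> exists df, is_derive r 1 logw df.
Proof.
move=> rr.
have h1 := isdD (isd_cst 1 r 1) (isdN (isdZ rs (is_derive_ir rs_gt0 rr))).
have h2 := @isd_comp _ _ (@ln R) (fun q => 1 - rs * ir q) r 1 _ _ (is_derive1_ln (rs_ir_lt1 rr)) h1.
by eexists; exact: (isdD (isd_cst 1 r 1) (isdN h2)).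
Qed.

(** The local energy weights, as functions of 1 / r. *)
Definition wr r : R := ir r ^+ d.+3 * (logw r)^-1 ^+ 2.
Definition ww r : R := ir r * (1 - rps * ir r) ^+ 2.
Definition w0 r : R := (1 - rs * ir r)^-1 * (ir r ^+ 3 * (logw r)^-1 ^+ 4).

Section at_radius.
Variable r : R.
Hypothesis rr : rs < r.

Let sub_ratio : (r - rs) / r = 1 - rs * ir r.
Proof. by rewrite mulrBl divff // gt_eqF // (r_gt0 rs_gt0 rr). Qed.

Lemma c_rE : c_r n rs r = wr r.
Proof. by rewrite /c_r sub_ratio /wr /ir !exprVn -invfM. Qed.

Lemma c_omegaE : c_omega n rs r = ww r.
Proof.
rewrite /c_omega /ww; congr (_ * _ ^+ 2).
by rewrite mulrBl divff // gt_eqF // (r_gt0 rs_gt0 rr).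
Qed.

Lemma c_0E : c_0 rs r = w0 r.
Proof. by rewrite /c_0 sub_ratio /w0 /ir !exprVn invfM. Qed.

Lemma wr_le : wr r <= (rs ^+ d.+1)^-1 * (ir r ^+ 2 * sc d rs r * zt d rs r ^+ 2).
Proof.
have /andP[l0 l1] := logwV_le rr; have y0 := ir_gt0 rs_gt0 rr.
have z2 : (logw r)^-1 ^+ 2 <= zt d rs r ^+ 2.
  by apply: lerXn2r; rewrite ?nnegrE //; exact: le_trans l1.
have k : rs ^+ d.+1 != 0 by rewrite gt_eqF // exprn_gt0.
have -> : (rs ^+ d.+1)^-1 * (ir r ^+ 2 * sc d rs r * zt d rs r ^+ 2) = ir r ^+ d.+3 * zt d rs r ^+ 2.
  rewrite /sc exprMn -/(ir r) -[ir r ^+ d.+3]/(ir r ^+ (2 + d.+1)) exprD.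
  by move: k; move: (rs ^+ d.+1) (ir r ^+ 2) (ir r ^+ d.+1) => a b c a0; field.
by apply: ler_wpM2l => //; rewrite exprn_ge0 // ltW.
Qed.

Lemma ww_le : ww r <= ir r * (1 - kap K * sc d rs r) ^+ 2.
Proof.
have y0 := ir_gt0 rs_gt0 rr; rewrite (kap_sc n).
apply: ler_wpM2l; first exact: ltW.
apply: one_sub_pow_sq; rewrite mulr_ge0 ?(ltW y0) // ltW //; exact: photon_sphere_gt0.
Qed.

Lemma w0_le : lap d rs r * w0 r <= N * (ir r ^+ 3 * zt d rs r ^+ 4).
Proof.
have /andP[l0 l1] := logwV_le rr; have y0 := ir_gt0 rs_gt0 rr; have x0 := rs_ir_lt1 rr.
have z4 : (logw r)^-1 ^+ 4 <= zt d rs r ^+ 4.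
  by apply: lerXn2r; rewrite ?nnegrE //; exact: le_trans l1.
have l0' : 0 <= lap d rs r by have /andP[/ltW] := lap_bounds d rs_gt0 rr.
have e : lap d rs r / (1 - rs * ir r) <= N.
  rewrite ler_pdivrMr //; apply: bernoulli.
  by have /andP[/ltW -> /ltW ->] := ratio_bounds rs_gt0 rr.
have e0 : 0 <= lap d rs r / (1 - rs * ir r) by rewrite divr_ge0 // ltW.
have y3 : 0 <= ir r ^+ 3 by rewrite exprn_ge0 // ltW.
have -> : lap d rs r * w0 r =
    lap d rs r / (1 - rs * ir r) * (ir r ^+ 3 * (logw r)^-1 ^+ 4) by rewrite /w0; exact: mulrA.
apply: ler_pM => //; first by rewrite mulr_ge0 // exprn_ge0.
exact: ler_wpM2l.
Qed.

End at_radius.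

Let CR : R := (rs ^+ d.+1)^-1 / rs.
(** The constant by which the bulk dominates the local energy density. *)
Definition CL : R := CR * (1 + 2 * N ^+ 2) + 1 + N.

Let CR_gt0 : 0 < CR.
Proof. by rewrite divr_gt0 // invr_gt0 exprn_gt0. Qed.

Lemma CL_gt0 : 0 < CL.
Proof.
have n0 : 0 < N by rewrite ltr0n.
by rewrite /CL addr_gt0 // addr_gt0 // mulr_gt0 // addr_gt0 // mulr_gt0 // exprn_gt0.
Qed.

Let collect (A q1 q2 q3 T1 T2 T3 b : R) : 0 <= T1 -> 0 <= T2 -> 0 <= T3 -> 1 <= A ->
  T1 + T2 + 2 * A * T3 <= b -> q1 <= CR * (1 + 2 * N ^+ 2) * (T1 + T2) -> q2 <= T3 -> q3 <= N * T2 ->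
  q1 + q2 + q3 <= CL * b.
Proof.
move=> t1 t2 t3 A1 hb h1 h2 h3.
have c0 : 0 <= CR * (1 + 2 * N ^+ 2).
  by rewrite mulr_ge0 ?(ltW CR_gt0) // addr_ge0 // mulr_ge0 // sqr_ge0.
have n0 : 0 <= N by [].
have aT : 0 <= (A - 1) * T3 by rewrite mulr_ge0 // subr_ge0.
have b1 : T1 + T2 <= b by lra.
have b2 : T3 <= b by lra.
have b3 : T2 <= b by lra.
have k1 := ler_wpM2l c0 b1; have k3 := ler_wpM2l n0 b3.
rewrite /CL; move: k1 k3 h1 h2 h3 b2; move: (CR * (1 + _)) => c; lra.
Qed.

Let split_sum (c m x1 x2 T1 T2 : R) : x1 <= c * T1 -> x2 <= c * (2 * m) * T2 ->
  0 <= c * (2 * m) * T1 -> 0 <= c * T2 -> x1 + x2 <= c * (1 + 2 * m) * (T1 + T2).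
Proof. by move=> *; lra. Qed.

(* The radial term: F Ur is u + a2 phi - N s y z phi, and s y is a power of
   y up to a constant. *)
Let radial_bound (cr y s z a ph fu : R) : 0 <= y -> 0 <= s <= 1 -> 0 <= z <= 1 -> rs * y <= 1 ->
  cr <= (rs ^+ d.+1)^-1 * (y ^+ 2 * s * z ^+ 2) -> fu = a - N * s * y * z * ph ->
  cr * fu ^+ 2 <= CR * (1 + 2 * N ^+ 2) * (2 * (N * s * y * z ^+ 2) * a ^+ 2 + y ^+ 3 * z ^+ 4 * ph ^+ 2).
Proof.
move=> y0 /andP[s0 s1] /andP[zz0 z1] ry hcr ->.
pose g := (rs ^+ d.+1)^-1.
have g0 : 0 <= g by rewrite invr_ge0 exprn_ge0 // ltW.
have y1 : y <= rs^-1 by rewrite -[rs^-1]mul1r ler_pdivlMr // mulrC.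
have N1 : 1 <= N by rewrite ler1n.
have N0 : 0 <= N by [].
pose b := N * s * y * z * ph.
have w0' : 0 <= g * (y ^+ 2 * s * z ^+ 2).
  by rewrite mulr_ge0 // mulr_ge0 ?sqr_ge0 // mulr_ge0 ?sqr_ge0.
have h1 : cr * (a - b) ^+ 2 <= g * (y ^+ 2 * s * z ^+ 2) * (2 * a ^+ 2 + 2 * b ^+ 2).
  apply: (@le_trans _ _ (g * (y ^+ 2 * s * z ^+ 2) * (a - b) ^+ 2)).
    by apply: ler_wpM2r => //; exact: sqr_ge0.
  by apply: ler_wpM2l => //; have := sqr_ge0 (a + b); lra.
apply: (le_trans h1).
have z2 : 0 <= z ^+ 2 by exact: sqr_ge0.
have p1 : 0 <= s * y * z ^+ 2 * a ^+ 2 by rewrite mulr_ge0 ?sqr_ge0 // mulr_ge0 // mulr_ge0.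
have p2 : 0 <= y ^+ 3 * z ^+ 4 * ph ^+ 2.
  by rewrite mulr_ge0 ?sqr_ge0 // mulr_ge0 ?exprn_ge0.
have i0 : 0 <= rs^-1 by rewrite invr_ge0 ltW.
have CRE : CR = g / rs by [].
have C0 := ltW CR_gt0.
have k1 : g * (y ^+ 2 * s * z ^+ 2) * (2 * a ^+ 2) <= CR * (2 * (N * s * y * z ^+ 2) * a ^+ 2).
  have -> : g * (y ^+ 2 * s * z ^+ 2) * (2 * a ^+ 2) = (g * (2 * (s * y * z ^+ 2 * a ^+ 2))) * y by ring.
  have -> : CR * (2 * (N * s * y * z ^+ 2) * a ^+ 2) =
     (g * (2 * (N * (s * y * z ^+ 2 * a ^+ 2)))) * rs^-1 by rewrite CRE; ring.
  apply: ler_pM => //; first by rewrite mulr_ge0 // mulr_ge0.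
  by apply: ler_wpM2l => //; rewrite ler_pM2l // ler_peMl.
have k2 : g * (y ^+ 2 * s * z ^+ 2) * (2 * b ^+ 2) <= CR * (2 * N ^+ 2) * (y ^+ 3 * z ^+ 4 * ph ^+ 2).
  have -> : g * (y ^+ 2 * s * z ^+ 2) * (2 * b ^+ 2) =
     (g * (2 * N ^+ 2) * (y ^+ 3 * z ^+ 4 * ph ^+ 2)) * (s ^+ 3 * y) by rewrite /b; ring.
  have -> : CR * (2 * N ^+ 2) * (y ^+ 3 * z ^+ 4 * ph ^+ 2) =
     (g * (2 * N ^+ 2) * (y ^+ 3 * z ^+ 4 * ph ^+ 2)) * rs^-1 by rewrite CRE; ring.
  apply: ler_wpM2l.
    apply: mulr_ge0 => //; apply: mulr_ge0 => //; apply: mulr_ge0 => //; exact: sqr_ge0.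
  by apply: le_trans y1; rewrite ler_piMl // exprn_ile1.
have p3 : 0 <= CR * (2 * N ^+ 2) * (2 * (N * s * y * z ^+ 2) * a ^+ 2).
  have -> : 2 * (N * s * y * z ^+ 2) * a ^+ 2 = 2 * (N * (s * y * z ^+ 2 * a ^+ 2)) by ring.
  apply: mulr_ge0; last by rewrite mulr_ge0 // mulr_ge0.
  by apply: mulr_ge0 => //; apply: mulr_ge0 => //; exact: sqr_ge0.
have p4 : 0 <= CR * (y ^+ 3 * z ^+ 4 * ph ^+ 2) by rewrite mulr_ge0.
by rewrite [_ * (2 * a ^+ 2 + _)]mulrDr; exact: (split_sum k1 k2 p3 p4).
Qed.

Variables (phi : R -> R -> 'rV[R]_n -> R) (A : R).
Hypotheses (n4 : (4 <= n)%N) (A1 : 1 <= A) (A_large : err_const K + 2 <= A * (3 / 16)).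
Local Notation V := (R * R * 'rV[R]_n)%type.

Definition qle (p : V) : R := (wr p.1.2 * lap d rs p.1.2 * Ur phi p ^+ 2
  + ww p.1.2 * (ir p.1.2 ^+ 2 * gradsq phi p) + w0 p.1.2 * U0 phi p ^+ 2) * vol d p.1.2.

(** The radial, angular and zeroth order parts of the density are bounded by the
   matching terms of the coercivity estimate. *)
Lemma qle_bulk t r w : rs < r ->
  qle (t, r, w) <= CL * (vol d r * (lap d rs r)^-1 * mbulk rs phi A (zt d rs rps) (t, r, w)).
Proof.
move=> rr; have /andP[l0 l1] := lap_bounds d rs_gt0 rr.
have /andP[s0 s1] := sc_bounds d rs_gt0 rr; have s01 : 0 <= sc d rs r <= 1 by rewrite !ltW.
have /andP[u0 u1] := zt_bounds d rs_gt0 rr; have u01 : 0 <= zt d rs r <= 1 by rewrite ltW.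
have y0 := ltW (ir_gt0 rs_gt0 rr).
have /andP[v0 v1] := zt_bounds d rs_gt0 (photon_sphere_gt n rs_gt0).
have v01 : 0 <= zt d rs rps <= 1 by rewrite ltW.
have K3 : 3 <= K by rewrite ler_nat !ltnS subn_gt0.
have g0 := gradsq_ge0 phi (t, r, w).
have F0 : lap d rs r != 0 by rewrite gt_eqF.
pose a := Uc rs phi (t, r, w) + a2 K (sc d rs r) (ir r) (zt d rs r) * U0 phi (t, r, w).
have hb := bulk_ge K3 A_large (Uc rs phi (t, r, w)) (U0 phi (t, r, w)) s01 y0 u01 v01 g0
  (multiplier_sign n rs_gt0 rr).
have -> : qle (t, r, w) = vol d r * (lap d rs r)^-1 *
   (wr r * (lap d rs r * Ur phi (t, r, w)) ^+ 2 + lap d rs r * ww r * (ir r ^+ 2 * gradsq phi (t, r, w))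
    + lap d rs r * w0 r * U0 phi (t, r, w) ^+ 2).
  rewrite /qle /=; move: (wr r) (ww r) (w0 r) (Ur phi (t, r, w)) (U0 phi (t, r, w)) (gradsq phi (t, r, w)) => b1 b2 b3 b4 b5 b6.
  by field.
rewrite [leRHS]mulrCA; apply: ler_wpM2l; first by rewrite ltW // rho_gt0.
have T1 : 0 <= 2 * q2 K (sc d rs r) (ir r) (zt d rs r) * a ^+ 2.
  apply: mulr_ge0; last exact: sqr_ge0.
  rewrite mulr_ge0 // /q2 -natN mulr_ge0 ?sqr_ge0 // mulr_ge0 // mulr_ge0 // ltW //.
have T2 : 0 <= ir r ^+ 3 * zt d rs r ^+ 4 * U0 phi (t, r, w) ^+ 2.
  by rewrite mulr_ge0 ?sqr_ge0 // mulr_ge0 ?exprn_ge0 // ltW.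
have T3 : 0 <= lap d rs r * ir r ^+ 3 * (1 - kap K * sc d rs r) ^+ 2 * gradsq phi (t, r, w).
  by rewrite mulr_ge0 // mulr_ge0 ?sqr_ge0 // mulr_ge0 ?exprn_ge0 // ltW.
apply: (collect T1 T2 T3 A1 hb).
- have fu : lap d rs r * Ur phi (t, r, w) = a - N * sc d rs r * ir r * zt d rs r * U0 phi (t, r, w).
    rewrite /a /Uc /half_vol /a2 natN /lap /=.
    by move: (Ur phi (t, r, w)) (U0 phi (t, r, w)) => b1 b2; field.
  have := radial_bound y0 s01 u01 (rs_ir rs_gt0 rr) (wr_le rr) fu.
  by rewrite /q2 -natN.
- have := ler_wpM2l (mulr_ge0 (ltW l0) (mulr_ge0 (sqr_ge0 (ir r)) g0)) (ww_le rr).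
  have -> : lap d rs r * (ir r ^+ 2 * gradsq phi (t, r, w)) * ww r =
    lap d rs r * ww r * (ir r ^+ 2 * gradsq phi (t, r, w)) by rewrite mulrAC.
  have -> : lap d rs r * (ir r ^+ 2 * gradsq phi (t, r, w)) * (ir r * (1 - kap K * sc d rs r) ^+ 2) =
    lap d rs r * ir r ^+ 3 * (1 - kap K * sc d rs r) ^+ 2 * gradsq phi (t, r, w).
    by move: (gradsq _ _) => x; ring.
  exact.
- by rewrite [leRHS]mulrA; apply: ler_wpM2r (w0_le rr); exact: sqr_ge0.
Qed.

Hypothesis wave : wave_solution rs phi.

Lemma nice_qle : nice rs qle.
Proof.
have nlog : nice rs (fun p : V => (logw p.1.2)^-1).
  apply: (@nice_radial R n rs (fun r => (logw r)^-1)) => r rr; have [df h] := is_derive_logw rr.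
  have L0 : logw r != 0.
    rewrite gt_eqF // (lt_le_trans ltr01) //.
    by apply: le_trans (logw_ge rr); exact: Lam_ge1.
  have H := @isd_inv R logw r df L0 h.
  by apply/differentiable_continuous/derivable1_diffP; exact: isd_ex H.
have nsub : nice rs (fun p : V => (1 - rs * ir p.1.2)^-1).
  apply: (@nice_radial R n rs (fun r => (1 - rs * ir r)^-1)) => r rr.
  have h := isdD (isd_cst 1 r 1) (isdN (isdZ rs (is_derive_ir rs_gt0 rr))).
  have L0 : 1 - rs * ir r != 0 by rewrite gt_eqF // rs_ir_lt1.
  have H := @isd_inv R (fun r => 1 - rs * ir r) r _ L0 h.
  by apply/differentiable_continuous/derivable1_diffP; exact: isd_ex H.
by rewrite /qle /wr /ww /w0; nice_with rs_gt0 wave.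
Qed.

Lemma qle_ge0 t r w : rs < r -> 0 <= qle (t, r, w).
Proof.
move=> rr; have /andP[l0 l1] := lap_bounds d rs_gt0 rr; have y0 := ltW (ir_gt0 rs_gt0 rr).
have /andP[i0 _] := logwV_le rr; have x0 := rs_ir_lt1 rr; have w0' := vol_gt0 d rs_gt0 rr.
rewrite /qle /=; apply: mulr_ge0; last exact: ltW.
apply: addr_ge0; first apply: addr_ge0.
- rewrite mulr_ge0 ?sqr_ge0 // mulr_ge0 ?(ltW l0) // /wr mulr_ge0 ?sqr_ge0 //.
  exact: exprn_ge0.
- have g0 := gradsq_ge0 phi (t, r, w).
  apply: mulr_ge0; last by rewrite mulr_ge0 ?sqr_ge0.
  by rewrite /ww mulr_ge0 ?sqr_ge0.
- by rewrite mulr_ge0 ?sqr_ge0 // /w0 mulr_ge0 ?invr_ge0 ?(ltW x0) // mulr_ge0 ?exprn_ge0.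
Qed.

Lemma LE_normE : LE_norm_sq rs phi = (\int[spacetime]_(z in ext3 rs) (qle (to_V z))%:E)%E.
Proof.
rewrite -(ext3_tonelli nice_qle) => [|t r w rr _]; last exact: qle_ge0.
apply: eq_integral => t _; apply: eq_integral => w; rewrite inE => sw.
apply: eq_integral => r; rewrite inE /= in_itv /= andbT => rr; congr EFin.
rewrite c_rE // c_omegaE // c_0E // -[lapse n rs r]/(lap d rs r) -[r ^+ d.+2]/(vol d r).
rewrite /qle /= drE // ang_grad_sqE.
have -> : r ^- 2 = ir r ^+ 2 by rewrite /ir exprVn.
congr ((_ + _ + _ * _ ^+ 2) * _).
by rewrite /U0 ray_ext_sphere.
Qed.

End le_density.


(** * The estimate *)

Section local_energy.
Context {R : realType} (n : nat) (rs : R).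
Hypotheses (n4 : (4 <= n)%N) (rs_gt0 : 0 < rs).
Local Notation d := (n - 3)%N.
Local Notation K := (d.+2%:R : R).
Local Notation V := (R * R * 'rV[R]_n)%type.

(* the weight of the first multiplier: large enough for the coercivity *)
Let A : R := Num.max 1 ((err_const K + 2) * (16 / 3)).
Definition LE_constant : R := CL n rs * (98 * (4 * Cm K A ^+ 2)).

Lemma LE_constant_ge0 : 0 <= LE_constant.
Proof.
apply: mulr_ge0; first exact: ltW (CL_gt0 n rs_gt0).
by apply: mulr_ge0 => //; apply: mulr_ge0 => //; exact: sqr_ge0.
Qed.

Variables (phi : R -> R -> 'rV[R]_n -> R) (E : R).
Hypotheses (wave : wave_solution rs phi) (decay : vanishes_at_infinity (phi 0))
  (E0 : (energy rs phi 0 <= E%:E)%E).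

Let A1 : 1 <= A. Proof. by rewrite le_max lexx. Qed.

Let A_large : err_const K + 2 <= A * (3 / 16).
Proof.
have h : (err_const K + 2) * (16 / 3) <= A by rewrite le_max lexx orbT.
have k : 0 <= 3 / 16 :> R by rewrite divr_ge0.
by have := ler_wpM2r k h; lra.
Qed.

Theorem local_energy_bound : (LE_norm_sq rs phi <= (LE_constant * E)%:E)%E.
Proof.
rewrite LE_normE //; have nq := nice_qle rs_gt0 wave.
apply: (ext3_le nq) => [t r w rr _|T a b T0]; first exact: qle_ge0.
apply: (uncut3 (d := d) rs_gt0 nq (D := LE_constant * E * T)) => [t r w rr _|].
  exact: qle_ge0.
move=> X {}a {}b X1 ra ab hp; have X0 : 0 < X by lra.
have /andP[v0 v1] := zt_bounds d rs_gt0 (photon_sphere_gt n rs_gt0).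
pose z0 := zt d rs (photon_sphere n rs).
have z01 : 0 <= z0 <= 1 by rewrite (ltW v0).
have h := morawetz_cutoff rs_gt0 wave n4 (le_trans ler01 A1) z01 E0 decay X0 T0 ra ab hp.
pose B (q : V) := chi d rs 0 X q.1.2 * (vol d q.1.2 * (lap d rs q.1.2)^-1 * mbulk rs phi A z0 q).
have nB : nice rs B.
  have nm : nice rs (mbulk rs phi A z0) := nice_mbulk rs_gt0 wave.
  have nr : nice rs (fun q : V => vol d q.1.2 * (lap d rs q.1.2)^-1) by nice_with rs_gt0 wave.
  have nc : nice rs (fun q : V => chi d rs 0 X q.1.2) by nice_with rs_gt0 wave.
  exact: (niceM nc (niceM nr nm)).
have nc : nice rs (fun q : V => chi d rs 0 X q.1.2) by nice_with rs_gt0 wave.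
have nB2 : nice rs (fun q => CL n rs * B q) := niceM (@nice_cst _ _ _ (CL n rs)) nB.
have h1 : Q3 T a b (fun q => chi d rs 0 X q.1.2 * qle rs phi q) <= Q3 T a b (fun q => CL n rs * B q).
  apply: (@Q3_le R n rs T a b _ _ (niceM nc nq) nB2 ra) => t r w _ /andP[ar _] sw.
  rewrite /B /= [leRHS]mulrCA; apply: ler_wpM2l; first exact: chi_ge0.
  exact: (qle_bulk rs_gt0 phi n4 A1 A_large t w (lt_le_trans ra ar)).
apply: (le_trans h1); rewrite (Q3Z T b (CL n rs) nB ra).
apply: (le_trans (ler_wpM2l (ltW (CL_gt0 n rs_gt0)) h)).
by rewrite /LE_constant mulrDr !mulrA.
Qed.

Theorem uniform_energy_bound :
  (ereal_sup [set energy rs phi t | t in `[0%R, +oo[] <= E%:E)%E.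
Proof.
apply: ge_ereal_sup => _ [t t0 <-]; rewrite energyE //.
apply: (ext2_le (nice_qen rs_gt0 wave)) => [r w rr _|a b ra ab]; first exact: qen_ge0.
apply: (energy_bound rs_gt0 wave E0) => //.
by move: t0; rewrite /= in_itv /= andbT.
Qed.

End local_energy.

Theorem theorem1 (R : realType) (n : nat) (rs : R) :
  (4 <= n)%N -> 0 < rs ->
  exists2 C : R, 0 < C &
    forall phi : R -> R -> 'rV[R]_n -> R,
      wave_solution rs phi ->
      vanishes_at_infinity (phi 0) ->
      (ereal_sup [set energy rs phi t | t in `[0%R, +oo[] + LE_norm_sq rs phi
       <= C%:E * energy rs phi 0)%E.
Proof.
move=> n4 rs_gt0; have c0 := LE_constant_ge0 n rs_gt0.
exists (1 + LE_constant n rs) => [|phi wave decay]; first by rewrite ltr_pwDl.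
have C0 : 0 < 1 + LE_constant n rs by rewrite ltr_pwDl.
have e0 : (0 <= energy rs phi 0)%E.
  rewrite energyE //; apply: integral_ge0 => -[w r] [/= _]; rewrite in_itv /= andbT => rr.
  by rewrite lee_fin; exact: qen_ge0.
have [fin|] := boolP (energy rs phi 0 \is a fin_num); last first.
  rewrite ge0_fin_numE // -leNgt leye_eq => /eqP ->.
  by rewrite gt0_muley ?lte_fin // leey.
have E0 : (energy rs phi 0 <= (fine (energy rs phi 0))%:E)%E by rewrite fineK.
have h1 := uniform_energy_bound rs_gt0 wave E0.
have h2 := local_energy_bound n4 rs_gt0 wave decay E0.
rewrite -[X in (_ * X)%E](fineK fin) -EFinM mulrDl mul1r EFinD.
exact: leeD.
Qed.
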